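(* Let $\phi : (M^2 ,g) \to (N^n ,h)$ be a proper-biharmonic Riemannian immersion with $|H|^2$ constant, where $H$ is its mean curvature vector field. Assume that $M$ is compact and that its Gaussian curvature satisfies $K^{M}\geq 0$. Then $\nabla A_H =0$ and, moreover, $M$ is flat or pseudo-umbilical.
   Context: All objects are smooth; $(M^2,g)$ is a two-dimensional Riemannian manifold and $(N^n,h)$ a Riemannian manifold. The curvature convention is $R(X,Y)=[\nabla_X,\nabla_Y]-\nabla_{[X,Y]}$. For a smooth map $\phi$, $\tau(\phi)=\mathrm{trace}\,\nabla d\phi$ is the tension field, and $\phi$ is harmonic if $\tau(\phi)=0$. The map $\phi$ is biharmonic if $\mathrm{trace}(\nabla^\phi)^2\tau(\phi)-\mathrm{trace}\,R^N(d\phi(\cdot),\tau(\phi))d\phi(\cdot)=0$ (with $\nabla^\phi$ the pull-back connection on $\phi^{-1}TN$), and proper-biharmonic if it is biharmonic and not harmonic. A Riemannian immersion is an isometric immersion. $B$ is its second fundamental form, $H=\frac12\mathrm{trace}\,B$ its mean curvature vector field (so $\tau(\phi)=2H$), and $A_H$ the shape operator in the direction $H$, $\langle A_H(X),Y\rangle=\langle B(X,Y),H\rangle$. The surface (or immersion) is pseudo-umbilical if $A_H=|H|^2\,\mathrm{Id}$.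
   Formalization: M is additionally assumed connected (the usual convention for manifolds); for disconnected M the conclusion ''M is flat or pseudo-umbilical'' can fail, e.g. for a disjoint union of a flat torus and a round sphere with the same |H|. *)

(* Defs.v *)
From HB Require Import structures.
From mathcomp Require Import all_boot all_order all_algebra.
From mathcomp Require Import all_classical all_reals all_analysis.

Set Implicit Arguments.
Unset Strict Implicit.
Unset Printing Implicit Defensive.

Import Order.TTheory GRing.Theory Num.Theory.
Import numFieldNormedType.Exports.

Local Open Scope classical_set_scope.
Local Open Scope ring_scope.

(* Tensor calculus is done in charts. Tangent vectors are row vectors of
   components in the coordinate basis, so an endomorphism with matrix A sends
   X to X *m A, a bilinear form with matrix b sends (X, Y) to X *m b *m Y^T,
   and the differential of u at x is X |-> X *m 'J u x. *)

Section LocalCalculus.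
Variable R : realType.

Definition pder (W : normedModType R) (m : nat) (i : 'I_m)
  (f : 'rV[R]_m -> W) : 'rV[R]_m -> W := fun x => 'D_(delta_mx 0 i) f x.

(* C^oo on A (used for open A): every iterated partial derivative is
   Frechet differentiable at every point of A. *)
Definition smooth_on (W : normedModType R) (m : nat) (A : set 'rV[R]_m)
  (f : 'rV[R]_m -> W) : Prop :=
  forall (s : seq 'I_m) (x : 'rV[R]_m), A x ->
    differentiable (foldr (fun i h => pder i h) f s) x.

Definition inner (k : nat) (b : 'M[R]_k) (X Y : 'rV[R]_k) : R :=
  (X *m b *m Y^T) 0 0.

(* Gamma^k_ij of the metric with components g. *)
Definition christoffel (m : nat) (g : 'rV[R]_m -> 'M[R]_m) (k i j : 'I_m)
  (x : 'rV[R]_m) : R :=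
  2^-1 * \sum_(l < m) invmx (g x) k l *
    (pder i g x j l + pder j g x i l - pder l g x i j).

(* Gamma(X, Y) = nabla_X Y for X and Y with constant components. *)
Definition Gam (m : nat) (g : 'rV[R]_m -> 'M[R]_m) (x X Y : 'rV[R]_m)
  : 'rV[R]_m :=
  \row_k \sum_(i < m) \sum_(j < m) christoffel g k i j x * X 0 i * Y 0 j.

(* R(X,Y)Z = nabla_X nabla_Y Z - nabla_Y nabla_X Z - nabla_[X,Y] Z, computed
   on the extensions of X, Y, Z with constant components, so [X,Y] = 0. *)
Definition curvature (m : nat) (g : 'rV[R]_m -> 'M[R]_m)
  (x X Y Z : 'rV[R]_m) : 'rV[R]_m :=
  ('D_X (fun y => Gam g y Y Z) x + Gam g x X (Gam g x Y Z))
  - ('D_Y (fun y => Gam g y X Z) x + Gam g x Y (Gam g x X Z)).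

(* <R(d_0,d_1)d_1, d_0> / (|d_0|^2 |d_1|^2 - <d_0,d_1>^2). *)
Definition gauss_curvature (g : 'rV[R]_2 -> 'M[R]_2) (x : 'rV[R]_2) : R :=
  let e0 : 'rV[R]_2 := delta_mx 0 0 in
  let e1 : 'rV[R]_2 := delta_mx 0 1 in
  inner (g x) (curvature g x e0 e1 e1) e0 / \det (g x).

(* (nabla_{d_i} A)(d_j) = nabla_{d_i} (A d_j) - A (nabla_{d_i} d_j). *)
Definition nabla_endo (m : nat) (g A : 'rV[R]_m -> 'M[R]_m) (i j : 'I_m)
  (x : 'rV[R]_m) : 'rV[R]_m :=
  pder i (fun y => row j (A y)) x + Gam g x (delta_mx 0 i) (row j (A x))
  - Gam g x (delta_mx 0 i) (delta_mx 0 j) *m A x.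

Section AlongMap.
(* u is a map written in coordinates, g and h are the metric components of
   its source and target; sections of the pull-back bundle are functions
   'rV_m -> 'rV_n. *)
Variables (m n : nat) (g : 'rV[R]_m -> 'M[R]_m) (h : 'rV[R]_n -> 'M[R]_n).
Variable u : 'rV[R]_m -> 'rV[R]_n.

Definition trace_g (x : 'rV[R]_m) (T : 'I_m -> 'I_m -> 'rV[R]_n) : 'rV[R]_n :=
  \sum_(i < m) \sum_(j < m) invmx (g x) i j *: T i j.

(* nabla^phi_{d_i} V *)
Definition pull_nabla (i : 'I_m) (V : 'rV[R]_m -> 'rV[R]_n) (x : 'rV[R]_m)
  : 'rV[R]_n :=
  pder i V x + Gam h (u x) (pder i u x) (V x).

(* (nabla d phi)(d_i, d_j) = nabla^phi_{d_i} dphi(d_j) - dphi(nabla_{d_i} d_j);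
   for an isometric immersion this is Gauss' formula for B(d_i, d_j). *)
Definition second_form (i j : 'I_m) (x : 'rV[R]_m) : 'rV[R]_n :=
  pull_nabla i (pder j u) x
  - \sum_(k < m) Gam g x (delta_mx 0 i) (delta_mx 0 j) 0 k *: pder k u x.

Definition tension (x : 'rV[R]_m) : 'rV[R]_n :=
  trace_g x (fun i j => second_form i j x).

(* (nabla^phi)^2 V (d_i, d_j)
   = nabla^phi_{d_i} nabla^phi_{d_j} V - nabla^phi_{nabla_{d_i} d_j} V. *)
Definition pull_nabla2 (V : 'rV[R]_m -> 'rV[R]_n) (i j : 'I_m) (x : 'rV[R]_m)
  : 'rV[R]_n :=
  pull_nabla i (pull_nabla j V) x
  - \sum_(k < m) Gam g x (delta_mx 0 i) (delta_mx 0 j) 0 k *: pull_nabla k V x.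

Definition bitension (x : 'rV[R]_m) : 'rV[R]_n :=
  trace_g x (fun i j => pull_nabla2 tension i j x)
  - trace_g x (fun i j =>
      curvature h (u x) (pder i u x) (tension x) (pder j u x)).

Definition mean_curvature (x : 'rV[R]_m) : 'rV[R]_n :=
  m%:R^-1 *: trace_g x (fun i j => second_form i j x).

Definition mean_curvature_sqnorm (x : 'rV[R]_m) : R :=
  inner (h (u x)) (mean_curvature x) (mean_curvature x).

(* The solution A of A *m g = (<B(d_i, d_j), H>)_ij, that is
   <A X, Y> = <B(X, Y), H>. *)
Definition shape_H (x : 'rV[R]_m) : 'M[R]_m :=
  (\matrix_(i, j) inner (h (u x)) (second_form i j x) (mean_curvature x))
  *m invmx (g x).

End AlongMap.
End LocalCalculus.

(* The charts form a smooth atlas, not required to be maximal. chart_inv i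
   matters only on the image of chart i. *)
Record manifold (R : realType) (m : nat) := Manifold {
  points :> topologicalType;
  chart_index : Type;
  chart_dom : chart_index -> set points;
  chart : chart_index -> points -> 'rV[R]_m;
  chart_inv : chart_index -> 'rV[R]_m -> points;
  _ : hausdorff_space points;
  _ : @second_countable points;
  _ : forall p, exists i, chart_dom i p;
  _ : forall i, open (chart_dom i);
  _ : forall i, open (chart i @` chart_dom i);
  _ : forall i, {in chart_dom i, cancel (chart i) (chart_inv i)};
  _ : forall i, {within chart_dom i, continuous (chart i)};
  _ : forall i, {within chart i @` chart_dom i, continuous (chart_inv i)};
  _ : forall i j, smooth_on (chart i @` (chart_dom i `&` chart_dom j))
                    (chart j \o chart_inv i)
}.

(* The metric is given by its components metric i in each chart i, as
   functions of the coordinates; they transform as a (0,2)-tensor. *)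
Record riemannian (R : realType) (m : nat) := Riemannian {
  underlying :> manifold R m;
  metric : chart_index underlying -> 'rV[R]_m -> 'M[R]_m;
  _ : forall i, smooth_on (chart i @` chart_dom i) (metric i);
  _ : forall i x, (chart i @` chart_dom i) x -> (metric i x)^T = metric i x;
  _ : forall i x, (chart i @` chart_dom i) x ->
        forall X : 'rV[R]_m, X != 0 -> 0 < inner (metric i x) X X;
  _ : forall (i j : chart_index underlying) (x : 'rV[R]_m),
        (chart i @` (chart_dom i `&` chart_dom j)) x ->
        let t := chart j \o chart_inv i in
        metric i x = 'J t x *m metric j (t x) *m ('J t x)^T
}.

Section Global.
Variables (R : realType) (m n : nat) (M : riemannian R m) (N : riemannian R n).
Variable phi : M -> N.

Definition local_map (i : chart_index M) (a : chart_index N)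
  : 'rV[R]_m -> 'rV[R]_n :=
  chart a \o phi \o chart_inv i.

Definition local_dom (i : chart_index M) (a : chart_index N) : set 'rV[R]_m :=
  chart i @` (chart_dom i `&` phi @^-1` chart_dom a).

Definition smooth_map : Prop :=
  continuous phi /\ forall i a, smooth_on (local_dom i a) (local_map i a).

Definition immersion : Prop :=
  smooth_map /\
  forall i a x, local_dom i a x -> row_free ('J (local_map i a) x).

Definition isometric : Prop :=
  forall i a x, local_dom i a x ->
    let u := local_map i a in
    'J u x *m metric a (u x) *m ('J u x)^T = metric i x.

Definition riemannian_immersion : Prop := immersion /\ isometric.

(* The fields below are tensorial, so a condition at a point of M does not
   depend on the charts i and a around the point and its image. *)
Definition harmonic_map : Prop :=
  forall i a x, local_dom i a x ->
    tension (metric i) (metric a) (local_map i a) x = 0.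

Definition biharmonic_map : Prop :=
  forall i a x, local_dom i a x ->
    bitension (metric i) (metric a) (local_map i a) x = 0.

Definition proper_biharmonic : Prop := biharmonic_map /\ ~ harmonic_map.

Definition constant_mean_curvature_sqnorm : Prop :=
  exists c : R, forall i a x, local_dom i a x ->
    mean_curvature_sqnorm (metric i) (metric a) (local_map i a) x = c.

Definition shape_H_parallel : Prop :=
  forall i a x, local_dom i a x -> forall j k : 'I_m,
    nabla_endo (metric i) (shape_H (metric i) (metric a) (local_map i a)) j k x
    = 0.

Definition pseudo_umbilical : Prop :=
  forall i a x, local_dom i a x ->
    shape_H (metric i) (metric a) (local_map i a) x
    = (mean_curvature_sqnorm (metric i) (metric a) (local_map i a) x)%:M.

End Global.

Definition nonneg_gauss_curvature (R : realType) (M : riemannian R 2) : Prop :=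
  forall (i : chart_index M) (x : 'rV[R]_2), (chart i @` chart_dom i) x ->
    0 <= gauss_curvature (metric i) x.

Definition flat (R : realType) (M : riemannian R 2) : Prop :=
  forall (i : chart_index M) (x : 'rV[R]_2), (chart i @` chart_dom i) x ->
    gauss_curvature (metric i) x = 0.

(* Main.v *)
Require Import Defs.
From mathcomp Require Import all_boot all_order all_algebra.
From mathcomp Require Import all_classical all_reals all_analysis.
From mathcomp Require Import ring lra.
Set Implicit Arguments.
Unset Strict Implicit.
Unset Printing Implicit Defensive.
Import Order.TTheory GRing.Theory Num.Theory.
Import numFieldNormedType.Exports.
Local Open Scope classical_set_scope.
Local Open Scope ring_scope.

(** Let B be the second fundamental form, V = 2H the tension field and
    A the endomorphism A_H.  The proof is a Bochner argument for the trace-free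
    part of A, closed by the strong maximum principle instead of integration.

    The tangential part of the biharmonic equation is first order in
    b = <B, V>: since V is normal, <nabla_X V, dphi Y> = - b(X, Y), and the
    Codazzi equation turns the curvature term into derivatives of b.  What is
    left is 2 div b + (1/2) d|V|^2 - d(tr b) = 0, where tr b = |V|^2
    (inner_bitension).  When |H| is constant, b is divergence free with
    constant trace.

    On a surface this makes the trace-free part of A a holomorphic quadratic
    differential.  In an orthonormal frame with connection form w (spin_form)
    it is a pair of functions (p, q), the real and imaginary part of the Hopf
    function; with dp - 2wq and dq + 2wp as their covariant differentials,
    being divergence free is a Cauchy-Riemann equation (cauchy_riemann), and
    f = p^2 + q^2 satisfies
      Laplacian f = 2 |nabla (p, q)|^2 + 4 K f          (bochner),
    which is nonnegative because K >= 0.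

    By Cayley-Hamilton f = |H|^4 - det A, so f does not depend on charts
    (det_shape_change) and is a continuous function on M.  It attains its
    maximum since M is compact; Hopf's strong maximum principle
    (strong_maximum) makes the set where the maximum is attained open, and M is
    connected, so f is constant (det_shape_at_const).  Then both terms of the
    Bochner formula vanish: nabla A = 0 and K f = 0.  If f is not 0 then M is
    flat; if f = 0 then A = |H|^2 Id (det_shape_const).

    The local computations use three facts about the pull-back connection of a
    map: it is compatible with the metric (nab_metric), it has no torsion
    (nab_torsion), and the commutator of covariant derivatives is the curvature
    (nab_curvature).  Metric compatibility and vanishing torsion determine the
    tangential part of nabla dphi for an isometric map
    (second_fund_normal).  Applied to a change of charts, which is isometric
    between spaces of the same dimension, this gives the transformation law of
    the Christoffel symbols (second_fund_transition). *)

(** * Partial derivatives *)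

Fact seal_key : unit. Proof. exact: tt. Qed.

(** Partial derivative with a rigid head constant: when two partial derivatives
    in different directions are compared, unification would otherwise unfold
    both down to limits of filters before failing. *)
Definition pd := locked_with seal_key (@pder).
Arguments pd {R W m}.

Lemma pder_pd : @pder = @pd.
Proof. by rewrite /pd locked_withE. Qed.

Section Smooth.
Variable R : realType.

Lemma pdE (m : nat) (W : normedModType R) i (f : 'rV[R]_m -> W) x :
  pd i f x = 'D_(delta_mx 0 i) f x.
Proof. by rewrite -pder_pd. Qed.

Section PartialDerivatives.
Variables (m : nat) (A : set 'rV[R]_m) (i : 'I_m) (x : 'rV[R]_m).

Lemma near_eq_pd (W : normedModType R) (f g : 'rV[R]_m -> W) :
  open A -> A x -> (forall y, A y -> f y = g y) -> pd i f x = pd i g x.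
Proof.
move=> oA Ax fg; rewrite !pdE; apply: near_eq_derive.
by have := open_nbhs_nbhs (conj oA Ax); apply: filterS.
Qed.

Implicit Types f g : 'rV[R]_m -> R.

Lemma pd_cst (W : normedModType R) (c : W) :
  pd i (fun _ : 'rV[R]_m => c) x = 0.
Proof. by rewrite pdE; exact: (derive_cst c). Qed.

Lemma pdD (W : normedModType R) (f g : 'rV[R]_m -> W) :
  differentiable f x -> differentiable g x ->
  pd i (fun y => f y + g y) x = pd i f x + pd i g x.
Proof. by move=> df dg; rewrite !pdE deriveD//; exact: diff_derivable. Qed.

Lemma pdN (W : normedModType R) (f : 'rV[R]_m -> W) : differentiable f x ->
  pd i (fun y => - f y) x = - pd i f x.
Proof. by move=> df; rewrite !pdE deriveN//; exact: diff_derivable. Qed.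

Lemma pdB (W : normedModType R) (f g : 'rV[R]_m -> W) :
  differentiable f x -> differentiable g x ->
  pd i (fun y => f y - g y) x = pd i f x - pd i g x.
Proof. by move=> df dg; rewrite !pdE deriveB//; exact: diff_derivable. Qed.

Lemma pdM f g : differentiable f x -> differentiable g x ->
  pd i (fun y => f y * g y) x = pd i f x * g x + f x * pd i g x.
Proof.
move=> df dg; rewrite !pdE deriveM; try exact: diff_derivable.
by rewrite addrC; congr (_ + _); rewrite [LHS]mulrC.
Qed.

Lemma differentiable_inv f : differentiable f x -> f x != 0 ->
  differentiable (fun y => (f y)^-1) x.
Proof. by move=> df f0; exact: differentiableV. Qed.

Lemma pdV f : differentiable f x -> f x != 0 ->
  pd i (fun y => (f y)^-1) x = - ((f x)^-1 * (f x)^-1 * pd i f x).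
Proof.
move=> df f0; rewrite !pdE deriveV//; last exact: diff_derivable.
by rewrite [LHS]mulNr -expr2 exprVn.
Qed.

Lemma pd_sum (W : normedModType R) n (F : 'I_n -> 'rV[R]_m -> W) :
  (forall j, differentiable (F j) x) ->
  pd i (fun y => \sum_(j < n) F j y) x = \sum_(j < n) pd i (F j) x.
Proof.
move=> dF; under eq_bigr do rewrite pdE.
rewrite pdE -derive_sum => [|j]; last exact: diff_derivable.
by congr derive; apply/funext => y; rewrite fct_sumE.
Qed.

Lemma differentiable_bigsum (W : normedModType R) n (F : 'I_n -> 'rV[R]_m -> W) :
  (forall j, differentiable (F j) x) ->
  differentiable (fun y => \sum_(j < n) F j y) x.
Proof.
move=> dF; have := differentiable_sum dF.
by rewrite (_ : \sum_(j < n) F j = fun y => \sum_(j < n) F j y)//;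
  apply/funext => y; rewrite fct_sumE.
Qed.

Lemma differentiable_mx p q (F : 'rV[R]_m -> 'M[R]_(p, q)) :
  (forall a b, differentiable (fun y => F y a b) x) -> differentiable F x.
Proof.
move=> dF; rewrite (_ : F = fun y => \sum_a \sum_b F y a b *: delta_mx a b).
  by do 2 (apply: differentiable_bigsum => ?); exact: differentiableZl.
by apply/funext => y; exact: matrix_sum_delta.
Qed.

Lemma differentiable_entry p q (F : 'rV[R]_m -> 'M[R]_(p, q)) a b :
  differentiable F x -> differentiable (fun y => F y a b) x.
Proof.
move=> dF.
exact: (@differentiable_comp _ _ _ _ F (fun N : 'M[R]_(p, q) => N a b) x dF
         (differentiable_coord _ _ _)).
Qed.

Lemma pd_entry p q (F : 'rV[R]_m -> 'M[R]_(p, q)) a b :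
  differentiable F x -> pd i F x a b = pd i (fun y => F y a b) x.
Proof. by move=> dF; rewrite !pdE derive_mx ?mxE//; exact: diff_derivable. Qed.

End PartialDerivatives.

Lemma derive_pd (m : nat) (W : normedModType R) (f : 'rV[R]_m -> W) x v :
  differentiable f x -> 'D_v f x = \sum_i v 0 i *: pd i f x.
Proof.
move=> df; under eq_bigr do rewrite pdE.
rewrite deriveE// {1}(row_sum_delta v) linear_sum/=.
by apply: eq_bigr => i _; rewrite linearZ/= deriveE.
Qed.

Lemma derive_compE (m n : nat) (W : normedModType R) (f : 'rV[R]_n -> W)
    (u : 'rV[R]_m -> 'rV[R]_n) x v :
  differentiable u x -> differentiable f (u x) ->
  'D_v (fun y => f (u y)) x = 'D_('D_v u x) f (u x).
Proof.
move=> du df; rewrite !deriveE// ?(diff_comp du df)//.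
exact: differentiable_comp.
Qed.

Lemma pd_comp (m n : nat) (W : normedModType R) (f : 'rV[R]_n -> W)
    (u : 'rV[R]_m -> 'rV[R]_n) x (i : 'I_m) :
  differentiable u x -> differentiable f (u x) ->
  pd i (fun y => f (u y)) x = \sum_j pd i u x 0 j *: pd j f (u x).
Proof. by move=> du df; rewrite pdE derive_compE// derive_pd//; under eq_bigr do rewrite -pdE. Qed.

End Smooth.

(** * Smooth functions *)

Section Smooth2.
Variable R : realType.

Lemma smooth_diff (m : nat) (W : normedModType R) (A : set 'rV[R]_m)
  (f : 'rV[R]_m -> W) x : smooth_on A f -> A x -> differentiable f x.
Proof. by move=> /(_ [::] x). Qed.

Lemma smooth_pd (m : nat) (W : normedModType R) (A : set 'rV[R]_m)
  (f : 'rV[R]_m -> W) i : smooth_on A f -> smooth_on A (pd i f).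
Proof.
by move=> sf s x Ax; have := sf (rcons s i) x Ax; rewrite foldr_rcons pder_pd.
Qed.

(** Smoothness is coinductive: a class of differentiable functions that is
    closed under partial derivatives consists of smooth functions. *)
Lemma smooth_coind (m : nat) (W : normedModType R) (A : set 'rV[R]_m)
    (P : ('rV[R]_m -> W) -> Prop) :
  (forall f, P f -> forall x, A x -> differentiable f x) ->
  (forall f i, P f -> P (pd i f)) -> forall f, P f -> smooth_on A f.
Proof.
rewrite /smooth_on pder_pd => Pd Pp f Pf s; suff : P (foldr (fun i h => pd i h) f s) by move/Pd.
by elim: s => //= i s; exact: Pp.
Qed.

(** g - f vanishes near x, hence is little-o of anything there, so its
    differential is 0 and g = f + (g - f) is differentiable. *)
Lemma near_eq_differentiable (V W : normedModType R) (f g : V -> W) (x : V) :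
  (\near x, f x = g x) -> differentiable f x -> differentiable g x.
Proof.
move=> fg df; pose h := g - f.
have h0 : \forall y \near x, h y = 0.
  by apply: filterS fg => y fgy; rewrite /h !fctE fgy subrr.
have ho : h \o shift x = cst (h x) + (0 : V -> W) +o_ 0 id.
  apply/eqaddoP => _/posnumP[e]; rewrite (nbhs_singleton h0).
  have : \forall y \near 0, h (y + x) = 0.
    have := h0; rewrite (near_shift 0)/= => h0'; apply: filterS h0' => y /=.
    by have -> : x - 0 = x :> V by exact: (@subr0 V x).
  apply: filterS => y hy; rewrite [X in `|X|](_ : _ = h (y + x) - (0 + 0)) // hy addr0 subrr normr0.
  by rewrite mulr_ge0.
have d0 : 'd h x = 0 :> (V -> W).
  by apply/diff_unique => //; exact: cst_continuous.
have dh : differentiable h x.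
  by apply/diff_locallyP; rewrite d0; split => //; exact: cst_continuous.
have -> : g = f + h by rewrite /h addrC subrK.
exact: differentiableD.
Qed.

Lemma differentiable_sqrt (m : nat) (f : 'rV[R]_m -> R) x :
  differentiable f x -> 0 < f x -> differentiable (fun y => Num.sqrt (f y)) x.
Proof.
move=> df f0; apply: (@differentiable_comp _ _ _ _ f Num.sqrt) => //.
by apply/derivable1_diffP; case: (is_derive1_sqrt f0).
Qed.

Lemma pd_sqrt (m : nat) (f : 'rV[R]_m -> R) i x :
  differentiable f x -> 0 < f x ->
  pd i (fun y => Num.sqrt (f y)) x = (2 * Num.sqrt (f x))^-1 * pd i f x.
Proof.
move=> df f0.
have ds : differentiable (Num.sqrt : R -> R) (f x).
  by apply/derivable1_diffP; case: (is_derive1_sqrt f0).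
rewrite !pdE !deriveE//; last exact: differentiable_sqrt.
rewrite (diff_comp df ds)/= -(derive_sqrt f0) deriveE// mulrC.
rewrite -[X in _ = X]/(_ *: _ : R) -linearZ/=; congr ('d _ _ _).
by rewrite [RHS]mulr1.
Qed.

Section Closure.
Variables (m : nat) (A : set 'rV[R]_m).
Hypothesis oA : open A.
Implicit Types f g : 'rV[R]_m -> R.

(** The class to which coinduction is applied.  Closing under all operations at
    once lets a single induction prove that each of them preserves smoothness:
    the derivative of a product, an inverse or a composite is again in the class,
    whereas for one operation alone it is not. *)
Inductive generated : ('rV[R]_m -> R) -> Prop :=
| gen_base f : smooth_on A f -> generated f
| gen_eq f g : generated f -> (forall x, A x -> f x = g x) -> generated g
| gen_cst c : generated (fun _ => c)
| gen_add f g : generated f -> generated g -> generated (fun x => f x + g x)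
| gen_mul f g : generated f -> generated g -> generated (fun x => f x * g x)
| gen_inv f : generated f -> (forall x, A x -> f x != 0) ->
    generated (fun x => (f x)^-1)
| gen_sqrt f : generated f -> (forall x, A x -> 0 < f x) ->
    generated (fun x => Num.sqrt (f x))
| gen_comp n (B : set 'rV[R]_n) (f : 'rV[R]_n -> R) (u : 'rV[R]_m -> 'rV[R]_n) :
    (forall j, smooth_on A (fun x => u x 0 j)) ->
    smooth_on B f -> (forall x, A x -> B (u x)) ->
    generated (fun x => f (u x)).

Lemma near_open (T : Type) (f g : 'rV[R]_m -> T) x : A x -> (forall y, A y -> f y = g y) ->
  \near x, f x = g x.
Proof. by move=> Ax fg; have := open_nbhs_nbhs (conj oA Ax); exact: filterS. Qed.

Lemma generated_diff f : generated f -> forall x, A x -> differentiable f x.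
Proof.
elim => {f} [f sf|f g _ df fg|c|f g _ df _ dg|f g _ df _ dg|f _ df f0
            |f _ df f0|n B f u su sf uAB] x Ax.
- exact: smooth_diff sf Ax.
- by apply: near_eq_differentiable (df _ Ax); exact: near_open.
- exact: differentiable_cst.
- by apply: differentiableD; [exact: df|exact: dg].
- by apply: differentiableM; [exact: df|exact: dg].
- by apply: differentiable_inv; [exact: df|exact: f0].
- by apply: differentiable_sqrt; [exact: df|exact: f0].
- apply: (@differentiable_comp _ _ _ _ u f); last exact: smooth_diff sf (uAB _ Ax).
  by apply: differentiable_mx => a b; rewrite ord1; exact: smooth_diff (su b) Ax.
Qed.

Lemma generated_sum n (F : 'I_n -> 'rV[R]_m -> R) :
  (forall j, generated (F j)) -> generated (fun x => \sum_j F j x).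
Proof.
elim: n F => [|n IH] F gF.
  by under eq_fun do rewrite big_ord0; exact: gen_cst.
by under eq_fun do rewrite big_ord_recl; apply: gen_add => //; exact: IH.
Qed.

(** Every differentiation rule expresses the derivative through members of the
    class, up to equality on the open set A. *)
Lemma generated_pd f i : generated f -> generated (pd i f).
Proof.
elim => {f} [f sf|f g _ df fg|c|f g cf df cg dg|f g cf df cg dg|f cf df f0
            |f cf df f0|n B f u su sf uAB].
- exact/gen_base/smooth_pd.
- by apply: gen_eq df _ => x Ax; exact: near_eq_pd fg.
- by apply: gen_eq (gen_cst 0) _ => x _; rewrite pd_cst.
- apply: gen_eq (gen_add df dg) _ => x Ax.
  by rewrite pdD//; [exact: generated_diff cf _ Ax|exact: generated_diff cg _ Ax].
- apply: gen_eq (gen_add (gen_mul df cg) (gen_mul cf dg)) _ => x Ax.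
  by rewrite pdM//; [exact: generated_diff cf _ Ax|exact: generated_diff cg _ Ax].
- have gi := gen_inv cf f0.
  apply: gen_eq (gen_mul (gen_cst (-1)) (gen_mul (gen_mul gi gi) df)) _ => x Ax.
  by rewrite pdV ?mulN1r//; [exact: generated_diff cf _ Ax|exact: f0].
- have gi : generated (fun x => (2 * Num.sqrt (f x))^-1).
    apply: gen_inv => [|x Ax]; first by apply: gen_mul; [exact: gen_cst|exact: gen_sqrt].
    by rewrite mulf_neq0// gt_eqF// sqrtr_gt0 f0.
  apply: gen_eq (gen_mul gi df) _ => x Ax.
  by rewrite pd_sqrt//; [exact: generated_diff cf _ Ax|exact: f0].
- have gs : generated (fun x => \sum_j pd i (fun y => u y 0 j) x * pd j f (u x)).
    apply: generated_sum => j; apply: gen_mul.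
      exact/gen_base/smooth_pd.
    exact: gen_comp su (smooth_pd j sf) uAB.
  apply: gen_eq gs _ => x Ax.
  have du : differentiable u x.
    by apply: differentiable_mx => a b; rewrite ord1; exact: smooth_diff (su b) Ax.
  rewrite pd_comp//; last exact: smooth_diff sf (uAB _ Ax).
  by apply: eq_bigr => j _; rewrite pd_entry.
Qed.

Lemma generated_smooth f : generated f -> smooth_on A f.
Proof.
move: f; apply: smooth_coind => [|f i]; first exact: generated_diff.
exact: generated_pd.
Qed.

Lemma smooth_eq f g : smooth_on A f -> (forall x, A x -> f x = g x) ->
  smooth_on A g.
Proof. by move=> sf fg; apply: generated_smooth; apply: gen_eq fg; exact: gen_base. Qed.

Lemma smooth_cst (c : R) : smooth_on A (fun _ => c).
Proof. exact/generated_smooth/gen_cst. Qed.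

Lemma smoothD f g : smooth_on A f -> smooth_on A g ->
  smooth_on A (fun x => f x + g x).
Proof. by move=> *; apply/generated_smooth/gen_add; exact: gen_base. Qed.

Lemma smoothM f g : smooth_on A f -> smooth_on A g ->
  smooth_on A (fun x => f x * g x).
Proof. by move=> *; apply/generated_smooth/gen_mul; exact: gen_base. Qed.

Lemma smoothN f : smooth_on A f -> smooth_on A (fun x => - f x).
Proof.
move=> sf; apply: (@smooth_eq (fun x => -1 * f x)); last by move=> *; rewrite mulN1r.
exact: smoothM (smooth_cst _) sf.
Qed.

Lemma smoothB f g : smooth_on A f -> smooth_on A g ->
  smooth_on A (fun x => f x - g x).
Proof. by move=> sf sg; apply: smoothD => //; exact: smoothN. Qed.

Lemma smoothV f : smooth_on A f -> (forall x, A x -> f x != 0) ->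
  smooth_on A (fun x => (f x)^-1).
Proof. by move=> *; apply/generated_smooth/gen_inv => //; exact: gen_base. Qed.

Lemma smooth_sqrt f : smooth_on A f -> (forall x, A x -> 0 < f x) ->
  smooth_on A (fun x => Num.sqrt (f x)).
Proof. by move=> *; apply/generated_smooth/gen_sqrt => //; exact: gen_base. Qed.

Lemma smooth_sum n (F : 'I_n -> 'rV[R]_m -> R) :
  (forall j, smooth_on A (F j)) -> smooth_on A (fun x => \sum_j F j x).
Proof. by move=> *; apply/generated_smooth/generated_sum => ?; exact: gen_base. Qed.

Lemma smooth_mx p q (F : 'rV[R]_m -> 'M[R]_(p, q)) :
  (forall a b, smooth_on A (fun x => F x a b)) -> smooth_on A F.
Proof.
move=> sF; apply: (@smooth_coind _ _ _ (fun F : 'rV[R]_m -> 'M[R]_(p, q) =>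
   forall a b, smooth_on A (fun x => F x a b))) => // {sF}F.
  by move=> sF x Ax; apply: differentiable_mx => a b; exact: smooth_diff (sF a b) Ax.
move=> i sF a b; apply: smooth_eq (smooth_pd i (sF a b)) _ => x Ax.
rewrite pd_entry//; apply: differentiable_mx => a' b'.
exact: smooth_diff (sF a' b') Ax.
Qed.

Lemma smooth_entry p q (F : 'rV[R]_m -> 'M[R]_(p, q)) a b :
  smooth_on A F -> smooth_on A (fun x => F x a b).
Proof.
rewrite /smooth_on pder_pd => sF s.
suff H : forall x, A x -> foldr (fun i h => pd i h) (fun x => F x a b) s x
    = (foldr (fun i h => pd i h) F s) x a b.
  move=> x Ax; apply: near_eq_differentiable (differentiable_entry a b (sF s x Ax)).
  by apply: near_open => // y Ay; rewrite H.
elim: s => //= i s IH x Ax.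
rewrite (near_eq_pd i oA Ax IH) pd_entry//; exact: sF.
Qed.

Lemma smooth_comp n (B : set 'rV[R]_n) (f : 'rV[R]_n -> R) (u : 'rV[R]_m -> 'rV[R]_n) :
  smooth_on A u -> smooth_on B f -> (forall x, A x -> B (u x)) ->
  smooth_on A (fun x => f (u x)).
Proof.
move=> su sf uAB; apply/generated_smooth/gen_comp; [|exact: sf|exact: uAB].
by move=> j; exact: smooth_entry.
Qed.

End Closure.
End Smooth2.

(** * Symmetry of second derivatives *)

Section Schwarz.
Variables (R : realType) (m : nat).
Implicit Types (f : 'rV[R]_m -> R) (x v : 'rV[R]_m).

Lemma is_derive_line f x v (t : R) : differentiable f (x + t *: v) ->
  is_derive t 1 (fun s : R => f (x + s *: v)) ('D_v f (x + t *: v)).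
Proof.
move=> df; pose l (s : R) : 'rV[R]_m := x + s *: v.
have dl : differentiable l t.
  by apply: differentiableD; [exact: differentiable_cst|exact: differentiableZl].
have Dl : 'D_1 l t = v.
  rewrite /l deriveD ?derive_cst ?add0r//; last first.
    by apply: diff_derivable; exact: differentiableZl.
  by rewrite deriveE; [rewrite diffZl// diff_val scale1r|exact: differentiableZl].
have dfl : differentiable (f \o l) t by exact: differentiable_comp.
apply: DeriveDef; first exact: diff_derivable.
have -> : 'D_v f (x + t *: v) = 'D_('D_1 l t) f (l t) by rewrite Dl.
by rewrite !deriveE// -[fun s : R => _]/(f \o l) (diff_comp dl df).
Qed.

Lemma MVT_line f x v (t : R) : 0 < t ->
  (forall s, 0 <= s <= t -> differentiable f (x + s *: v)) ->
  exists2 s, 0 < s < t & f (x + t *: v) - f x = t * 'D_v f (x + s *: v).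
Proof.
move=> t0 df.
have [s st E] : exists2 s, s \in `]0, t[%R & f (x + t *: v) - f (x + 0 *: v) =
    'D_v f (x + s *: v) * (t - 0).
  apply: (@MVT _ (fun s => f (x + s *: v))) => // [s|].
    by rewrite in_itv/= => /andP[s0 st]; apply: is_derive_line; apply: df; rewrite !ltW.
  apply: derivable_within_continuous => s; rewrite in_itv/= => st.
  by have [] := is_derive_line (df _ st).
exists s; first by move: st; rewrite in_itv.
by rewrite mulrC -[X in _ * X]subr0 -E scale0r addr0.
Qed.

(** Two applications of the mean value theorem: along e_i to the first
    difference y |-> f (y + t e_j) - f y, then along e_j to d_i f. *)
Lemma second_difference f x i j (t : R) : 0 < t ->
  (forall a b, 0 <= a <= t -> 0 <= b <= t ->
    differentiable f (x + a *: delta_mx 0 i + b *: delta_mx 0 j) /\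
    differentiable (pd i f) (x + a *: delta_mx 0 i + b *: delta_mx 0 j)) ->
  exists a b, [/\ 0 <= a <= t, 0 <= b <= t &
    f (x + t *: delta_mx 0 i + t *: delta_mx 0 j) - f (x + t *: delta_mx 0 i)
     - f (x + t *: delta_mx 0 j) + f x
    = t * (t * pd j (pd i f) (x + a *: delta_mx 0 i + b *: delta_mx 0 j))].
Proof.
move=> t0 df; set ei := delta_mx 0 i; set ej := delta_mx 0 j.
have t00 : (0 : R) <= 0 <= t by rewrite lexx ltW.
have tt : 0 <= t <= t by rewrite lexx ltW.
pose sh (y : 'rV[R]_m) := y + t *: ej.
have dsh y : differentiable sh y.
  by apply: differentiableD => //; exact: differentiable_cst.
have Dsh y v : 'D_v sh y = v.
  rewrite /sh deriveD//; try exact: diff_derivable.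
  by rewrite derive_cst addr0 derive_id.
pose g y := f (sh y) - f y.
have dg a : 0 <= a <= t -> differentiable f (sh (x + a *: ei)) /\ differentiable f (x + a *: ei).
  move=> at0; split; first by have [] := df a t at0 tt.
  by have [] := df a 0 at0 t00; rewrite scale0r addr0.
have dg' a : 0 <= a <= t -> differentiable (fun y => f (sh y)) (x + a *: ei).
  by move=> /dg[h _]; apply: (@differentiable_comp _ _ _ _ sh f).
have [a a0 Ea] : exists2 s, 0 < s < t & g (x + t *: ei) - g x = t * 'D_ei g (x + s *: ei).
  apply: MVT_line => // s s0; apply: differentiableB; first exact: dg'.
  by have [] := dg s s0.
have {}a0 : 0 <= a <= t by case/andP: a0 => *; rewrite !ltW.
have [b b0 Eb] : exists2 s, 0 < s < t & pd i f (x + a *: ei + t *: ej) - pd i f (x + a *: ei)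
   = t * 'D_ej (pd i f) (x + a *: ei + s *: ej).
  by apply: MVT_line => // s s0; have [] := df a s a0 s0.
have {}b0 : 0 <= b <= t by case/andP: b0 => *; rewrite !ltW.
exists a, b; split => //.
move: Ea; rewrite /g /sh {1}deriveB; last 2 first.
- by apply: diff_derivable; exact: dg'.
- by apply: diff_derivable; have [] := dg a a0.
rewrite derive_compE//; last by have [] := dg a a0.
rewrite Dsh -!pdE Eb.
rewrite -pdE => <-.
by ring.
Qed.

(** The second difference is symmetric in i and j, so second_difference gives
    d_j d_i f and d_i d_j f the same value at two points of any small cube at x;
    both derivatives are continuous at x. *)
Lemma pdC (A : set 'rV[R]_m) f i j x : open A -> smooth_on A f -> A x ->
  pd i (pd j f) x = pd j (pd i f) x.
Proof.
move=> oA sf Ax; apply/eqP/negPn/negP => nE.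
set c1 := pd i (pd j f) x in nE; set c2 := pd j (pd i f) x in nE.
pose e := `|c1 - c2| / 2.
have e0 : 0 < e by rewrite divr_gt0// normr_gt0 subr_eq0.
have near_c k l : \forall y \near x, `|pd k (pd l f) x - pd k (pd l f) y| < e.
  have /differentiable_continuous := smooth_diff (smooth_pd k (smooth_pd l sf)) Ax.
  by move=> /cvgrPdist_lt; exact.
have /nbhs_ballP[r /= r0 Br] : \forall y \near x, [/\ A y, `|c1 - pd i (pd j f) y| < e
    & `|c2 - pd j (pd i f) y| < e].
  have nA := open_nbhs_nbhs (conj oA Ax).
  have nB := near_c i j.
  have nC := near_c j i.
  move: nA nB nC; apply: filterS3 => y Ay h1 h2.
  exact: And3 Ay h1 h2.
pose t := r / 3.
have t0 : 0 < t by rewrite divr_gt0.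
have inB k l a b : 0 <= a <= t -> 0 <= b <= t ->
    ball x r (x + a *: delta_mx 0 k + b *: delta_mx 0 l).
  move=> /andP[a0 at_] /andP[b0 bt].
  rewrite -ball_normE/= -addrA opprD addrA subrr sub0r normrN.
  have n1 (k' : 'I_m) : `|(delta_mx 0 k' : 'rV[R]_m)| <= 1.
    rewrite [leLHS]/Num.Def.normr/= mx_normrE; apply: bigmax_le => // -[u v] _ /=.
    by rewrite mxE; case: (_ && _); rewrite ?normr1 ?normr0.
  rewrite (le_lt_trans (ler_normD _ _))// !normrZ !ger0_norm//.
  rewrite (@le_lt_trans _ _ (t + t))//; last by rewrite /t; lra.
  by apply: lerD; rewrite -[leRHS]mulr1 ler_pM.
have dB k l a b : 0 <= a <= t -> 0 <= b <= t -> 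
    differentiable f (x + a *: delta_mx 0 k + b *: delta_mx 0 l) /\
    differentiable (pd k f) (x + a *: delta_mx 0 k + b *: delta_mx 0 l).
  move=> a0 b0; have [Ay _ _] := Br _ (inB k l a b a0 b0).
  by split; [exact: smooth_diff Ay|exact: smooth_diff (smooth_pd k sf) Ay].
have [a [b [a0 b0 E1]]] := second_difference t0 (dB i j).
have [a' [b' [a0' b0' E2]]] := second_difference t0 (dB j i).
have [_ _ B1] := Br _ (inB i j a b a0 b0).
have [_ B2 _] := Br _ (inB j i a' b' a0' b0').
have E : pd j (pd i f) (x + a *: delta_mx 0 i + b *: delta_mx 0 j) =
   pd i (pd j f) (x + a' *: delta_mx 0 j + b' *: delta_mx 0 i).
  apply: (mulfI (lt0r_neq0 t0)); apply: (mulfI (lt0r_neq0 t0)).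
  apply: etrans (esym E1) _; apply: etrans _ E2.
  rewrite [x + t *: delta_mx 0 j + _]addrAC; congr (_ + _).
  by rewrite -!addrA; congr (_ + _); rewrite addrC.
rewrite E in B1.
have : `|c1 - c2| < e + e.
  set c3 := pd i (pd j f) (_ + _ + _) in B1 B2.
  move: (c1) (c2) (c3) (e) B1 B2 => d1 d2 d3 e1 B1 B2.
  clear -B1 B2.
  rewrite -(subrKA d3).
  by rewrite (le_lt_trans (ler_normD _ _))// ltrD// distrC.
by rewrite /e -splitr ltxx.
Qed.

End Schwarz.

(** * Derivatives at an interior maximum *)

Section MaxTest.
Variables (R : realType) (m : nat) (U : set 'rV[R]_m) (f : 'rV[R]_m -> R).
Hypotheses (oU : open U) (sf : smooth_on U f).

Lemma near0_line (P : set 'rV[R]_m) (z w : 'rV[R]_m) : nbhs z P ->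
  exists2 t : R, 0 < t & forall s, `|s| <= t -> P (z + s *: w).
Proof.
move=> zP.
have cl : {for (0 : R), continuous (fun s : R => z + s *: w)}.
  by apply: continuousD; [exact: cst_continuous|exact: scalel_continuous].
have /cl : nbhs (z + 0 *: w) P by rewrite scale0r addr0.
rewrite nbhs_simpl/= => /nbhs_ballP[r /= r0 Br]; exists (r / 2); first by rewrite divr_gt0.
move=> s sr; apply: Br; rewrite -ball_normE/= sub0r normrN (le_lt_trans sr)//.
by rewrite ltr_pdivrMr// ltr_pMr// ltr1n.
Qed.

Lemma gradient_at_max z i : U z -> (\forall y \near z, f y <= f z) ->
  pd i f z = 0.
Proof.
move=> Uz zmax.
have := open_nbhs_nbhs (conj oU Uz) => nU.
have [t t0 Pt] := near0_line (delta_mx 0 i) (filterI nU zmax).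
have inI s : s \in `](- t), t[%R -> `|s| <= t.
  by rewrite in_itv/= ler_norml => /andP[? ?]; rewrite !ltW.
have D0 : is_derive (0 : R) (1 : R) (fun s : R => f (z + s *: delta_mx 0 i)) (0 : R).
  apply: (@derive1_at_max _ _ (- t) t).
  - by rewrite (@le_trans _ _ 0)// ?oppr_le0 ltW.
  - move=> s /inI /Pt[Us _].
    by have [] := is_derive_line (smooth_diff sf Us).
  - by rewrite in_itv/= oppr_lt0 t0.
  - by move=> s /inI /Pt[_]; rewrite scale0r addr0.
have U0 : U (z + (0 : R) *: delta_mx 0 i) by rewrite scale0r addr0.
have := @derive_val _ _ _ _ _ _ _ D0.
have [_ ->] := is_derive_line (smooth_diff sf U0).
by rewrite scale0r addr0 pdE.
Qed.

(** If the second derivative of f along w were positive, then D_w f, which is 0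
    at z, would be positive at z + s w for all small s > 0, and f would exceed
    f z there by the mean value theorem. *)
Lemma hessian_at_max z (w : 'rV[R]_m) : U z -> (\forall y \near z, f y <= f z) ->
  \sum_i \sum_j w 0 j * w 0 i * pd j (pd i f) z <= 0.
Proof.
move=> Uz zmax; rewrite leNgt; apply/negP => H.
have nU := open_nbhs_nbhs (conj oU Uz).
pose g y := \sum_i w 0 i * pd i f y.
have sg : smooth_on U g.
  apply: smooth_sum => // i; apply: smoothM => //; first exact: smooth_cst.
  exact: smooth_pd.
have g0 : g z = 0.
  by rewrite /g big1// => i _; rewrite gradient_at_max// mulr0.
have Dg : 0 < 'D_w g z.
  rewrite derive_pd; last exact: smooth_diff sg Uz.
  apply: lt_le_trans H _; rewrite exchange_big/= le_eqVlt; apply/orP; left; apply/eqP.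
  apply: eq_bigr => j _; rewrite /g pd_sum => [|i]; last first.
    apply: differentiableM; first exact: differentiable_cst.
    exact: smooth_diff (smooth_pd i sf) Uz.
  rewrite -[RHS]/(_ * _) mulr_sumr; apply: eq_bigr => i _.
  rewrite pdM; last 2 first.
  - exact: differentiable_cst.
  - exact: smooth_diff (smooth_pd i sf) Uz.
  by rewrite pd_cst mul0r add0r mulrA.
have dg : derivable g z w by apply: diff_derivable; exact: smooth_diff sg Uz.
have [r r0 gpos] : exists2 r : R, 0 < r & forall s, 0 < s -> s < r -> 0 < g (z + s *: w).
  have : \forall s \near (0:R)^', 0 < s^-1 *: (g (s *: w + z) - g z).
    exact: (cvgr_gt _ dg).
  move=> /nbhs_ballP[r /= r0 Br]; exists r => // s s0 sr.
  have : 0 < s^-1 *: (g (s *: w + z) - g z).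
    apply: Br; last by rewrite gt_eqF.
    by rewrite -ball_normE/= sub0r normrN gtr0_norm.
  by rewrite g0 subr0 addrC -[_ *: _]/(_ * _) pmulr_rgt0// invr_gt0.
have [t t0 Pt] := near0_line w (filterI nU zmax).
pose t' := Num.min t (r / 2).
have t'0 : 0 < t' by rewrite lt_min t0 divr_gt0.
have t't : t' <= t by rewrite ge_min lexx.
have t'r : t' < r.
  rewrite (@le_lt_trans _ _ (r / 2)) ?ge_min ?lexx ?orbT//.
  by rewrite ltr_pdivrMr// ltr_pMr// ltr1n.
have dft s : 0 <= s <= t' -> differentiable f (z + s *: w).
  move=> /andP[s0 st]; have [|Us _] := Pt s; last exact: smooth_diff sf Us.
  by rewrite ger0_norm// (le_trans st).
have [s /andP[s0 st] E] := MVT_line t'0 dft.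
have [|_] := Pt t'; first by rewrite gtr0_norm.
rewrite leNgt -subr_gt0 E derive_pd; last by apply: dft; rewrite !ltW.
by rewrite pmulr_rgt0// gpos// (lt_trans st).
Qed.

End MaxTest.

(** * Second-order operators and a barrier function *)

Lemma ord2 (k : 'I_2) : k = 0 \/ k = 1.
Proof. by case: k => -[|[|//]] k; [left|right]; exact/val_inj. Qed.

Section StrongMax.
Variable R : realType.
Implicit Types (U : set 'rV[R]_2) (f v : 'rV[R]_2 -> R) (x y z : 'rV[R]_2).

Lemma sum_ord2 (V : zmodType) (F : 'I_2 -> V) : \sum_i F i = F 0 + F 1.
Proof.
rewrite big_ord_recl big_ord_recl big_ord0 addr0; congr (F _ + F _);
exact/val_inj.
Qed.

Definition second_order (a b c b0 b1 : 'rV[R]_2 -> R) v x : R :=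
  a x * pd 0 (pd 0 v) x + 2 * b x * pd 0 (pd 1 v) x
  + c x * pd 1 (pd 1 v) x + b0 x * pd 0 v x + b1 x * pd 1 v x.

(** Multiplied by a, the principal part is (ac - b^2) d_11 v plus the second
    derivative of v along the constant vector (a z, b z), so only two
    directional second derivatives have to be nonpositive. *)
Lemma second_order_at_max U (a b c b0 b1 : 'rV[R]_2 -> R) v z : open U -> smooth_on U v -> U z ->
  0 < a z -> b z ^+ 2 < a z * c z -> (\forall y \near z, v y <= v z) ->
  second_order a b c b0 b1 v z <= 0.
Proof.
move=> oU sv Uz a0 D0 zmax.
have G k := gradient_at_max oU sv k Uz zmax.
pose w1 : 'rV[R]_2 := \row_j (j == 1)%:R.
pose w2 : 'rV[R]_2 := \row_j (if j == 0 then a z else b z).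
have := hessian_at_max oU sv w1 Uz zmax; have := hessian_at_max oU sv w2 Uz zmax.
rewrite !sum_ord2 /second_order (G 0) (G 1) (pdC 1 0 oU sv Uz).
rewrite !mxE/=.
move: (pd 0 (pd 0 v) z) (pd 0 (pd 1 v) z) (pd 1 (pd 1 v) z) => p q r.
rewrite /= => h2 h1.
have r0 : r <= 0 by move: h1; lra.
rewrite -(@pmulr_rle0 _ (a z))//.
have -> : a z * (a z * p + 2 * b z * q + c z * r + b0 z * 0 + b1 z * 0)
  = (a z * c z - b z ^+ 2) * r + (a z * a z * p + (b z * a z) * q + ((a z * b z) * q + b z * b z * r)) by ring.
have : (a z * c z - b z ^+ 2) * r <= 0 by rewrite mulr_ge0_le0// subr_ge0 ltW.
move: h2; lra.
Qed.

Definition sqdist y x : R := (x 0 0 - y 0 0) ^+ 2 + (x 0 1 - y 0 1) ^+ 2.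

Lemma coord_diff k x : differentiable (fun x : 'rV[R]_2 => x 0 k) x.
Proof. exact: differentiable_coord. Qed.

Lemma pd_coord (k i : 'I_2) x : pd i (fun x : 'rV[R]_2 => x 0 k) x = (k == i)%:R.
Proof.
by rewrite -(@pd_entry _ _ _ _ 1 2 (fun x => x))// pdE derive_id mxE eqxx.
Qed.

Lemma smooth_coord U k : smooth_on U (fun x : 'rV[R]_2 => x 0 k).
Proof.
apply: (@smooth_coind _ _ _ _ (fun f : 'rV[R]_2 -> R =>
  f = (fun x : 'rV[R]_2 => x 0 k) \/ exists c, f = cst c)); last by left.
  by move=> _ [->|[c ->]] x _; [exact: coord_diff|exact: differentiable_cst].
move=> _ i [->|[c ->]]; right.
  by exists (k == i)%:R; apply/funext => x; exact: pd_coord.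
by exists 0; apply/funext => x; exact: pd_cst.
Qed.

Lemma smooth_sqdist U y (oU : open U) : smooth_on U (sqdist y).
Proof.
by rewrite /sqdist; under eq_fun do rewrite !expr2;
 apply: smoothD => //; apply: smoothM => //; apply: smoothB => //;
  (apply: smooth_coord || apply: smooth_cst).
Qed.

Lemma pd_sqdist y k : pd k (sqdist y) = fun x => 2 * (x 0 k - y 0 k).
Proof.
apply/funext => x.
have dc j : differentiable (fun x : 'rV[R]_2 => x 0 j - y 0 j) x.
  by apply: differentiableB; [exact: coord_diff|exact: differentiable_cst].
have pc j : pd k (fun x : 'rV[R]_2 => x 0 j - y 0 j) x = (j == k)%:R.
  rewrite (pdB k (coord_diff j x) (differentiable_cst (y 0 j) x)).
  by rewrite pd_coord pd_cst subr0.
rewrite /sqdist; under [X in pd _ X]eq_fun do rewrite !expr2.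
rewrite pdD ?pdM ?pc//; do ?[exact: differentiableM].
case: k {pc} => -[|[|//]] /= k2.
  rewrite (_ : Ordinal k2 = 0); last exact/val_inj.
  by rewrite /= ; ring.
rewrite (_ : Ordinal k2 = 1); last exact/val_inj.
by rewrite /= ; ring.
Qed.

(** With s = r - |x - y|^2, which is positive inside the circle of radius
    sqrt r around y, this is s + A s^2 - |x - z|^2.  The quadratic term makes
    Lw large where the gradient of s is not 0, whatever the sign of Ls; the last
    term makes w negative on the circle away from its point z. *)
Definition barrier (r A : R) y z x : R :=
  (r - sqdist y x) + A * (r - sqdist y x) ^+ 2 - sqdist z x.

Lemma smooth_barrier U r A y z (oU : open U) : smooth_on U (barrier r A y z).
Proof.
rewrite /barrier; under eq_fun do rewrite expr2.
by do ?[apply: smooth_cst|apply: smooth_coord|apply: smoothB|apply: smoothD|apply: smoothM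
       |apply: smooth_sqdist].
Qed.

Lemma pd_barrier r A y z k : pd k (barrier r A y z) = fun x =>
  - ((1 + 2 * A * (r - sqdist y x)) * (2 * (x 0 k - y 0 k))) - 2 * (x 0 k - z 0 k).
Proof.
apply/funext => x; rewrite /barrier; under [X in pd _ X]eq_fun do rewrite expr2.
have dq p : differentiable (sqdist p) x by exact: smooth_diff (smooth_sqdist p openT) I.
have dr : differentiable (fun x => r - sqdist y x) x.
  by apply: differentiableB => //; exact: differentiable_cst.
have d2 : differentiable (fun x => (r - sqdist y x) * (r - sqdist y x)) x by exact: differentiableM.
have d3 : differentiable (fun x => A * ((r - sqdist y x) * (r - sqdist y x))) x.
  by apply: differentiableM => //; exact: differentiable_cst.
have pr : pd k (fun x => r - sqdist y x) x = - (2 * (x 0 k - y 0 k)).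
  by rewrite pdB// ?pd_sqdist ?pd_cst ?sub0r//; exact: differentiable_cst.
rewrite pdB//; last exact: differentiableD.
rewrite pdD// pdM//; try exact: differentiable_cst.
by rewrite pdM// pd_cst pr pd_sqdist; ring.
Qed.

(** The derivative of s is -2 (x - y), and 1 + 2 A s is the derivative of
    s + A s^2 with respect to s. *)
Lemma pd2_barrier r A y z k j x : pd j (pd k (barrier r A y z)) x =
  2 * A * (2 * (x 0 j - y 0 j)) * (2 * (x 0 k - y 0 k))
  - 2 * (1 + 2 * A * (r - sqdist y x)) * (k == j)%:R - 2 * (k == j)%:R.
Proof.
rewrite pd_barrier.
have dq p : differentiable (sqdist p) x by exact: smooth_diff (smooth_sqdist p openT) I.
have dc p : differentiable (fun x : 'rV[R]_2 => 2 * (x 0 k - p 0 k)) x.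
  apply: differentiableM; first exact: differentiable_cst.
  by apply: differentiableB; [exact: coord_diff|exact: differentiable_cst].
have pc (p : 'rV[R]_2) : pd j (fun x : 'rV[R]_2 => 2 * (x 0 k - p 0 k)) x = 2 * (k == j)%:R.
  have db : differentiable (fun x : 'rV[R]_2 => x 0 k - p 0 k) x.
    by apply: differentiableB; [exact: coord_diff|exact: differentiable_cst].
  rewrite pdM//; try exact: differentiable_cst.
  rewrite pdB//; try exact: coord_diff.
  by rewrite pd_coord !pd_cst; ring.
have dr : differentiable (fun x => r - sqdist y x) x.
  by apply: differentiableB => //; exact: differentiable_cst.
have d2 : differentiable (fun x => 2 * A * (r - sqdist y x)) x.
  by apply: differentiableM => //; exact: differentiable_cst.
have d3 : differentiable (fun x => 1 + 2 * A * (r - sqdist y x)) x.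
  by apply: differentiableD => //; exact: differentiable_cst.
have d4 : differentiable (fun x => (1 + 2 * A * (r - sqdist y x)) * (2 * (x 0 k - y 0 k))) x.
  exact: differentiableM.
rewrite pdB//; last exact: differentiableN.
rewrite pdN// pdM// pdD//; try exact: differentiable_cst.
rewrite pdM//; try exact: differentiable_cst.
rewrite pdB//; try exact: differentiable_cst.
by rewrite !pd_cst pd_sqdist !pc; ring.
Qed.

Lemma second_order_barrier A y z a b c b0 b1 :
  second_order a b c b0 b1 (barrier (sqdist y z) A y z) z =
  2 * A * (4 * (a z * (z 0 0 - y 0 0) ^+ 2 + 2 * b z * (z 0 0 - y 0 0) * (z 0 1 - y 0 1)
    + c z * (z 0 1 - y 0 1) ^+ 2))
  - 4 * (a z + c z) - 2 * (b0 z * (z 0 0 - y 0 0) + b1 z * (z 0 1 - y 0 1)).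
Proof.
rewrite /second_order !pd2_barrier !pd_barrier !subrr !mulr0 /=.
by ring.
Qed.

End StrongMax.

(** * Hopf's strong maximum principle *)

Section StrongMax2.
Variable R : realType.
Implicit Types (U : set 'rV[R]_2) (v w : 'rV[R]_2 -> R) (x y z : 'rV[R]_2).

Lemma continuous_dist z : continuous (fun x => `|z - x|).
Proof.
move=> x; apply: (@continuous_comp _ _ _ (fun x => z - x) Num.norm); last exact: norm_continuous.
by apply: continuousB; [exact: cst_continuous|exact: cvg_id].
Qed.

Lemma compact_closed_ball_rV z (r : R) :
  compact [set x : 'rV[R]_2 | `|z - x| <= r].
Proof.
apply: bounded_closed_compact.
  exists (`|z| + r); split; first exact: num_real.
  move=> M Mr x /= zx; rewrite (le_trans _ (ltW Mr))//.
  by rewrite -[x](subKr z) (le_trans (ler_normB _ _))// lerD.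
rewrite (_ : [set _ | _] = (fun x => `|z - x|) @^-1` [set t | t <= r])//.
apply: preimage_closed; last exact: closed_le.
by move=> x _; exact: continuous_dist.
Qed.

(** P only has to be closed relative to K, which suits functions that are
    continuous on K but not on the whole plane. *)
Lemma compact_setI_closed (K : set 'rV[R]_2) (P : set 'rV[R]_2) :
  compact K -> (forall x, K x -> ~ P x -> \forall y \near x, ~ P y) ->
  compact (K `&` P).
Proof.
move=> cK nP; apply: (subclosed_compact _ cK); last by move=> x [].
have clK : closed K by apply: compact_closed => //; exact: norm_hausdorff.
move=> x clx.
have Kx : K x by apply: clK => B /clx[y [[Ky _] By]]; exists y.
split => //; apply: contrapT => /(nP _ Kx) /clx[y [[_ Py] nPy]].
exact: nPy.
Qed.

Lemma compact_max (K : set 'rV[R]_2) v : K !=set0 -> compact K ->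
  (forall x, K x -> {for x, continuous v}) ->
  exists2 z, K z & forall x, K x -> v x <= v z.
Proof.
move=> K0 cK cv.
have [|z Kz zmax] := EVT_max_rV (f := v) K0 cK.
  by apply: continuous_in_subspaceT => x; rewrite inE; exact: cv.
exists z; first by rewrite inE in Kz.
by move=> x Kx; apply: zmax; rewrite inE.
Qed.

Lemma near_lt v x (k : R) : {for x, continuous v} -> v x < k ->
  \forall y \near x, v y < k.
Proof. by move=> cv; exact: (cvgr_lt _ cv). Qed.

Lemma near_gt v x (k : R) : {for x, continuous v} -> k < v x ->
  \forall y \near x, k < v y.
Proof. by move=> cv; exact: (cvgr_gt _ cv). Qed.

Lemma near_le0 v x : {for x, continuous v} -> ~ (0 <= v x) ->
  \forall y \near x, ~ (0 <= v y).
Proof.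
move=> cv /negP; rewrite -ltNge => vx.
have H := near_lt cv vx.
by apply: filterS H => y vy; apply/negP; rewrite -ltNge.
Qed.

Lemma second_orderD U (a b c b0 b1 : 'rV[R]_2 -> R) v w (e : R) x :
  open U -> smooth_on U v -> smooth_on U w -> U x ->
  second_order a b c b0 b1 (fun x => v x + e * w x) x =
  second_order a b c b0 b1 v x + e * second_order a b c b0 b1 w x.
Proof.
move=> oU sv sw Ux.
have D k v' w' : smooth_on U v' -> smooth_on U w' -> forall x, U x ->
    pd k (fun x => v' x + e * w' x) x = pd k v' x + e * pd k w' x.
  move=> sv' sw' {}x {}Ux.
  have dv := smooth_diff sv' Ux; have dw := smooth_diff sw' Ux.
  rewrite pdD ?pdM ?pd_cst//; first by ring.
  exact: differentiableM.
have D2 k j : pd k (pd j (fun x => v x + e * w x)) x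
    = pd k (pd j v) x + e * pd k (pd j w) x.
  rewrite -(D k (pd j v) (pd j w))//; [|exact: smooth_pd|exact: smooth_pd].
  by apply: (near_eq_pd k oU Ux) => y Uy; exact: D.
by rewrite /second_order !D2 !(D _ v w)//; ring.
Qed.

(** Suppose v takes values below its maximum M at points y arbitrarily close to
    x0.  Among the points where v = M take one, z, at minimal distance from y:
    then v < M inside the circle through z with centre y.  There is a barrier w
    for that circle with w z = 0 and Lw > 0 near z, and w is negative outside
    the circle near z.  For small e > 0, v + e w is below M on the boundary of a
    small square around z and equal to M at z, so it has an interior maximum,
    where L (v + e w) <= 0.  But L (v + e w) >= e Lw > 0. *)
Lemma strong_maximum U (a b c b0 b1 : 'rV[R]_2 -> R) v (M : R) x0 : open U ->
  (forall x, U x -> [/\ {for x, continuous a}, {for x, continuous b},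
     {for x, continuous c}, {for x, continuous b0} & {for x, continuous b1}]) ->
  (forall x, U x -> 0 < a x /\ b x ^+ 2 < a x * c x) ->
  smooth_on U v -> (forall x, U x -> 0 <= second_order a b c b0 b1 v x) ->
  (forall x, U x -> v x <= M) -> U x0 -> v x0 = M ->
  \forall x \near x0, v x = M.
Proof.
move=> oU cont ell sv Lv vM Ux0 vx0.
have [r /= r0 BU] : exists2 r : R, 0 < r & forall x, `|x0 - x| <= r -> U x.
  have /nbhs_ballP[r /= r0 Br] := open_nbhs_nbhs (conj oU Ux0).
  exists (r / 2); first by rewrite divr_gt0.
  move=> x xr; apply: Br; rewrite -ball_normE/= (le_lt_trans xr)//.
  by rewrite ltr_pdivrMr// ltr_pMr// ltr1n.
have cq y : continuous (sqdist y).
  by move=> x; apply: differentiable_continuous; exact: smooth_diff (smooth_sqdist y openT) I.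
have cv x : U x -> {for x, continuous v}.
  by move=> Ux; apply: differentiable_continuous; exact: smooth_diff sv Ux.
have qdC y z : sqdist y z = sqdist z y by rewrite /sqdist; ring.
have qd_ge0 y z : 0 <= sqdist y z by rewrite /sqdist addr_ge0// sqr_ge0.
have qd_eq0 y z : sqdist y z = 0 -> y = z.
  move/eqP; rewrite /sqdist paddr_eq0 ?sqr_ge0// !sqrf_eq0 !subr_eq0 => /andP[/eqP e0 /eqP e1].
  apply/rowP => -[[|[|//]] k].
    by rewrite (_ : Ordinal k = 0) ?e0//; exact/val_inj.
  by rewrite (_ : Ordinal k = 1) ?e1//; exact/val_inj.
have : \forall y \near x0, sqdist x0 y < r ^+ 2 / 16.
  apply: (near_lt (cq x0 x0)); rewrite /sqdist !subrr expr0n/= addr0.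
  by rewrite divr_gt0// exprn_gt0.
apply: filterS => y yx0; apply: contrapT => vyM.
(* z realizes the distance from y to the compact set {v = M} of the square C *)
pose C := [set x | `|x0 - x| <= r].
have cC : compact C := @compact_closed_ball_rV x0 r.
pose K := C `&` [set x | v x = M].
have cK : compact K.
  apply: compact_setI_closed => // x Cx /= vxM.
  have vlt : v x < M by rewrite lt_neqAle vM ?andbT; [exact/eqP|exact: BU].
  have H := near_lt (cv x (BU _ Cx)) vlt.
  by apply: filterS H => u uM uE; rewrite uE ltxx in uM.
have Kx0 : K x0 by split; rewrite /C/= ?subrr ?normr0// ltW.
have [z [Cz vz] zmin] : exists2 z, K z & forall x, K x -> sqdist y z <= sqdist y x.
  have [||z Kz zm] := @compact_max K (fun x => - sqdist y x) _ cK; first by exists x0.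
    by move=> x _; apply: continuousN; exact: cq.
  by exists z => // x Kx; rewrite -lerN2 zm.
have qyz : 0 < sqdist y z.
  rewrite lt_neqAle qd_ge0 andbT eq_sym; apply/eqP => /qd_eq0 yz.
  by rewrite yz vz in vyM.
(* |x0 - z| <= 2 |x0 - y| by the choice of z, and |x0 - y| <= r / 4: hence z is
   an interior point of C, and points near z lie in C *)
have x0z : `|x0 - z| < r.
  have q1 : sqdist x0 z < r ^+ 2.
    have q0 := zmin _ Kx0; rewrite qdC in q0.
    have q2 := yx0; move: q0 q2; rewrite /sqdist.
    move: (x0 0 0) (x0 0 1) (y 0 0) (y 0 1) (z 0 0) (z 0 1) => a1 a2 a3 a4 a5 a6 q0 q2.
    have := sqr_ge0 ((a5 - a3) + (a1 - a3)); have := sqr_ge0 ((a6 - a4) + (a2 - a4)).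
    have : 0 < r ^+ 2 by rewrite exprn_gt0.
    nra.
  have coord k : `|x0 0 k - z 0 k| < r.
    rewrite -(@ltr_pXn2r _ 2)// ?nnegrE ?normr_ge0//; last exact: ltW.
    rewrite real_normK ?num_real//; apply: le_lt_trans q1.
    have -> : (x0 0 k - z 0 k) ^+ 2 = (z 0 k - x0 0 k) ^+ 2 by ring.
    rewrite /sqdist; case: k => -[|[|//]] k.
      by rewrite (_ : Ordinal k = 0) ?lerDl ?sqr_ge0//; exact/val_inj.
    by rewrite (_ : Ordinal k = 1) ?lerDr ?sqr_ge0//; exact/val_inj.
  rewrite [ltLHS]/Num.Def.normr/= mx_normrE; apply: bigmax_lt => // -[i j] _ /=.
  by rewrite ord1 !mxE.
have Uz : U z by exact: BU.
have [az bz] := ell _ Uz.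
pose Q := a z * (z 0 0 - y 0 0) ^+ 2 + 2 * b z * (z 0 0 - y 0 0) * (z 0 1 - y 0 1)
    + c z * (z 0 1 - y 0 1) ^+ 2.
have Q0 : 0 < Q.
  rewrite -(@pmulr_rgt0 _ (a z))//.
  have -> : a z * Q = (a z * (z 0 0 - y 0 0) + b z * (z 0 1 - y 0 1)) ^+ 2
     + (a z * c z - b z ^+ 2) * (z 0 1 - y 0 1) ^+ 2 by rewrite /Q; ring.
  have [E|E] := eqVneq (z 0 1 - y 0 1) 0.
    move: qyz; rewrite /sqdist E !expr0n/= !mulr0 !addr0 => h.
    rewrite exprMn mulr_gt0// exprn_gt0//.
  by rewrite ltr_wpDl ?sqr_ge0// mulr_gt0 ?subr_gt0// exprn_even_gt0.
(* A is chosen so that Lw = 1 at z *)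
pose A := (4 * (a z + c z) + 2 * (b0 z * (z 0 0 - y 0 0) + b1 z * (z 0 1 - y 0 1)) + 1)
   / (8 * Q).
pose w := barrier (sqdist y z) A y z.
have Lw : second_order a b c b0 b1 w z = 1.
  rewrite second_order_barrier -/Q /A; field.
  by rewrite gt_eqF.
have sw : smooth_on U w by exact: smooth_barrier.
have cw : continuous w.
  by move=> x; apply: differentiable_continuous;
    exact: smooth_diff (smooth_barrier _ _ _ _ openT) I.
have wz : w z = 0 by rewrite /w /barrier /sqdist !subrr; ring.
have [d d0 Bd] : exists2 d : R, 0 < d & forall x, `|z - x| <= d ->
   [/\ `|x0 - x| <= r, 0 < second_order a b c b0 b1 w x & 0 < 1 + A * (sqdist y z - sqdist y x)].
  have n1 : \forall x \near z, `|x0 - x| < r.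
    exact: (near_lt (@continuous_dist x0 z)).
  have n2 : \forall x \near z, 0 < second_order a b c b0 b1 w x.
    have [ca cb cc cb0 cb1] := cont _ Uz.
    have cp j : {for z, continuous (pd j w)}.
      by apply: differentiable_continuous; exact: smooth_diff (smooth_pd j sw) Uz.
    have cpp i j : {for z, continuous (pd i (pd j w))}.
      apply: differentiable_continuous.
      exact: smooth_diff (smooth_pd i (smooth_pd j sw)) Uz.
    have cL : {for z, continuous (second_order a b c b0 b1 w)}.
      rewrite /second_order; apply: continuousD; [apply: continuousD; [apply: continuousD; [apply: continuousD|]|]|].
      - by apply: continuousM => //; exact: cpp.
      - apply: continuousM; last exact: cpp.
        by apply: continuousM => //; exact: cst_continuous.
      - by apply: continuousM => //; exact: cpp.
      - by apply: continuousM => //; exact: cp.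
      - by apply: continuousM => //; exact: cp.
    by apply: (near_gt cL); rewrite Lw.
  have n3 : \forall x \near z, 0 < 1 + A * (sqdist y z - sqdist y x).
    have cn : {for z, continuous (fun x => 1 + A * (sqdist y z - sqdist y x))}.
      apply: continuousD; first exact: cst_continuous.
      apply: continuousM; first exact: cst_continuous.
      by apply: continuousB; [exact: cst_continuous|exact: cq].
    by apply: (near_gt cn); rewrite subrr mulr0 addr0.
  have n4 : \forall x \near z, [/\ `|x0 - x| < r, 0 < second_order a b c b0 b1 w x &
      0 < 1 + A * (sqdist y z - sqdist y x)].
    by move: n1 n2 n3; apply: filterS3 => x h1 h2 h3; exact: And3 h1 h2 h3.
  have /nbhs_ballP[d /= d0 Bd] := n4; exists (d / 2); first by rewrite divr_gt0.
  move=> x xr; have [|h1 h2 h3] := Bd x; last by split => //; exact: ltW.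
  by rewrite -ball_normE/= (le_lt_trans xr)// ltr_pdivrMr// ltr_pMr// ltr1n.
pose D := [set x | `|z - x| <= d].
have cD : compact D := @compact_closed_ball_rV z d.
pose T := (D `&` [set x | 0 <= `|z - x| - d]) `&` [set x | 0 <= w x].
have cT : compact T.
  apply: compact_setI_closed; last first.
    by move=> x _ /= wx; apply: near_le0 => //; exact: cw.
  apply: compact_setI_closed => // x _ /= wx; apply: (@near_le0 (fun x => `|z - x| - d)) => //.
  by apply: continuousB; [exact: continuous_dist|exact: cst_continuous].
have DU x : D x -> U x by move=> /Bd[/BU].
(* T is the part of the boundary of the square D where w >= 0; it lies inside
   the circle because there s (1 + A s) >= |x - z|^2 > 0 *)
have Tlt x : T x -> v x < M.
  move=> [[Dx dx] wx]; have Ux := DU _ Dx.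
  rewrite lt_neqAle vM// andbT; apply/eqP => vx.
  have [Cx _ Ax] := Bd _ Dx.
  have zx : 0 < sqdist z x.
    rewrite lt_neqAle qd_ge0 andbT eq_sym; apply/eqP => /qd_eq0 zx.
    by move: dx; rewrite /= zx subrr normr0 sub0r oppr_ge0 leNgt d0.
  have := zmin x (conj Cx vx).
  move: wx; rewrite /= /w /barrier => wx; rewrite leNgt => /negP; apply.
  rewrite -subr_gt0 -(pmulr_lgt0 _ Ax); move: wx zx; lra.
have [e e0 eM] : exists2 e : R, 0 < e & forall x, T x -> v x + e * w x < M.
  have [T0|T0] := pselect (T !=set0); last first.
    by exists 1 => // x Tx; exfalso; apply: T0; exists x.
  have [x1 Tx1 vmax] : exists2 x1, T x1 & forall x, T x -> v x <= v x1.
    by apply: compact_max => // x [[/DU/cv]].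
  have [x2 Tx2 wmax] : exists2 x1, T x1 & forall x, T x -> w x <= w x1.
    by apply: compact_max => // x _; exact: cw.
  have v1 := Tlt _ Tx1; have w2 : 0 <= w x2 by case: Tx2.
  exists ((M - v x1) / (w x2 + 1)); first by rewrite divr_gt0 ?subr_gt0// ltr_wpDl.
  move=> x Tx.
  rewrite (@le_lt_trans _ _ (v x1 + (M - v x1) / (w x2 + 1) * w x2))//.
    apply: lerD; first exact: vmax.
    apply: ler_wpM2l; last exact: wmax.
    by apply: divr_ge0; [rewrite subr_ge0 ltW|rewrite addr_ge0].
  rewrite -ltrBrDl -mulrA gtr_pMr ?subr_gt0// mulrC ltr_pdivrMr; last by rewrite ltr_wpDl.
  by rewrite mul1r ltrDl.
pose g x := v x + e * w x.
have sg : smooth_on U g.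
  by apply: smoothD => //; apply: smoothM => //; exact: smooth_cst.
have [z1 Dz1 gmax] : exists2 z1, D z1 & forall x, D x -> g x <= g z1.
  apply: compact_max => //; first by exists z; rewrite /D/= subrr normr0 ltW.
  by move=> x /DU Ux; apply: differentiable_continuous; exact: smooth_diff sg Ux.
have Uz1 := DU _ Dz1.
have gM : M <= g z1.
  apply: le_trans (gmax z _); first by rewrite /g vz wz mulr0 addr0.
  by rewrite /D/= subrr normr0 ltW.
have z1d : `|z - z1| < d.
  rewrite ltNge; apply/negP => dz1; move: gM; apply/negP; rewrite -ltNge.
  have [w0|w0] := leP 0 (w z1).
    by apply: eM; split => //; split => //=; rewrite subr_ge0.
  by rewrite /g (@lt_le_trans _ _ (v z1)) ?vM// gtrDl pmulr_rlt0.
have zmaxn : \forall x \near z1, g x <= g z1.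
  have H := near_lt (@continuous_dist z z1) z1d.
  by apply: filterS H => x zx; apply: gmax; exact: ltW.
have [a1 b1'] := ell _ Uz1.
have := second_order_at_max b0 b1 oU sg Uz1 a1 b1' zmaxn.
rewrite (second_orderD _ _ _ _ _ _ oU sv sw Uz1) leNgt => /negP; apply.
by rewrite ltr_wpDl ?Lv// mulr_gt0//; have [] := Bd _ Dz1.
Qed.

End StrongMax2.

(** * Calculus of matrix-valued functions *)

(** gam, riem and nab are Gam, curvature and pull_nabla with rigid head
    constants, for the same reason as pd. *)
Definition gam := locked_with seal_key (@Gam).
Arguments gam {R m}.
Definition riem := locked_with seal_key (@curvature).
Arguments riem {R m}.
Definition nab := locked_with seal_key (@pull_nabla).
Arguments nab {R m n}.
Lemma Gam_gam : @Gam = @gam. Proof. by rewrite /gam locked_withE. Qed.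
Lemma curvature_riem : @curvature = @riem. Proof. by rewrite /riem locked_withE. Qed.
Lemma pull_nabla_nab : @pull_nabla = @nab. Proof. by rewrite /nab locked_withE. Qed.

Section MatrixSmooth.
Variables (R : realType) (m : nat) (A : set 'rV[R]_m).
Hypothesis oA : open A.

Lemma smooth_bigsum (I : Type) (r : seq I) (P : pred I) (F : I -> 'rV[R]_m -> R) :
  (forall i, smooth_on A (F i)) -> smooth_on A (fun x => \sum_(i <- r | P i) F i x).
Proof.
move=> sF; elim: r => [|i r IH].
  by under eq_fun do rewrite big_nil; exact: smooth_cst.
under eq_fun do rewrite big_cons; case: (P i) => //.
exact: smoothD.
Qed.

Lemma smooth_bigprod (I : Type) (r : seq I) (P : pred I) (F : I -> 'rV[R]_m -> R) :
  (forall i, smooth_on A (F i)) -> smooth_on A (fun x => \prod_(i <- r | P i) F i x).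
Proof.
move=> sF; elim: r => [|i r IH].
  by under eq_fun do rewrite big_nil; exact: smooth_cst.
under eq_fun do rewrite big_cons; case: (P i) => //.
exact: smoothM.
Qed.

Lemma smooth_mxD p q (F G : 'rV[R]_m -> 'M[R]_(p, q)) :
  smooth_on A F -> smooth_on A G -> smooth_on A (fun x => F x + G x).
Proof.
move=> sF sG; apply: smooth_mx => // a b; under eq_fun do rewrite mxE.
by apply: smoothD => //; exact: smooth_entry.
Qed.

Lemma smooth_mxN p q (F : 'rV[R]_m -> 'M[R]_(p, q)) :
  smooth_on A F -> smooth_on A (fun x => - F x).
Proof.
move=> sF; apply: smooth_mx => // a b; under eq_fun do rewrite mxE.
by apply: smoothN => //; exact: smooth_entry.
Qed.

Lemma smooth_mxB p q (F G : 'rV[R]_m -> 'M[R]_(p, q)) :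
  smooth_on A F -> smooth_on A G -> smooth_on A (fun x => F x - G x).
Proof. by move=> sF sG; apply: smooth_mxD => //; exact: smooth_mxN. Qed.

Lemma smooth_mxcst p q (N : 'M[R]_(p, q)) : smooth_on A (fun _ => N).
Proof. by apply: smooth_mx => // a b; exact: smooth_cst. Qed.

Lemma smooth_mxZ p q (f : 'rV[R]_m -> R) (F : 'rV[R]_m -> 'M[R]_(p, q)) :
  smooth_on A f -> smooth_on A F -> smooth_on A (fun x => f x *: F x).
Proof.
move=> sf sF; apply: smooth_mx => // a b; under eq_fun do rewrite mxE.
by apply: smoothM => //; exact: smooth_entry.
Qed.

Lemma smooth_mxsum p q (I : Type) (r : seq I) (P : pred I)
    (F : I -> 'rV[R]_m -> 'M[R]_(p, q)) :
  (forall i, smooth_on A (F i)) -> smooth_on A (fun x => \sum_(i <- r | P i) F i x).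
Proof.
move=> sF; apply: smooth_mx => // a b; under eq_fun do rewrite summxE.
by apply: smooth_bigsum => i; exact: smooth_entry.
Qed.

Lemma smooth_mulmx p q r (F : 'rV[R]_m -> 'M[R]_(p, q)) (G : 'rV[R]_m -> 'M[R]_(q, r)) :
  smooth_on A F -> smooth_on A G -> smooth_on A (fun x => F x *m G x).
Proof.
move=> sF sG; apply: smooth_mx => // a b; under eq_fun do rewrite mxE.
by apply: smooth_bigsum => k; apply: smoothM => //; exact: smooth_entry.
Qed.

Lemma smooth_trmx p q (F : 'rV[R]_m -> 'M[R]_(p, q)) :
  smooth_on A F -> smooth_on A (fun x => (F x)^T).
Proof.
move=> sF; apply: smooth_mx => // a b; under eq_fun do rewrite mxE.
exact: smooth_entry.
Qed.

Lemma smooth_det p (F : 'rV[R]_m -> 'M[R]_p) :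
  smooth_on A F -> smooth_on A (fun x => \det (F x)).
Proof.
move=> sF; rewrite /determinant; apply: smooth_bigsum => s.
apply: smoothM => //; first exact: smooth_cst.
by apply: smooth_bigprod => i; exact: smooth_entry.
Qed.

(** Cramer's rule reduces the inverse to determinants. *)
Lemma smooth_invmx p (F : 'rV[R]_m -> 'M[R]_p) :
  smooth_on A F -> (forall x, A x -> F x \in unitmx) ->
  smooth_on A (fun x => invmx (F x)).
Proof.
move=> sF uF; apply: smooth_mx => // a b.
apply: (@smooth_eq _ _ _ oA (fun x => (\det (F x))^-1 *
   ((-1) ^+ (b + a) * \det (row' b (col' a (F x)))))); last first.
  by move=> x Ax; rewrite /invmx uF// !mxE.
apply: smoothM => //.
  apply: smoothV => //; first exact: smooth_det.
  by move=> x /uF; rewrite unitmxE unitfE.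
apply: smoothM => //; first exact: smooth_cst.
apply: smooth_det; apply: smooth_mx => // i j; under eq_fun do rewrite !mxE.
exact: smooth_entry.
Qed.

Lemma smooth_inner p (H : 'rV[R]_m -> 'M[R]_p) V W :
  smooth_on A H -> smooth_on A V -> smooth_on A W ->
  smooth_on A (fun x => inner (H x) (V x) (W x)).
Proof.
move=> sH sV sW; apply: smooth_entry => //; apply: smooth_mulmx.
  exact: smooth_mulmx.
exact: smooth_trmx.
Qed.

Lemma smooth_compmx p q n (B : set 'rV[R]_n) (F : 'rV[R]_n -> 'M[R]_(p, q))
    (u : 'rV[R]_m -> 'rV[R]_n) : open B ->
  smooth_on A u -> smooth_on B F -> (forall x, A x -> B (u x)) ->
  smooth_on A (fun x => F (u x)).
Proof.
move=> oB su sF uAB; apply: smooth_mx => // a b.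
exact: (@smooth_comp _ _ _ oA n B (fun y => F y a b) u su (smooth_entry oB a b sF) uAB).
Qed.

Section Leibniz.
Variables (i : 'I_m) (x : 'rV[R]_m).

Lemma pd_mulmx p q r (F : 'rV[R]_m -> 'M[R]_(p, q)) (G : 'rV[R]_m -> 'M[R]_(q, r)) :
  differentiable F x -> differentiable G x ->
  pd i (fun x => F x *m G x) x = pd i F x *m G x + F x *m pd i G x.
Proof.
move=> dF dG.
have de a b k : differentiable (fun y => F y a k * G y k b) x.
  by apply: differentiableM; exact: differentiable_entry.
have dS a b : differentiable (fun y => (F y *m G y) a b) x.
  by under eq_fun do rewrite mxE; exact: differentiable_bigsum.
apply/matrixP => a b; rewrite pd_entry; last exact: differentiable_mx.
under [X in pd _ X]eq_fun do rewrite mxE.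
rewrite pd_sum// !mxE -big_split/=; apply: eq_bigr => k _.
by rewrite pdM ?(pd_entry _ _ _ dF) ?(pd_entry _ _ _ dG)//; exact: differentiable_entry.
Qed.

Lemma differentiable_mulmx p q r (F : 'rV[R]_m -> 'M[R]_(p, q)) (G : 'rV[R]_m -> 'M[R]_(q, r)) :
  differentiable F x -> differentiable G x -> differentiable (fun x => F x *m G x) x.
Proof.
move=> dF dG; apply: differentiable_mx => a b; under eq_fun do rewrite mxE.
by apply: differentiable_bigsum => k; apply: differentiableM; exact: differentiable_entry.
Qed.

Lemma differentiable_trmx p q (F : 'rV[R]_m -> 'M[R]_(p, q)) :
  differentiable F x -> differentiable (fun x => (F x)^T) x.
Proof.
move=> dF; apply: differentiable_mx => a b; under eq_fun do rewrite mxE.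
exact: differentiable_entry.
Qed.

Lemma pd_trmx p q (F : 'rV[R]_m -> 'M[R]_(p, q)) : differentiable F x ->
  pd i (fun x => (F x)^T) x = (pd i F x)^T.
Proof.
move=> dF; apply/matrixP => a b; rewrite pd_entry; last exact: differentiable_trmx.
under [X in pd _ X]eq_fun do rewrite mxE.
by rewrite mxE pd_entry.
Qed.

Lemma pd_scale p q (f : 'rV[R]_m -> R) (F : 'rV[R]_m -> 'M[R]_(p, q)) :
  differentiable f x -> differentiable F x ->
  pd i (fun x => f x *: F x) x = pd i f x *: F x + f x *: pd i F x.
Proof.
move=> df dF; apply/matrixP => a b; rewrite pd_entry; last first.
  apply: differentiable_mx => a' b'; under eq_fun do rewrite mxE.
  by apply: differentiableM => //; exact: differentiable_entry.
under [X in pd _ X]eq_fun do rewrite mxE.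
rewrite pdM//; last exact: differentiable_entry.
by rewrite !mxE pd_entry.
Qed.

Lemma pd_inner p (H : 'rV[R]_m -> 'M[R]_p) V W :
  differentiable H x -> differentiable V x -> differentiable W x ->
  pd i (fun x => inner (H x) (V x) (W x)) x =
  inner (pd i H x) (V x) (W x) + (inner (H x) (pd i V x) (W x)
   + inner (H x) (V x) (pd i W x)).
Proof.
move=> dH dV dW; have dVH := differentiable_mulmx dV dH.
have dT := differentiable_trmx dW.
rewrite /inner -(pd_entry _ _ _ (differentiable_mulmx dVH dT)).
have addE (M N : 'M[R]_1) : (M + N) 0 0 = M 0 0 + N 0 0 by rewrite mxE.
rewrite pd_mulmx// pd_mulmx// pd_trmx// mulmxDl !addE.
by rewrite addrA [in RHS]addrAC [in RHS](addrC _ (_ 0 0)) -!addrA; congr (_ + _); rewrite addrC.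
Qed.

End Leibniz.
End MatrixSmooth.

Section Inner.
Variables (R : realType) (k : nat).
Implicit Types (b : 'M[R]_k) (X Y Z : 'rV[R]_k).

Lemma innerDl b X Y Z : inner b (X + Y) Z = inner b X Z + inner b Y Z.
Proof. by rewrite /inner !mulmxDl mxE. Qed.
Lemma innerDr b X Y Z : inner b Z (X + Y) = inner b Z X + inner b Z Y.
Proof. by rewrite /inner linearD/= mulmxDr mxE. Qed.
Lemma innerZl b a X Z : inner b (a *: X) Z = a * inner b X Z.
Proof. by rewrite /inner -!scalemxAl mxE. Qed.
Lemma innerZr b a X Z : inner b Z (a *: X) = a * inner b Z X.
Proof. by rewrite /inner linearZ/= -scalemxAr mxE. Qed.
Lemma innerNl b X Z : inner b (- X) Z = - inner b X Z.
Proof. by rewrite -scaleN1r innerZl mulN1r. Qed.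
Lemma innerNr b X Z : inner b Z (- X) = - inner b Z X.
Proof. by rewrite -scaleN1r innerZr mulN1r. Qed.
Lemma innerBl b X Y Z : inner b (X - Y) Z = inner b X Z - inner b Y Z.
Proof. by rewrite innerDl innerNl. Qed.
Lemma innerBr b X Y Z : inner b Z (X - Y) = inner b Z X - inner b Z Y.
Proof. by rewrite innerDr innerNr. Qed.
Lemma inner0l b Z : inner b 0 Z = 0.
Proof. by rewrite /inner !mul0mx mxE. Qed.
Lemma inner0r b Z : inner b Z 0 = 0.
Proof. by rewrite /inner trmx0 mulmx0 mxE. Qed.
Lemma inner_suml b (I : Type) (r : seq I) P (F : I -> 'rV[R]_k) Z :
  inner b (\sum_(i <- r | P i) F i) Z = \sum_(i <- r | P i) inner b (F i) Z.
Proof. by elim/big_rec2: _ => [|i x y _ <-]; rewrite ?inner0l ?innerDl. Qed.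
Lemma inner_sumr b (I : Type) (r : seq I) P (F : I -> 'rV[R]_k) Z :
  inner b Z (\sum_(i <- r | P i) F i) = \sum_(i <- r | P i) inner b Z (F i).
Proof. by elim/big_rec2: _ => [|i x y _ <-]; rewrite ?inner0r ?innerDr. Qed.
Lemma inner_sum_form (I : Type) (r : seq I) P (a : I -> R) (F : I -> 'M[R]_k) Y Z :
  inner (\sum_(i <- r | P i) a i *: F i) Y Z = \sum_(i <- r | P i) a i * inner (F i) Y Z.
Proof.
elim/big_rec2: _ => [|i x y _ <-]; first by rewrite /inner mulmx0 mul0mx mxE.
by rewrite /inner mulmxDr mulmxDl -scalemxAr -scalemxAl !mxE.
Qed.
Lemma innerC b X Y : b^T = b -> inner b X Y = inner b Y X.
Proof.
move=> bT; rewrite /inner -[in LHS](trmxK (X *m b *m Y^T)) mxE.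
by rewrite !trmx_mul trmxK bT mulmxA.
Qed.
Lemma inner_delta b i j : inner b (delta_mx 0 i) (delta_mx 0 j) = b i j.
Proof. by rewrite /inner -rowE trmx_delta -colE !mxE. Qed.
Lemma innerE b X Y : inner b X Y = \sum_i \sum_j X 0 i * Y 0 j * b i j.
Proof.
rewrite {1}(row_sum_delta X) inner_suml; apply: eq_bigr => i _.
rewrite {1}(row_sum_delta Y) inner_sumr; apply: eq_bigr => j _.
by rewrite innerZl innerZr inner_delta mulrA.
Qed.
End Inner.

(** * The Levi-Civita connection along a map *)

(** A nondegenerate metric is what the Levi-Civita connection is built from;
    positivity enters later, through orthonormal frames. *)
Definition metric_on (R : realType) (n : nat) (B : set 'rV[R]_n)
    (h : 'rV[R]_n -> 'M[R]_n) : Prop :=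
  [/\ open B, smooth_on B h, forall y, B y -> (h y)^T = h y
    & forall y, B y -> h y \in unitmx].

Section LeviCivita.
Variables (R : realType) (n : nat) (h : 'rV[R]_n -> 'M[R]_n).
Implicit Types (y X Y Z W : 'rV[R]_n).

Lemma gamE y X Y : gam h y X Y =
  \row_k \sum_(i < n) \sum_(j < n) (2^-1 * \sum_(l < n) invmx (h y) k l *
    (pd i h y j l + pd j h y i l - pd l h y i j)) * X 0 i * Y 0 j.
Proof. by rewrite -Gam_gam /Gam /christoffel pder_pd. Qed.

Lemma gamDl y X X' Y : gam h y (X + X') Y = gam h y X Y + gam h y X' Y.
Proof.
rewrite !gamE; apply/rowP => k; rewrite !mxE -big_split; apply: eq_bigr => i _.
by rewrite -big_split; apply: eq_bigr => j _; rewrite !mxE mulrDr mulrDl.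
Qed.

Lemma gamDr y X Y Y' : gam h y X (Y + Y') = gam h y X Y + gam h y X Y'.
Proof.
rewrite !gamE; apply/rowP => k; rewrite !mxE -big_split; apply: eq_bigr => i _.
by rewrite -big_split; apply: eq_bigr => j _; rewrite !mxE mulrDr.
Qed.

Lemma gamZl y a X Y : gam h y (a *: X) Y = a *: gam h y X Y.
Proof.
rewrite !gamE; apply/rowP => k; rewrite !mxE mulr_sumr; apply: eq_bigr => i _.
by rewrite mulr_sumr; apply: eq_bigr => j _; rewrite !mxE; ring.
Qed.

Lemma gamZr y a X Y : gam h y X (a *: Y) = a *: gam h y X Y.
Proof.
rewrite !gamE; apply/rowP => k; rewrite !mxE mulr_sumr; apply: eq_bigr => i _.
by rewrite mulr_sumr; apply: eq_bigr => j _; rewrite !mxE; ring.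
Qed.

Lemma gam0l y Y : gam h y 0 Y = 0.
Proof. by have := gamZl y 0 0 Y; rewrite !scale0r. Qed.
Lemma gam0r y X : gam h y X 0 = 0.
Proof. by have := gamZr y 0 X 0; rewrite !scale0r. Qed.
Lemma gam_suml y (I : Type) (r : seq I) P (F : I -> 'rV[R]_n) Y :
  gam h y (\sum_(i <- r | P i) F i) Y = \sum_(i <- r | P i) gam h y (F i) Y.
Proof. by elim/big_rec2: _ => [|i u v _ <-]; rewrite ?gam0l ?gamDl. Qed.
Lemma gam_sumr y (I : Type) (r : seq I) P (F : I -> 'rV[R]_n) X :
  gam h y X (\sum_(i <- r | P i) F i) = \sum_(i <- r | P i) gam h y X (F i).
Proof. by elim/big_rec2: _ => [|i u v _ <-]; rewrite ?gam0r ?gamDr. Qed.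

Lemma gam_basis y X Y : gam h y X Y =
  \sum_i \sum_j (X 0 i * Y 0 j) *: gam h y (delta_mx 0 i) (delta_mx 0 j).
Proof.
rewrite {1}(row_sum_delta X) gam_suml; apply: eq_bigr => i _.
rewrite {1}(row_sum_delta Y) gam_sumr; apply: eq_bigr => j _.
by rewrite gamZl gamZr scalerA.
Qed.

Variable B : set 'rV[R]_n.
Hypothesis hB : metric_on B h.
Let oB : open B. Proof. by case: hB. Qed.
Let sh : smooth_on B h. Proof. by case: hB. Qed.

Lemma smooth_gam X Y : smooth_on B (fun y => gam h y X Y).
Proof.
under eq_fun do rewrite gamE.
apply: smooth_mx => // a k; under eq_fun do rewrite mxE.
apply: smooth_bigsum => // i; apply: smooth_bigsum => // j.
apply: smoothM => //; last exact: smooth_cst.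
apply: smoothM => //; last exact: smooth_cst.
apply: smoothM => //; first exact: smooth_cst.
apply: smooth_bigsum => // l; apply: smoothM => //.
  by apply: smooth_entry => //; apply: smooth_invmx => //; case: hB.
by apply: smoothB => //; first apply: smoothD => //;
  apply: smooth_entry => //; exact: smooth_pd.
Qed.

Section AtPoint.
Variable y : 'rV[R]_n.
Hypothesis By : B y.

Definition dmetric X : 'M[R]_n := \sum_i X 0 i *: pd i h y.

Lemma pd_metric_sym i : (pd i h y)^T = pd i h y.
Proof.
rewrite -pd_trmx; last exact: smooth_diff sh By.
by apply: (near_eq_pd i oB By) => z Bz; case: hB => _ _ ->.
Qed.

Lemma dmetric_sym X : (dmetric X)^T = dmetric X.
Proof.
by rewrite /dmetric linear_sum; apply: eq_bigr => i _; rewrite linearZ/= pd_metric_sym.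
Qed.

Lemma inner_inj Z W : (forall X, inner (h y) Z X = inner (h y) W X) -> Z = W.
Proof.
move=> E; have uh : h y \in unitmx by case: hB => _ _ _; exact.
apply/subr0_eq; rewrite -[LHS](mulmxK uh).
suff -> : (Z - W) *m h y = 0 by rewrite mul0mx.
apply/rowP => j; have := E (delta_mx 0 j); move/eqP.
rewrite -subr_eq0 -innerBl /inner trmx_delta -colE => /eqP.
by rewrite !mxE.
Qed.

(** The Koszul formula for vectors with constant components; unlike the
    definition of gam it does not mention the inverse matrix. *)
Lemma inner_gam X Y W : inner (h y) (gam h y X Y) W =
  2^-1 * (inner (dmetric X) Y W + inner (dmetric Y) X W - inner (dmetric W) X Y).
Proof.
have uh : h y \in unitmx by case: hB => _ _ _; exact.
have sy : (h y)^T = h y by case: hB => _ _ /(_ _ By).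
pose D i j l := pd i h y j l + pd j h y i l - pd l h y i j.
pose L : 'rV[R]_n := \row_l (2^-1 * \sum_i \sum_j D i j l * X 0 i * Y 0 j).
have E (T : 'I_n -> 'I_n -> 'I_n -> R) : \sum_i \sum_j \sum_l T i j l =
    \sum_l \sum_i \sum_j T i j l.
  rewrite [RHS]exchange_big; apply: eq_bigr => i _; exact: exchange_big.
have -> : gam h y X Y = L *m invmx (h y).
  rewrite gamE; apply/rowP => k; rewrite !mxE.
  have iT : (invmx (h y))^T = invmx (h y) by rewrite trmx_inv sy.
  under [RHS]eq_bigr => l _.
    rewrite mxE -[in invmx _ l k]iT mxE mulr_sumr mulr_suml.
    under eq_bigr do rewrite mulr_sumr mulr_suml.
    over.
  rewrite -E; apply: eq_bigr => i _; apply: eq_bigr => j _.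
  by rewrite mulr_sumr !mulr_suml; apply: eq_bigr => l _; rewrite /D; ring.
rewrite {1}/inner mulmxKV//.
rewrite mxE; under eq_bigr => l _.
  rewrite !mxE -mulrA mulr_suml; under eq_bigr do rewrite mulr_suml.
  over.
rewrite -mulr_sumr; congr (_ * _).
rewrite /dmetric !inner_sum_form.
have -> : \sum_i X 0 i * inner (pd i h y) Y W =
   \sum_l \sum_i \sum_j X 0 i * Y 0 j * W 0 l * pd i h y j l.
  rewrite -E; apply: eq_bigr => i _; rewrite innerE mulr_sumr; apply: eq_bigr => j _.
  by rewrite mulr_sumr; apply: eq_bigr => l _; ring.
have -> : \sum_i Y 0 i * inner (pd i h y) X W =
   \sum_l \sum_i \sum_j X 0 i * Y 0 j * W 0 l * pd j h y i l.
  rewrite -E [RHS]exchange_big; apply: eq_bigr => i _; rewrite innerE mulr_sumr; apply: eq_bigr => j _.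
  by rewrite mulr_sumr; apply: eq_bigr => l _; ring.
have -> : \sum_l W 0 l * inner (pd l h y) X Y =
   \sum_l \sum_i \sum_j X 0 i * Y 0 j * W 0 l * pd l h y i j.
  apply: eq_bigr => i _; rewrite innerE mulr_sumr; apply: eq_bigr => j _.
  by rewrite mulr_sumr; apply: eq_bigr => l _; ring.
rewrite -sumrN -!big_split/=; apply: eq_bigr => l _.
rewrite -sumrN -!big_split/=; apply: eq_bigr => i _.
rewrite -sumrN -!big_split/=; apply: eq_bigr => j _.
by rewrite /D; ring.
Qed.

Lemma gamC X Y : gam h y X Y = gam h y Y X.
Proof.
apply: inner_inj => W; rewrite !inner_gam (innerC _ _ (dmetric_sym W)).
by rewrite [_ + inner _ X W]addrC.
Qed.

Lemma metric_compatible X V W : inner (dmetric X) V W =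
  inner (h y) (gam h y X V) W + inner (h y) V (gam h y X W).
Proof.
have sy : (h y)^T = h y by case: hB => _ _ /(_ _ By).
rewrite (innerC V _ sy) !inner_gam.
rewrite (innerC V W (dmetric_sym X)) (innerC X W (dmetric_sym V)).
rewrite (innerC X V (dmetric_sym W)); move: (inner _ _ _) (inner _ _ _) (inner _ _ _) => a b c.
by field.
Qed.

End AtPoint.

Section AlongMap.
Variables (m : nat) (A : set 'rV[R]_m) (u : 'rV[R]_m -> 'rV[R]_n).
Hypotheses (oA : open A) (su : smooth_on A u) (uAB : forall x, A x -> B (u x)).
Implicit Types (V : 'rV[R]_m -> 'rV[R]_n).

Lemma nabE i V x : nab h u i V x = pd i V x + gam h (u x) (pd i u x) (V x).
Proof. by rewrite -pull_nabla_nab /pull_nabla pder_pd Gam_gam. Qed.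

Lemma smooth_metric_along : smooth_on A (fun x => h (u x)).
Proof. exact: smooth_compmx oB su sh uAB. Qed.

Lemma smooth_gam_along (X Y : 'rV[R]_m -> 'rV[R]_n) :
  smooth_on A X -> smooth_on A Y -> smooth_on A (fun x => gam h (u x) (X x) (Y x)).
Proof.
move=> sX sY; under eq_fun do rewrite gam_basis.
apply: smooth_mxsum => // i; apply: smooth_mxsum => // j; apply: smooth_mxZ => //.
  by apply: smoothM => //; exact: smooth_entry.
exact: (smooth_compmx oA oB su (smooth_gam _ _) uAB).
Qed.

Lemma smooth_nab i V : smooth_on A V -> smooth_on A (nab h u i V).
Proof.
move=> sV; rewrite (_ : nab h u i V = fun x => pd i V x + gam h (u x) (pd i u x) (V x)).
  apply: smooth_mxD => //; first exact: smooth_pd.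
  by apply: smooth_gam_along => //; exact: smooth_pd.
by apply/funext => x; rewrite nabE.
Qed.

(** Leibniz rule for gam, which is bilinear in X and Y with coefficients that are
    functions of the base point u x. *)
Lemma pd_gam i (X Y : 'rV[R]_m -> 'rV[R]_n) x : A x ->
  smooth_on A X -> smooth_on A Y ->
  pd i (fun x => gam h (u x) (X x) (Y x)) x =
  'D_(pd i u x) (fun y => gam h y (X x) (Y x)) (u x)
  + (gam h (u x) (pd i X x) (Y x) + gam h (u x) (X x) (pd i Y x)).
Proof.
move=> Ax sX sY.
pose G a b y := gam h y (delta_mx 0 a) (delta_mx 0 b).
have dG a b : differentiable (G a b) (u x).
  exact: smooth_diff (smooth_gam _ _) (uAB Ax).
have du : differentiable u x by exact: smooth_diff su Ax.
have dGu a b : differentiable (fun x => G a b (u x)) x.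
  exact: (smooth_diff (smooth_compmx oA oB su (smooth_gam _ _) uAB) Ax).
have dX : differentiable X x by exact: smooth_diff sX Ax.
have dY : differentiable Y x by exact: smooth_diff sY Ax.
have dXe a : differentiable (fun x => X x 0 a) x by exact: differentiable_entry.
have dYe a : differentiable (fun x => Y x 0 a) x by exact: differentiable_entry.
have dXY a b : differentiable (fun x => X x 0 a * Y x 0 b) x by exact: differentiableM.
have dZ a b : differentiable (fun x => (X x 0 a * Y x 0 b) *: G a b (u x)) x.
  apply: (smooth_diff (A := A)) => //; apply: smooth_mxZ => //.
    by apply: smoothM => //; exact: smooth_entry.
  exact: (smooth_compmx oA oB su (smooth_gam _ _) uAB).
under [X in pd _ X]eq_fun do rewrite gam_basis.
rewrite pd_sum => [|a]; last exact: differentiable_bigsum.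
rewrite (_ : 'D_(_) _ _ = \sum_a \sum_b (X x 0 a * Y x 0 b) *: pd i (fun x => G a b (u x)) x).
  rewrite [X in _ = _ + (X + _)]gam_basis [X in _ = _ + (_ + X)]gam_basis.
  rewrite -!big_split; apply: eq_bigr => a _.
  rewrite pd_sum => [|b]; last exact: dZ.
  rewrite -!big_split; apply: eq_bigr => b _ /=.
  rewrite (pd_scale i (dXY a b) (dGu a b)) (pdM i (dXe a) (dYe b)) !pd_entry//.
  by rewrite addrC scalerDl.
under [X in derive X _ _]eq_fun do rewrite gam_basis.
have dZc a b : differentiable (fun y => (X x 0 a * Y x 0 b) *: G a b y) (u x).
  exact: differentiableZ.
have Dsum (F : 'I_n -> 'rV[R]_n -> 'rV[R]_n) v : (forall a, differentiable (F a) (u x)) ->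
    'D_v (fun y => \sum_a F a y) (u x) = \sum_a 'D_v (F a) (u x).
  move=> dF; rewrite -derive_sum => [|a]; last exact: diff_derivable.
  by congr derive; apply/funext => y; rewrite fct_sumE.
rewrite Dsum => [|a]; last exact: differentiable_bigsum.
apply: eq_bigr => a _; rewrite Dsum//; apply: eq_bigr => b _.
have -> : 'D_(pd i u x) (fun y => (X x 0 a * Y x 0 b) *: gam h y (delta_mx 0 a) (delta_mx 0 b)) (u x)
   = (X x 0 a * Y x 0 b) *: 'D_(pd i u x) (G a b) (u x).
  exact: (deriveZ _ (diff_derivable (dG a b))).
by congr (_ *: _); rewrite [RHS]pdE (derive_compE _ du (dG a b)) -pdE.
Qed.

(** The Leibniz rule leaves the derivative of the metric along u, which
    metric_compatible splits into the two Christoffel terms. *)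
Lemma nab_metric i (V W : 'rV[R]_m -> 'rV[R]_n) x : A x -> smooth_on A V -> smooth_on A W ->
  pd i (fun x => inner (h (u x)) (V x) (W x)) x =
  inner (h (u x)) (nab h u i V x) (W x) + inner (h (u x)) (V x) (nab h u i W x).
Proof.
move=> Ax sV sW.
rewrite pd_inner; [|exact: smooth_diff smooth_metric_along Ax|
                    exact: smooth_diff sV Ax|exact: smooth_diff sW Ax].
rewrite pd_comp; [|exact: smooth_diff su Ax|exact: smooth_diff sh (uAB Ax)].
rewrite -[\sum_j _]/(dmetric (u x) (pd i u x)) metric_compatible; last exact: uAB.
rewrite !nabE innerDl innerDr; ring.
Qed.

(** Second derivatives commute and the Christoffel symbols are symmetric. *)
Lemma nab_torsion i j x : A x -> nab h u i (pd j u) x = nab h u j (pd i u) x.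
Proof.
move=> Ax; rewrite !nabE (gamC (uAB Ax)); congr (_ + _).
apply/rowP => a; rewrite !pd_entry; [|exact: smooth_diff (smooth_pd _ su) Ax..].
have E k l : pd k (fun t => pd l u t 0 a) x = pd k (pd l (fun t => u t 0 a)) x.
  by apply: (near_eq_pd k oA Ax) => y Ay; rewrite pd_entry//; exact: smooth_diff su Ay.
by rewrite !E (pdC i j oA (smooth_entry oA 0 a su) Ax).
Qed.

Lemma riemE y X Y Z : riem h y X Y Z =
  ('D_X (fun z => gam h z Y Z) y + gam h y X (gam h y Y Z))
  - ('D_Y (fun z => gam h z X Z) y + gam h y Y (gam h y X Z)).
Proof. by rewrite -curvature_riem /curvature Gam_gam. Qed.

(** Expanding both sides leaves, besides the curvature, terms that are
    symmetric in i and j because derivatives commute. *)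
Lemma nab_curvature i j V x : A x -> smooth_on A V ->
  nab h u i (nab h u j V) x - nab h u j (nab h u i V) x
  = riem h (u x) (pd i u x) (pd j u x) (V x).
Proof.
move=> Ax sV.
have su' k : smooth_on A (pd k u) by exact: smooth_pd.
have N k l : nab h u k (nab h u l V) x = pd k (pd l V) x
   + ('D_(pd k u x) (fun y => gam h y (pd l u x) (V x)) (u x)
   + (gam h (u x) (pd k (pd l u) x) (V x) + gam h (u x) (pd l u x) (pd k V x)))
   + (gam h (u x) (pd k u x) (pd l V x)
      + gam h (u x) (pd k u x) (gam h (u x) (pd l u x) (V x))).
  rewrite nabE nabE gamDr -pd_gam//; congr (_ + _).
  rewrite -pdD; last 2 first.
  - exact: smooth_diff (smooth_pd l sV) Ax.
  - exact: smooth_diff (smooth_gam_along (su' l) sV) Ax.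
  by apply: (near_eq_pd k oA Ax) => y Ay; rewrite nabE.
have C (q : nat) (F : 'rV[R]_m -> 'rV[R]_q) : smooth_on A F -> pd i (pd j F) x = pd j (pd i F) x.
  move=> sF; apply/rowP => a; rewrite !pd_entry; [|exact: smooth_diff (smooth_pd _ sF) Ax..].
  have E k l : pd k (fun t => pd l F t 0 a) x = pd k (pd l (fun t => F t 0 a)) x.
    by apply: (near_eq_pd k oA Ax) => y Ay; rewrite pd_entry//; exact: smooth_diff sF Ay.
  by rewrite !E (pdC i j oA (smooth_entry oA 0 a sF) Ax).
rewrite !N (C _ _ sV) (C _ _ su) riemE.
set a1 := pd j (pd i V) x; set a2 := 'D_(_) _ _; set a3 := gam _ _ (pd j _ x) (V x).
set a4 := gam _ _ _ _; set a5 := gam _ _ _ _; set a6 := gam _ _ _ _.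
set a7 := 'D_(_) _ _; set a8 := gam _ _ _ (gam _ _ _ _).
apply/rowP => k; rewrite !mxE; ring.
Qed.

End AlongMap.
End LeviCivita.

(** * Symmetries of the curvature tensor *)

Section Curvature.
Variables (R : realType) (n : nat) (h : 'rV[R]_n -> 'M[R]_n) (B : set 'rV[R]_n).
Hypothesis hB : metric_on B h.
Let oB : open B. Proof. by case: hB. Qed.

Lemma riem_skew y X Y Z : riem h y X Y Z = - riem h y Y X Z.
Proof. by rewrite !riemE opprB. Qed.

(** All terms cancel in pairs once gam is symmetrized, including inside the
    derivatives. *)
Lemma riem_bianchi y X Y Z : B y ->
  riem h y X Y Z + riem h y Y Z X + riem h y Z X Y = 0.
Proof.
move=> By.
have D V Y' Z' : 'D_V (fun z => gam h z Y' Z') y = 'D_V (fun z => gam h z Z' Y') y.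
  apply: near_eq_derive; apply: (near_open oB By) => z Bz; exact: (gamC hB).
rewrite !riemE (D X Y Z) (D Y X Z) (D Z Y X) !(gamC hB By _ (gam h y _ _)).
rewrite (gamC hB By X Y) (gamC hB By Y Z) (gamC hB By Z X).
apply/rowP => k; rewrite !mxE; ring.
Qed.

(** Apply d_i d_j = d_j d_i to the function <V, W>. *)
Lemma riem_skew_along m (A : set 'rV[R]_m) (u : 'rV[R]_m -> 'rV[R]_n)
    (V W : 'rV[R]_m -> 'rV[R]_n) i j x :
  open A -> smooth_on A u -> (forall x, A x -> B (u x)) ->
  smooth_on A V -> smooth_on A W -> A x ->
  inner (h (u x)) (riem h (u x) (pd i u x) (pd j u x) (V x)) (W x) =
  - inner (h (u x)) (V x) (riem h (u x) (pd i u x) (pd j u x) (W x)).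
Proof.
move=> oA su uAB sV sW Ax.
have sN k Z : smooth_on A Z -> smooth_on A (nab h u k Z) by move=> sZ; exact: (smooth_nab hB oA su uAB).
have compat := nab_metric hB oA su uAB.
pose f x := inner (h (u x)) (V x) (W x).
have sf : smooth_on A f.
  by apply: smooth_inner => //; exact: (smooth_metric_along hB oA su uAB).
have P k l : pd k (pd l f) x =
   inner (h (u x)) (nab h u k (nab h u l V) x) (W x)
   + inner (h (u x)) (nab h u l V x) (nab h u k W x)
   + (inner (h (u x)) (nab h u k V x) (nab h u l W x)
   + inner (h (u x)) (V x) (nab h u k (nab h u l W) x)).
  rewrite -!compat//; try exact: sN.
  rewrite -pdD.
  - by apply: (near_eq_pd k oA Ax) => t At; exact: compat.
  - apply: (smooth_diff (A := A)) => //; apply: smooth_inner => //; last exact: sN.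
    exact: (smooth_metric_along hB oA su uAB).
  - apply: (smooth_diff (A := A)) => //; apply: smooth_inner => //; last exact: sN.
    exact: (smooth_metric_along hB oA su uAB).
have := pdC i j oA sf Ax; rewrite !P.
rewrite -!(nab_curvature hB oA su uAB)//.
by rewrite innerBl innerBr; lra.
Qed.

(** riem_skew_along for the affine map (s0, s1) |-> y + s0 X + s1 Y and constant
    sections: this turns a pointwise identity into one along a map. *)
Lemma riem_skew_inner y X Y Z W : B y ->
  inner (h y) (riem h y X Y Z) W = - inner (h y) Z (riem h y X Y W).
Proof.
move=> By.
pose l (s : 'rV[R]_2) := y + (s 0 0 *: X + s 0 1 *: Y).
have sl : smooth_on setT l.
  have sc k (Z' : 'rV[R]_n) : smooth_on setT (fun s : 'rV[R]_2 => s 0 k *: Z').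
    exact: (smooth_mxZ openT (@smooth_coord R setT k) (smooth_mxcst openT Z')).
  exact: (smooth_mxD openT (smooth_mxcst openT y) (smooth_mxD openT (sc 0 X) (sc 1 Y))).
have dl s : differentiable l s by exact: smooth_diff sl I.
pose A := l @^-1` B.
have oA : open A.
  by apply: open_comp => // s _; exact: differentiable_continuous.
have l0 : l 0 = y by rewrite /l !mxE !scale0r !addr0.
have A0 : A 0 by rewrite /A/= l0.
have sA p q (F : 'rV[R]_2 -> 'M[R]_(p, q)) : smooth_on setT F -> smooth_on A F.
  by move=> sF s x _; exact: sF.
have P k : pd k l 0 = (0 == k)%:R *: X + (1 == k)%:R *: Y.
  have dX : differentiable (fun s : 'rV[R]_2 => s 0 0 *: X) 0.
    by apply: differentiableZl; exact: coord_diff.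
  have dY : differentiable (fun s : 'rV[R]_2 => s 0 1 *: Y) 0.
    by apply: differentiableZl; exact: coord_diff.
  rewrite /l pdD; [|exact: differentiable_cst|exact: differentiableD].
  rewrite pd_cst add0r pdD//.
  rewrite !pd_scale; try exact: coord_diff; try exact: differentiable_cst.
  by rewrite !pd_cst !scaler0 !addr0 !pd_coord.
have := @riem_skew_along 2 A l (fun _ => Z) (fun _ => W) 0 1 0 oA (sA _ _ _ sl) (fun _ => id)
   (sA _ _ _ (smooth_mxcst openT _)) (sA _ _ _ (smooth_mxcst openT _)) A0.
by rewrite l0 !P/= !scale1r !scale0r addr0 add0r.
Qed.

(** A linear combination of the Bianchi identities for the four cyclic triples
    of X, Y, Z, W. *)
Lemma riem_pair y X Y Z W : B y ->
  inner (h y) (riem h y X Y Z) W = inner (h y) (riem h y Z W X) Y.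
Proof.
move=> By.
have sy : (h y)^T = h y by case: hB => _ _ /(_ _ By).
pose r X Y Z W := inner (h y) (riem h y X Y Z) W.
have r1 X' Y' Z' W' : r X' Y' Z' W' = - r Y' X' Z' W'.
  by rewrite /r riem_skew innerNl.
have r2 X' Y' Z' W' : r X' Y' Z' W' = - r X' Y' W' Z'.
  by rewrite /r riem_skew_inner// (innerC _ _ sy).
have rb X' Y' Z' W' : r X' Y' Z' W' + r Y' Z' X' W' + r Z' X' Y' W' = 0.
  by rewrite /r -!innerDl riem_bianchi// inner0l.
rewrite -/(r X Y Z W) -/(r Z W X Y).
have := rb X Y Z W; have := rb Y Z W X; have := rb Z W X Y; have := rb W X Y Z.
have := r2 Y Z W X; have := r2 Z W Y X; have := r1 W Y Z X.
have := r1 W X Z Y; have := r2 X W Z Y; have := r1 X Z W Y; have := r2 Z X W Y.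
have := r1 W X Y Z; have := r2 X Y W Z; have := r2 Y W X Z.
by clearbody r; lra.
Qed.

End Curvature.

(** * Isometric maps and the tangential part of the bitension field *)

Section IsometricMap.
Variables (R : realType) (m n : nat).
Variables (g : 'rV[R]_m -> 'M[R]_m) (h : 'rV[R]_n -> 'M[R]_n).
Variables (A : set 'rV[R]_m) (B : set 'rV[R]_n) (u : 'rV[R]_m -> 'rV[R]_n).

Definition second_fund i j x : 'rV[R]_n :=
  nab h u i (pd j u) x
  - \sum_(k < m) gam g x (delta_mx 0 i) (delta_mx 0 j) 0 k *: pd k u x.

Definition tension_field x : 'rV[R]_n := \sum_i \sum_j invmx (g x) i j *: second_fund i j x.

Lemma second_formE i j x : second_form g h u i j x = second_fund i j x.
Proof. by rewrite /second_form pull_nabla_nab pder_pd Gam_gam. Qed.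

Lemma tensionE : tension g h u = tension_field.
Proof.
apply/funext => x; rewrite /tension /trace_g /tension_field.
by apply: eq_bigr => i _; apply: eq_bigr => j _; rewrite second_formE.
Qed.

Hypotheses (hg : metric_on A g) (hB : metric_on B h).
Hypotheses (su : smooth_on A u) (uAB : forall x, A x -> B (u x)).
Hypothesis iso : forall i j x, A x ->
  inner (h (u x)) (pd i u x) (pd j u x) = g x i j.
Let oA : open A. Proof. by case: hg. Qed.
Let oB : open B. Proof. by case: hB. Qed.
Let sg : smooth_on A g. Proof. by case: hg. Qed.
Let su' i : smooth_on A (pd i u). Proof. exact: smooth_pd. Qed.
Let sN i V : smooth_on A V -> smooth_on A (nab h u i V).
Proof. by move=> sV; exact: (smooth_nab hB oA su uAB). Qed.
Let compat := nab_metric hB oA su uAB.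
Let hsym x : A x -> (h (u x))^T = h (u x).
Proof. by move=> /uAB; case: hB => _ _ + _ => /(_ (u x)). Qed.
Let gsym x : A x -> (g x)^T = g x.
Proof. by case: hg => _ _ + _ => /(_ x). Qed.

Lemma smooth_second_fund i j : smooth_on A (second_fund i j).
Proof.
apply: smooth_mxB => //; first exact: sN.
apply: smooth_mxsum => // k; apply: smooth_mxZ => //.
by apply: smooth_entry => //; exact: smooth_gam.
Qed.

Lemma smooth_tension_field : smooth_on A tension_field.
Proof.
apply: smooth_mxsum => // i; apply: smooth_mxsum => // j; apply: smooth_mxZ => //.
  by apply: smooth_entry => //; apply: smooth_invmx => //; case: hg.
exact: smooth_second_fund.
Qed.

Lemma second_fund_sym i j x : A x -> second_fund i j x = second_fund j i x.
Proof.
by move=> Ax; rewrite /second_fund (nab_torsion hB oA su uAB)// (gamC hg Ax).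
Qed.

(** The Koszul argument: C_ijk = <nabla_i u_j, u_k> is symmetric in i, j, and
    d_i g_jk = C_ijk + C_ikj, so C_ijk is the Christoffel symbol of the first
    kind of g, which is what the subtracted term contributes. *)
Lemma second_fund_normal i j k x : A x -> inner (h (u x)) (second_fund i j x) (pd k u x) = 0.
Proof.
move=> Ax.
have pg a b c : pd a g x b c = inner (h (u x)) (nab h u a (pd b u) x) (pd c u x)
    + inner (h (u x)) (nab h u a (pd c u) x) (pd b u x).
  rewrite pd_entry; last exact: smooth_diff sg Ax.
  rewrite -(near_eq_pd a oA Ax (fun t At => iso b c At)) compat//.
  by rewrite [in X in _ + X](innerC _ _ (hsym Ax)).
have tor a b := nab_torsion hB oA su uAB a b Ax.
have dd a : dmetric g x (delta_mx 0 a) = pd a g x.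
  rewrite /dmetric (bigD1 a)//= !mxE !eqxx scale1r big1 ?addr0// => b ba.
  by rewrite !mxE eqxx (negbTE ba) scale0r.
rewrite /second_fund innerBl inner_suml.
under eq_bigr do rewrite innerZl iso//.
have -> : \sum_l gam g x (delta_mx 0 i) (delta_mx 0 j) 0 l * g x l k
   = inner (g x) (gam g x (delta_mx 0 i) (delta_mx 0 j)) (delta_mx 0 k).
  by rewrite /inner trmx_delta -colE !mxE.
rewrite (inner_gam hg Ax) !dd !inner_delta !pg (tor j i) (tor k i) (tor k j).
by field.
Qed.

Lemma tension_field_normal k x : A x -> inner (h (u x)) (tension_field x) (pd k u x) = 0.
Proof.
move=> Ax; rewrite /tension_field inner_suml big1// => i _; rewrite inner_suml big1// => j _.
by rewrite innerZl second_fund_normal// mulr0.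
Qed.

(** This is 2 <B, H> with H the mean curvature vector of a surface, since
    the tension field is the trace of B. *)
Definition tension_form i j x := inner (h (u x)) (second_fund i j x) (tension_field x).

Lemma smooth_tension_form i j : smooth_on A (tension_form i j).
Proof.
apply: smooth_inner => //; [exact: (smooth_metric_along hB oA su uAB)|exact: smooth_second_fund|].
exact: smooth_tension_field.
Qed.

Lemma tension_form_sym i j x : A x -> tension_form i j x = tension_form j i x.
Proof. by move=> Ax; rewrite /tension_form second_fund_sym. Qed.

Lemma inner_nab_pd i j x : A x ->
  inner (h (u x)) (nab h u i (pd j u) x) (tension_field x) = tension_form i j x.
Proof.
move=> Ax; rewrite /tension_form /second_fund innerBl inner_suml big1 ?subr0// => k _.
by rewrite innerZl (innerC _ _ (hsym Ax)) tension_field_normal// mulr0.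
Qed.

(** Differentiate <V, u_k> = 0: the Weingarten equation. *)
Lemma inner_nab_tension_field i k x : A x ->
  inner (h (u x)) (nab h u i tension_field x) (pd k u x) = - tension_form i k x.
Proof.
move=> Ax; apply/eqP; rewrite -addr_eq0 -inner_nab_pd//.
rewrite (innerC (nab h u i (pd k u) x) _ (hsym Ax)).
rewrite -compat//; last exact: smooth_tension_field.
by rewrite (near_eq_pd i oA Ax (fun t At => tension_field_normal k At)) pd_cst.
Qed.

Lemma bitensionE x : bitension g h u x =
  \sum_i \sum_j invmx (g x) i j *:
     (nab h u i (nab h u j tension_field) x
      - \sum_(k < m) gam g x (delta_mx 0 i) (delta_mx 0 j) 0 k *: nab h u k tension_field x
      - riem h (u x) (pd i u x) (tension_field x) (pd j u x)).
Proof.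
rewrite /bitension /trace_g /pull_nabla2 tensionE pull_nabla_nab pder_pd Gam_gam
  curvature_riem -sumrB; apply: eq_bigr => i _; rewrite -sumrB.
by apply: eq_bigr => j _; rewrite !scalerBr.
Qed.

(** Writing b for tension_form, V for the tension field, and T_ij for
    <nabla_j u_i, nabla_k V>: moving derivatives off nabla V gives -d_i b_jk,
    and the pair symmetry of the curvature turns <R(u_i, V) u_j, u_k> into
    <R(u_j, u_k) u_i, V>, a commutator of covariant derivatives of u_i.  The
    trace of T_ij is half the derivative of |V|^2, up to Christoffel terms. *)
Lemma inner_bitension k x : A x -> inner (h (u x)) (bitension g h u x) (pd k u x) =
  - (\sum_i \sum_j invmx (g x) i j *
     (2 * pd i (tension_form j k) x
      - 2 * (\sum_l gam g x (delta_mx 0 i) (delta_mx 0 j) 0 l * tension_form l k x)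
      - pd k (tension_form i j) x))
  - 2^-1 * pd k (fun x => inner (h (u x)) (tension_field x) (tension_field x)) x.
Proof.
move=> Ax.
pose ip := inner (h (u x)).
pose G i j l := gam g x (delta_mx 0 i) (delta_mx 0 j) 0 l.
pose T i j := ip (nab h u j (pd i u) x) (nab h u k tension_field x).
have sT := smooth_tension_field.
(* the rough Laplacian, by metric compatibility *)
have E1 i j : ip (nab h u i (nab h u j tension_field) x) (pd k u x) =
    - pd i (tension_form j k) x - ip (nab h u j tension_field x) (nab h u i (pd k u) x).
  apply/eqP; rewrite eq_sym subr_eq eq_sym -compat//; last exact: sN.
  rewrite (near_eq_pd i oA Ax (fun t At => inner_nab_tension_field j k At)).
  by rewrite pdN//; exact: smooth_diff (smooth_tension_form j k) Ax.
(* the curvature term, by pair symmetry and nab_curvature: the Codazzi equation *)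
have E2 i j : ip (riem h (u x) (pd i u x) (tension_field x) (pd j u x)) (pd k u x) =
    pd j (tension_form k i) x - ip (nab h u k (pd i u) x) (nab h u j tension_field x)
    - (pd k (tension_form j i) x - T i j).
  rewrite /ip (riem_pair hB _ _ _ _ (uAB Ax)).
  rewrite -(nab_curvature hB oA su uAB j k Ax (su' i)) innerBl.
  have F a b : pd a (tension_form b i) x = ip (nab h u a (nab h u b (pd i u)) x) (tension_field x)
      + ip (nab h u b (pd i u) x) (nab h u a tension_field x).
    rewrite -compat//; last exact: sN.
    by apply: (near_eq_pd a oA Ax) => t At; rewrite inner_nab_pd.
  by rewrite !F /T -/ip !addrK.
have tor a b := nab_torsion hB oA su uAB a b Ax.
have E3 i j : ip (nab h u i (nab h u j tension_field) x
      - \sum_(l < m) G i j l *: nab h u l tension_field x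
      - riem h (u x) (pd i u x) (tension_field x) (pd j u x)) (pd k u x) =
   - pd i (tension_form j k) x - pd j (tension_form i k) x + pd k (tension_form i j) x
    + \sum_l G i j l * tension_form l k x - T i j.
  rewrite /ip innerBl innerBl -/ip E1 E2 /ip inner_suml.
  under eq_bigr do rewrite innerZl inner_nab_tension_field// mulrN.
  rewrite sumrN opprK (tor k i) (innerC (nab h u j tension_field x) _ (hsym Ax)).
  rewrite (near_eq_pd j oA Ax (fun t At => tension_form_sym k i At)).
  rewrite (near_eq_pd k oA Ax (fun t At => tension_form_sym j i At)).
  ring.
(* the tangential part of nabla_j u_i meets -b_lk by the Weingarten equation *)
have E4 i j : T i j = ip (second_fund i j x) (nab h u k tension_field x) - \sum_l G i j l * tension_form l k x.
  rewrite /T (tor j i) /second_fund /ip innerBl inner_suml.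
  under [X in _ = _ - X - _]eq_bigr => l _.
    rewrite innerZl (innerC _ _ (hsym Ax)) inner_nab_tension_field// tension_form_sym// mulrN.
    over.
  by rewrite sumrN opprK addrK.
(* the trace of the second fundamental form is V itself *)
have E5 : \sum_i \sum_j invmx (g x) i j * ip (second_fund i j x) (nab h u k tension_field x) =
    2^-1 * pd k (fun x => inner (h (u x)) (tension_field x) (tension_field x)) x.
  rewrite compat// (innerC (nab h u k tension_field x) _ (hsym Ax)).
  have half (t : R) : 2^-1 * (t + t) = t by field.
  rewrite half.
  rewrite {2}/tension_field inner_suml; apply: eq_bigr => i _.
  by rewrite inner_suml; apply: eq_bigr => j _; rewrite innerZl.
have E6 : \sum_i \sum_j invmx (g x) i j * pd j (tension_form i k) x =
    \sum_i \sum_j invmx (g x) i j * pd i (tension_form j k) x.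
  rewrite exchange_big; apply: eq_bigr => i _; apply: eq_bigr => j _; congr (_ * _).
  by rewrite -[in LHS](gsym Ax) -trmx_inv mxE.
rewrite bitensionE inner_suml -E5.
under eq_bigr => i _.
  rewrite inner_suml.
  under eq_bigr do rewrite innerZl.
  over.
transitivity (\sum_i \sum_j (invmx (g x) i j * (- pd i (tension_form j k) x + pd k (tension_form i j) x
    + 2 * (\sum_l G i j l * tension_form l k x) - ip (second_fund i j x) (nab h u k tension_field x)) -
     invmx (g x) i j * pd j (tension_form i k) x)).
  apply: eq_bigr => i _; apply: eq_bigr => j _; rewrite [X in _ * X = _](E3 i j) E4; ring.
rewrite (_ : \sum_i _ = \sum_i \sum_j invmx (g x) i j *
    (- pd i (tension_form j k) x + pd k (tension_form i j) x
    + 2 * (\sum_l G i j l * tension_form l k x) - ip (second_fund i j x) (nab h u k tension_field x))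
    - \sum_i \sum_j invmx (g x) i j * pd j (tension_form i k) x); last first.
  by rewrite -sumrB; apply: eq_bigr => i _; rewrite -sumrB.
rewrite E6 -[LHS]sumrB -[X in _ = X - _]sumrN -[RHS]sumrB; apply: eq_bigr => i _.
rewrite -[LHS]sumrB -[X in _ = X - _]sumrN -[RHS]sumrB; apply: eq_bigr => j _; rewrite /G; ring.
Qed.

End IsometricMap.

(** * Orthonormal frames on a surface *)

Section HasPd.
Variables (R : realType) (m : nat) (i : 'I_m) (x : 'rV[R]_m).
Implicit Types f g : 'rV[R]_m -> R.

(** Differentiability and value together, so that the derivative of an explicit
    expression is found by applying the rules of its outermost operations. *)
Definition haspd f (d : R) := differentiable f x /\ pd i f x = d.

Lemma haspd_val f d : haspd f d -> pd i f x = d. Proof. by case. Qed.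
Lemma haspd_cst c : haspd (fun _ => c) 0.
Proof. by split; [exact: differentiable_cst|exact: pd_cst]. Qed.
Lemma haspdD f g df dg : haspd f df -> haspd g dg -> haspd (fun y => f y + g y) (df + dg).
Proof. by move=> [? <-] [? <-]; split; [exact: differentiableD|exact: pdD]. Qed.
Lemma haspdN f df : haspd f df -> haspd (fun y => - f y) (- df).
Proof. by move=> [? <-]; split; [exact: differentiableN|exact: pdN]. Qed.
Lemma haspdM f g df dg : haspd f df -> haspd g dg ->
  haspd (fun y => f y * g y) (df * g x + f x * dg).
Proof. by move=> [? <-] [? <-]; split; [exact: differentiableM|exact: pdM]. Qed.
Lemma haspdX2 f df : haspd f df -> haspd (fun y => f y ^+ 2) (2 * f x * df).
Proof.
move=> /[dup] h /(haspdM h) [d e]; split.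
  by under eq_fun do rewrite expr2.
by under [X in pd _ X]eq_fun do rewrite expr2; rewrite e; ring.
Qed.
Lemma haspdV f df : f x != 0 -> haspd f df ->
  haspd (fun y => (f y)^-1) (- ((f x)^-1 * (f x)^-1 * df)).
Proof. by move=> f0 [? <-]; split; [exact: differentiable_inv|exact: pdV]. Qed.
Lemma haspd_smooth A f : smooth_on A f -> A x -> haspd f (pd i f x).
Proof. by move=> sf Ax; split => //; exact: smooth_diff sf Ax. Qed.
Lemma haspd_near A f g d : open A -> A x -> (forall y, A y -> f y = g y) ->
  haspd f d -> haspd g d.
Proof.
move=> oA Ax fg [df <-]; split.
  exact: near_eq_differentiable (near_open oA Ax fg) df.
by apply: (near_eq_pd i oA Ax) => y Ay; rewrite fg.
Qed.
End HasPd.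

Ltac haspd_tac := repeat first
  [ eassumption | eapply haspd_cst | eapply haspdD | eapply haspdN | eapply haspdX2
  | eapply haspdM | eapply haspdV ].

Section Frame.
Variables (R : realType) (A : set 'rV[R]_2) (g : 'rV[R]_2 -> 'M[R]_2).
Hypothesis hg : metric_on A g.
Hypothesis gpos : forall x, A x -> forall X : 'rV[R]_2, X != 0 -> 0 < inner (g x) X X.
Let oA : open A. Proof. by case: hg. Qed.
Let sg : smooth_on A g. Proof. by case: hg. Qed.
Let gsym x : A x -> g x 1 0 = g x 0 1.
Proof. by move=> Ax; case: hg => _ _ /(_ _ Ax)/matrixP/(_ 0 1) <- _; rewrite mxE. Qed.

(** Cholesky factorization: the metric is the sum of the squares of the coframe
    chol11 dx0 + chol12 dx1, chol22 dx1. *)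
Definition chol11 x := Num.sqrt (g x 0 0).
Definition chol12 x := g x 0 1 / chol11 x.
Definition chol22 x := Num.sqrt (g x 1 1 - chol12 x ^+ 2).

Let g00 x : A x -> 0 < g x 0 0.
Proof.
move=> Ax; rewrite -inner_delta; apply: gpos => //.
by apply/eqP => /matrixP/(_ 0 0)/eqP; rewrite !mxE oner_eq0.
Qed.

Lemma chol11_gt0 x : A x -> 0 < chol11 x.
Proof. by move=> Ax; rewrite sqrtr_gt0 g00. Qed.

(* det g > 0, obtained by testing definiteness on the vector (-g_01, g_00) *)
Let chol22_arg x : A x -> 0 < g x 1 1 - chol12 x ^+ 2.
Proof.
move=> Ax; have E0 := g00 Ax; have a0 := chol11_gt0 Ax.
have := gpos Ax (X := \row_j (if j == 0 then - g x 0 1 else g x 0 0)).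
rewrite innerE !sum_ord2 !mxE/= (gsym Ax) => H.
have /H : (\row_j (if j == 0 then - g x 0 1 else g x 0 0)) != 0 :> 'rV[R]_2.
  by apply/eqP => /matrixP/(_ 0 1)/eqP; rewrite !mxE/= gt_eqF.
move=> H2; have -> : chol12 x ^+ 2 = g x 0 1 ^+ 2 / g x 0 0.
  by rewrite /chol12 expr_div_n /chol11 sqr_sqrtr// ltW.
rewrite -(@pmulr_rgt0 _ (g x 0 0))// mulrBr mulrCA mulfV ?gt_eqF// mulr1.
by rewrite -(@pmulr_rgt0 _ (g x 0 0))//; move: H2; congr (_ < _); ring.
Qed.

Lemma chol22_gt0 x : A x -> 0 < chol22 x.
Proof. by move=> Ax; rewrite sqrtr_gt0 chol22_arg. Qed.

Lemma metric00 x : A x -> g x 0 0 = chol11 x ^+ 2.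
Proof. by move=> Ax; rewrite sqr_sqrtr// ltW// g00. Qed.
Lemma metric01 x : A x -> g x 0 1 = chol11 x * chol12 x.
Proof. by move=> Ax; rewrite /chol12 mulrCA mulfV ?mulr1// gt_eqF// chol11_gt0. Qed.
Lemma metric10 x : A x -> g x 1 0 = chol11 x * chol12 x.
Proof. by move=> Ax; rewrite gsym// metric01. Qed.
Lemma metric11 x : A x -> g x 1 1 = chol12 x ^+ 2 + chol22 x ^+ 2.
Proof. by move=> Ax; rewrite /chol22 sqr_sqrtr ?ltW ?chol22_arg//; ring. Qed.

Lemma smooth_chol11 : smooth_on A chol11.
Proof. by apply: smooth_sqrt => //; exact: smooth_entry. Qed.
Lemma smooth_chol12 : smooth_on A chol12.
Proof.
apply: smoothM => //; first exact: smooth_entry.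
by apply: smoothV => //; [exact: smooth_chol11|move=> x /chol11_gt0/gt_eqF ->].
Qed.
Lemma smooth_chol22 : smooth_on A chol22.
Proof.
apply: smooth_sqrt => //; apply: smoothB => //; first exact: smooth_entry.
by under eq_fun do rewrite expr2; apply: smoothM => //; exact: smooth_chol12.
Qed.

Lemma invmx_metric x : A x -> invmx (g x) = \matrix_(i, j)
  if i == 0 then (if j == 0 then (chol12 x ^+ 2 + chol22 x ^+ 2) / (chol11 x ^+ 2 * chol22 x ^+ 2)
                  else - chol12 x / (chol11 x * chol22 x ^+ 2))
  else (if j == 0 then - chol12 x / (chol11 x * chol22 x ^+ 2) else (chol22 x ^+ 2)^-1).
Proof.
move=> Ax; have a0 := lt0r_neq0 (chol11_gt0 Ax); have c0 := lt0r_neq0 (chol22_gt0 Ax).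
have ug : g x \in unitmx by case: hg => _ _ _; exact.
set N := \matrix_(_, _) _; suff E : g x *m N = 1%:M.
  by rewrite -[RHS](mulKmx ug) E mulmx1.
apply/matrixP => i j; rewrite !mxE sum_ord2 !mxE/=.
case: (ord2 i) => ->; case: (ord2 j) => -> /=;
 rewrite ?metric00 ?metric01 ?metric10 ?metric11//; field; rewrite ?a0 ?c0//.
Qed.

Section Christoffel.
Variable x : 'rV[R]_2.
Hypothesis Ax : A x.
Let a0 := lt0r_neq0 (chol11_gt0 Ax).
Let c0 := lt0r_neq0 (chol22_gt0 Ax).

Lemma haspd_chol11 i : haspd i x chol11 (pd i chol11 x).
Proof. exact: haspd_smooth smooth_chol11 Ax. Qed.
Lemma haspd_chol12 i : haspd i x chol12 (pd i chol12 x).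
Proof. exact: haspd_smooth smooth_chol12 Ax. Qed.
Lemma haspd_chol22 i : haspd i x chol22 (pd i chol22 x).
Proof. exact: haspd_smooth smooth_chol22 Ax. Qed.

Lemma pd_metric i : [/\ pd i g x 0 0 = 2 * chol11 x * pd i chol11 x,
  pd i g x 0 1 = pd i chol11 x * chol12 x + chol11 x * pd i chol12 x,
  pd i g x 1 0 = pd i chol11 x * chol12 x + chol11 x * pd i chol12 x &
  pd i g x 1 1 = 2 * chol12 x * pd i chol12 x + 2 * chol22 x * pd i chol22 x].
Proof.
have ha := haspd_chol11 i; have hb := haspd_chol12 i; have hc := haspd_chol22 i.
split; (rewrite pd_entry; [apply: haspd_val; apply: haspd_near oA Ax _ _ |exact: smooth_diff sg Ax]).
- by move=> y Ay; rewrite metric00.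
- exact: haspdX2.
- by move=> y Ay; rewrite metric01.
- exact: haspdM.
- by move=> y Ay; rewrite metric10.
- exact: haspdM.
- by move=> y Ay; rewrite metric11.
- by apply: haspdD; exact: haspdX2.
Qed.

(** The connection form of the frame dual to the coframe, nabla e_1 = w e_2 and
    nabla e_2 = - w e_1, as determined by the two structure equations
    d theta1 = w /\ theta2, d theta2 = - w /\ theta1. *)
Definition spin_form (i : 'I_2) y : R :=
  let w0 := (pd 0 chol12 y - pd 1 chol11 y) / chol22 y in
  if i == 0 then w0 else (pd 0 chol22 y + w0 * chol12 y) / chol11 y.

Definition coframe1 (j : 'I_2) y := if j == 0 then chol11 y else chol12 y.
Definition coframe2 (j : 'I_2) y := if j == 0 then 0 else chol22 y.

Lemma gam_entry i j k : gam g x (delta_mx 0 i) (delta_mx 0 j) 0 k =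
  2^-1 * \sum_l invmx (g x) k l * (pd i g x j l + pd j g x i l - pd l g x i j).
Proof.
rewrite gamE mxE [LHS](bigD1 i)//= [X in _ + X]big1 => [|a ai]; last first.
  by rewrite big1// => b _; rewrite !mxE (negbTE ai) mulr0 mul0r.
rewrite addr0 [LHS](bigD1 j)//= [X in _ + X]big1 => [|b bj]; last first.
  by rewrite !mxE (negbTE bj) mulr0.
by rewrite addr0 !mxE !eqxx !mulr1.
Qed.

(** The covariant derivatives of the coframe, d theta2_j - gam theta2 =
    - w theta1_j and d theta1_j - gam theta1 = w theta2_j, solved for the Christoffel
    symbols. *)
Lemma christoffel1 i j : gam g x (delta_mx 0 i) (delta_mx 0 j) 0 1 =
  (pd i (coframe2 j) x + spin_form i x * coframe1 j x) / chol22 x.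
Proof.
rewrite gam_entry sum_ord2 (invmx_metric Ax) !mxE/=.
have [p1 p2 p3 p4] := pd_metric 0; have [q1 q2 q3 q4] := pd_metric 1.
rewrite /coframe2 /coframe1 /spin_form.
by case: (ord2 i) => ->; case: (ord2 j) => -> /=;
 rewrite ?p1 ?p2 ?p3 ?p4 ?q1 ?q2 ?q3 ?q4 ?pd_cst; field; rewrite a0 c0.
Qed.

Lemma christoffel0 i j : gam g x (delta_mx 0 i) (delta_mx 0 j) 0 0 =
  (pd i (coframe1 j) x - gam g x (delta_mx 0 i) (delta_mx 0 j) 0 1 * chol12 x
    - spin_form i x * coframe2 j x) / chol11 x.
Proof.
rewrite !gam_entry !sum_ord2 (invmx_metric Ax) !mxE/=.
have [p1 p2 p3 p4] := pd_metric 0; have [q1 q2 q3 q4] := pd_metric 1.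
rewrite /coframe2 /coframe1 /spin_form.
by case: (ord2 i) => ->; case: (ord2 j) => -> /=;
 rewrite ?p1 ?p2 ?p3 ?p4 ?q1 ?q2 ?q3 ?q4 ?pd_cst; field; rewrite a0 c0.
Qed.

End Christoffel.
End Frame.

(** * Divergence-free trace-free forms on a surface *)

Section TraceFree.
Variables (R : realType) (A : set 'rV[R]_2) (g : 'rV[R]_2 -> 'M[R]_2).
Hypothesis hg : metric_on A g.
Hypothesis gpos : forall x, A x -> forall X : 'rV[R]_2, X != 0 -> 0 < inner (g x) X X.
Variables (b : 'I_2 -> 'I_2 -> 'rV[R]_2 -> R) (c : R).
Hypothesis sb : forall i j, smooth_on A (b i j).
Hypothesis b_sym : forall x, A x -> b 1 0 x = b 0 1 x.
Hypothesis b_trace : forall x, A x ->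
  \sum_i \sum_j invmx (g x) i j * b i j x = 2 * c.
Hypothesis b_div : forall x k, A x -> \sum_i \sum_j invmx (g x) i j *
     (2 * pd i (b j k) x
      - 2 * (\sum_l gam g x (delta_mx 0 i) (delta_mx 0 j) 0 l * b l k x)
      - pd k (b i j) x) = 0.
Let oA : open A. Proof. by case: hg. Qed.
Notation al := (chol11 g).
Notation be := (chol12 g).
Notation ga := (chol22 g).
Let a0 x (Ax : A x) := lt0r_neq0 (chol11_gt0 gpos Ax).
Let c0 x (Ax : A x) := lt0r_neq0 (chol22_gt0 hg gpos Ax).
Let sa : smooth_on A al. Proof. exact: smooth_chol11. Qed.
Let sbe : smooth_on A be. Proof. exact: smooth_chol12. Qed.
Let sc : smooth_on A ga. Proof. exact: smooth_chol22. Qed.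

(** hopf_re and hopf_im are the values on (e_1, e_1) and (e_1, e_2) of the
    trace-free form b - c g; they are the real and imaginary part of its
    (2,0)-component, up to sign. *)
Definition hopf_re x := b 0 0 x * (al x ^+ 2)^-1 - c.
Definition hopf_im x := (b 0 1 x - be x * (al x)^-1 * b 0 0 x) * (al x * ga x)^-1.

Lemma smooth_hopf_re : smooth_on A hopf_re.
Proof.
apply: smoothB => //; last exact: smooth_cst.
apply: smoothM => //; apply: smoothV => //.
  by under eq_fun do rewrite expr2; exact: smoothM.
by move=> x Ax; rewrite expf_neq0// a0.
Qed.

Lemma smooth_hopf_im : smooth_on A hopf_im.
Proof.
apply: smoothM => //.
  apply: smoothB => //; apply: smoothM => //; apply: smoothM => //.
  by apply: smoothV => // x /a0.
apply: smoothV => //; first exact: smoothM.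
by move=> x Ax; rewrite mulf_neq0 ?a0 ?c0.
Qed.

Lemma b00E x : A x -> b 0 0 x = al x ^+ 2 * (hopf_re x + c).
Proof. by move=> Ax; rewrite /hopf_re; field; exact: a0. Qed.

Lemma b01E x : A x -> b 0 1 x = al x * be x * (hopf_re x + c) + al x * ga x * hopf_im x.
Proof. by move=> Ax; rewrite /hopf_re /hopf_im; field; rewrite (a0 Ax) (c0 Ax). Qed.

(** The last component is found from the trace. *)
Lemma b11E x : A x -> b 1 1 x =
  be x ^+ 2 * (hopf_re x + c) + 2 * be x * ga x * hopf_im x + ga x ^+ 2 * (c - hopf_re x).
Proof.
move=> Ax; have := b_trace Ax; rewrite !sum_ord2 (invmx_metric hg gpos Ax) !mxE/=.
rewrite (b_sym Ax) (b00E Ax) (b01E Ax).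
move: (hopf_re x) (hopf_im x) (b 1 1 x) (al x) (be x) (ga x) (a0 Ax) (c0 Ax) => p q b11 a bb cc a1 c1 E.
have -> : b11 = cc ^+ 2 * ((cc ^+ 2)^-1 * b11) by field.
have -> : (cc ^+ 2)^-1 * b11 = 2 * c - ((bb ^+ 2 + cc ^+ 2) / (a ^+ 2 * cc ^+ 2) * (a ^+ 2 * (p + c)) +
       - bb / (a * cc ^+ 2) * (a * bb * (p + c) + a * cc * q) +
       - bb / (a * cc ^+ 2) * (a * bb * (p + c) + a * cc * q)) by rewrite -E; ring.
by field; rewrite a1 c1.
Qed.

Section AtPoint.
Variable x : 'rV[R]_2.
Hypothesis Ax : A x.

(** The components on (e_1, e_1) and (e_1, e_2) of the covariant derivative of
    the trace-free form; the factor 2 is the weight of a quadratic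
    differential. *)
Definition dhopf_re i y := pd i hopf_re y - 2 * spin_form g i y * hopf_im y.
Definition dhopf_im i y := pd i hopf_im y + 2 * spin_form g i y * hopf_re y.

Lemma pd_hopf_re i y : pd i hopf_re y = dhopf_re i y + 2 * spin_form g i y * hopf_im y.
Proof. by rewrite /dhopf_re; ring. Qed.

Lemma pd_hopf_im i y : pd i hopf_im y = dhopf_im i y - 2 * spin_form g i y * hopf_re y.
Proof. by rewrite /dhopf_im; ring. Qed.

Lemma pd_b i : [/\
  pd i (b 0 0) x = 2 * al x * pd i al x * (hopf_re x + c) + al x ^+ 2 * pd i hopf_re x,
  pd i (b 0 1) x = (pd i al x * be x + al x * pd i be x) * (hopf_re x + c)
     + al x * be x * pd i hopf_re x
     + (pd i al x * ga x + al x * pd i ga x) * hopf_im x + al x * ga x * pd i hopf_im x,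
  pd i (b 1 0) x = pd i (b 0 1) x &
  pd i (b 1 1) x = 2 * be x * pd i be x * (hopf_re x + c) + be x ^+ 2 * pd i hopf_re x
     + 2 * (pd i be x * ga x + be x * pd i ga x) * hopf_im x + 2 * be x * ga x * pd i hopf_im x
     + 2 * ga x * pd i ga x * (c - hopf_re x) - ga x ^+ 2 * pd i hopf_re x].
Proof.
have ha := haspd_smooth i sa Ax; have hb := haspd_smooth i sbe Ax.
have hc := haspd_smooth i sc Ax.
have h1 := haspd_smooth i smooth_hopf_re Ax; have h2 := haspd_smooth i smooth_hopf_im Ax.
split.
- rewrite (near_eq_pd i oA Ax b00E).
  erewrite haspd_val; last haspd_tac; rewrite /=; ring.
- rewrite (near_eq_pd i oA Ax b01E).
  by erewrite haspd_val; last haspd_tac; rewrite /=; ring.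
- by apply: (near_eq_pd i oA Ax) => y; exact: b_sym.
- rewrite (near_eq_pd i oA Ax b11E).
  by erewrite haspd_val; last haspd_tac; rewrite /=; ring.
Qed.

(** Q = P o J, for the complex structure J of the metric: for a trace-free form
    in two dimensions the divergence has two components, div(e_1) =
    P(e_1) + Q(e_2) and div(e_2) = Q(e_1) - P(e_2). *)
Lemma cauchy_riemann : dhopf_im 0 x = (al x * dhopf_re 1 x - be x * dhopf_re 0 x) / ga x /\
  dhopf_im 1 x = be x * dhopf_re 1 x / ga x - (be x ^+ 2 + ga x ^+ 2) / (al x * ga x) * dhopf_re 0 x.
Proof.
have [p1 p2 p3 p4] := pd_b 0; have [q1 q2 q3 q4] := pd_b 1.
have aa := a0 Ax; have cc := c0 Ax.
(* the divergence on the coordinate vectors d_0 = chol11 e_1 and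
   d_1 = chol12 e_1 + chol22 e_2 *)
have E0 : dhopf_re 0 x + (al x * dhopf_im 1 x - be x * dhopf_im 0 x) / ga x = 0.
  rewrite -[RHS](mulr0 2^-1) -(b_div 0 Ax) !sum_ord2 (invmx_metric hg gpos Ax) !mxE/=.
  rewrite !(christoffel0 hg gpos Ax) !(christoffel1 hg gpos Ax).
  rewrite p1 p2 p3 p2 p4 q1 q3 q2 (b_sym Ax) (b00E Ax) (b01E Ax).
  rewrite /dhopf_re /dhopf_im /spin_form /coframe1 /coframe2 /= !pd_cst.
  by field; rewrite aa cc.
have E1 : be x * (dhopf_re 0 x / al x + (dhopf_im 1 x - be x * dhopf_im 0 x / al x) / ga x)
    + ga x * (dhopf_im 0 x / al x - (dhopf_re 1 x - be x * dhopf_re 0 x / al x) / ga x) = 0.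
  rewrite -[RHS](mulr0 2^-1) -(b_div 1 Ax) !sum_ord2 (invmx_metric hg gpos Ax) !mxE/=.
  rewrite !(christoffel0 hg gpos Ax) !(christoffel1 hg gpos Ax).
  rewrite p2 p4 q1 q3 q2 q4 (b11E Ax) (b01E Ax).
  rewrite /dhopf_re /dhopf_im /spin_form /coframe1 /coframe2 /= !pd_cst.
  by field; rewrite aa cc.
move: E0 E1 aa cc; move: (dhopf_re 0 x) (dhopf_re 1 x) (dhopf_im 0 x) (dhopf_im 1 x) (al x) (be x) (ga x).
move=> P0 P1 Q0 Q1 a bb c' E0 E1 aa cc.
have E2 : Q0 = (a * P1 - bb * P0) / c'.
  apply/eqP; rewrite -subr_eq0; apply/eqP.
  rewrite (_ : _ - _ = a / c' * (bb * (P0 / a + (Q1 - bb * Q0 / a) / c') +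
     c' * (Q0 / a - (P1 - bb * P0 / a) / c')) - bb / c' * (P0 + (a * Q1 - bb * Q0) / c')).
    by rewrite E0 E1; ring.
  by field; rewrite aa cc.
split => //.
have -> : Q1 = (bb * Q0 - c' * P0) / a + c' / a * (P0 + (a * Q1 - bb * Q0) / c').
  by field; rewrite aa cc.
by rewrite E0 E2; field; rewrite aa cc.
Qed.

End AtPoint.

Lemma smooth_spin_form i : smooth_on A (spin_form g i).
Proof.
have s0 : smooth_on A (fun y => (pd 0 be y - pd 1 al y) / ga y).
  apply: smoothM => //; last by apply: smoothV => // x /c0.
  by apply: smoothB => //; exact: smooth_pd.
rewrite /spin_form; case: (i == 0) => //.
apply: smoothM => //; last by apply: smoothV => // x /a0.
by apply: smoothD => //; [exact: smooth_pd|exact: smoothM].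
Qed.

(** The exterior derivative of spin_form, up to sign: the Gauss curvature times
    the area density, see gauss_curvatureE. *)
Definition spin_curl x := pd 1 (spin_form g 0) x - pd 0 (spin_form g 1) x.

(** The area density sqrt (det g) times the Laplacian of g, in divergence form:
    the first-order coefficients are derivatives of the principal ones. *)
Definition lap_a x := (be x ^+ 2 + ga x ^+ 2) * (al x * ga x)^-1.
Definition lap_b x := - (be x * (ga x)^-1).
Definition lap_c x := al x * (ga x)^-1.
Definition lap_b0 x := pd 0 lap_a x + pd 1 lap_b x.
Definition lap_b1 x := pd 1 lap_c x + pd 0 lap_b x.

Lemma smooth_lap_a : smooth_on A lap_a.
Proof.
apply: smoothM => //.
  under eq_fun do rewrite !expr2.
  by apply: smoothD => //; exact: smoothM.
apply: smoothV => //; first exact: smoothM.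
by move=> x Ax; rewrite mulf_neq0 ?a0 ?c0.
Qed.
Lemma smooth_lap_b : smooth_on A lap_b.
Proof. by apply: smoothN => //; apply: smoothM => //; apply: smoothV => // x /c0. Qed.
Lemma smooth_lap_c : smooth_on A lap_c.
Proof. by apply: smoothM => //; apply: smoothV => // x /c0. Qed.

(** Half the squared norm of the trace-free part. *)
Definition defect x := hopf_re x ^+ 2 + hopf_im x ^+ 2.

Lemma smooth_defect : smooth_on A defect.
Proof.
rewrite /defect; under eq_fun do rewrite !expr2.
by apply: smoothD => //; apply: smoothM => //; (exact: smooth_hopf_re || exact: smooth_hopf_im).
Qed.

(** With f = p^2 + q^2, P and Q the covariant differentials of p and q, and J
    the complex structure, df = 2 (p P + q Q) and Cauchy-Riemann gives
    df o J = 2 (p Q - q P).  Up to sign, the Laplacian is the exterior derivative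
    of df o J, and d of P and Q produces the curvature because p and q
    are multiplied by the connection form. *)
Lemma bochner x : A x ->
  second_order lap_a lap_b lap_c lap_b0 lap_b1 defect x =
  4 * (ga x / al x * dhopf_re 0 x ^+ 2
       + (al x * dhopf_re 1 x - be x * dhopf_re 0 x) ^+ 2 / (al x * ga x))
  + 4 * spin_curl x * defect x.
Proof.
move=> Ax.
have aa := a0 Ax; have cc := c0 Ax.
have hps i : smooth_on A (pd i hopf_re) by exact: smooth_pd i smooth_hopf_re.
have hqs i : smooth_on A (pd i hopf_im) by exact: smooth_pd i smooth_hopf_im.
have df i y : A y -> pd i defect y = 2 * (hopf_re y * pd i hopf_re y + hopf_im y * pd i hopf_im y).
  move=> Ay; have h1 := haspd_smooth i smooth_hopf_re Ay; have h2 := haspd_smooth i smooth_hopf_im Ay.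
  by rewrite /defect; erewrite haspd_val; last haspd_tac; rewrite /=; ring.
pose U i y := 2 * (hopf_re y * dhopf_im i y - hopf_im y * dhopf_re i y).
have J0 y : A y -> lap_c y * pd 1 defect y + lap_b y * pd 0 defect y = U 0 y.
  move=> Ay; have [c1 c2] := cauchy_riemann Ay.
  rewrite !df// !pd_hopf_re !pd_hopf_im /U c1 c2 /lap_c /lap_b.
  by field; rewrite (a0 Ay) (c0 Ay).
have J1 y : A y -> lap_a y * pd 0 defect y + lap_b y * pd 1 defect y = - U 1 y.
  move=> Ay; have [c1 c2] := cauchy_riemann Ay.
  rewrite !df// !pd_hopf_re !pd_hopf_im /U c1 c2 /lap_a /lap_b.
  by field; rewrite (a0 Ay) (c0 Ay).
have sdf := smooth_defect.
have L0 : pd 1 (U 0) x = pd 1 lap_c x * pd 1 defect x + lap_c x * pd 1 (pd 1 defect) x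
     + (pd 1 lap_b x * pd 0 defect x + lap_b x * pd 1 (pd 0 defect) x).
  rewrite -(near_eq_pd 1 oA Ax J0); apply: haspd_val.
  apply: haspdD; apply: haspdM; apply: haspd_smooth Ax;
  by [exact: smooth_lap_c|exact: smooth_lap_b|exact: smooth_pd].
have L1 : - pd 0 (U 1) x = pd 0 lap_a x * pd 0 defect x + lap_a x * pd 0 (pd 0 defect) x
     + (pd 0 lap_b x * pd 1 defect x + lap_b x * pd 0 (pd 1 defect) x).
  have sU : smooth_on A (U 1).
    rewrite /U /dhopf_im /dhopf_re; have h1 := smooth_hopf_re.
    have h2 := smooth_hopf_im; have h3 := smooth_spin_form 1.
    by do ?[exact: smooth_cst|exact: hps|exact: hqs|exact: h1|exact: h2|exact: h3
       |apply: smoothM => //|apply: smoothB => //|apply: smoothD => //].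
  rewrite -pdN; last exact: smooth_diff sU Ax.
  rewrite -(near_eq_pd 0 oA Ax J1); apply: haspd_val.
  apply: haspdD; apply: haspdM; apply: haspd_smooth Ax;
  by [exact: smooth_lap_a|exact: smooth_lap_b|exact: smooth_pd].
have UE i j : pd j (U i) x = 2 * (
    pd j hopf_re x * dhopf_im i x + hopf_re x * (pd j (pd i hopf_im) x
      + 2 * (pd j (spin_form g i) x * hopf_re x + spin_form g i x * pd j hopf_re x))
   - (pd j hopf_im x * dhopf_re i x + hopf_im x * (pd j (pd i hopf_re) x
      - 2 * (pd j (spin_form g i) x * hopf_im x + spin_form g i x * pd j hopf_im x)))).
  have h1 := haspd_smooth j smooth_hopf_re Ax; have h2 := haspd_smooth j smooth_hopf_im Ax.
  have h3 := haspd_smooth j (smooth_spin_form i) Ax.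
  have h4 := haspd_smooth j (hps i) Ax; have h5 := haspd_smooth j (hqs i) Ax.
  rewrite /U /dhopf_im /dhopf_re; erewrite haspd_val; last haspd_tac; rewrite /=; ring.
have -> : second_order lap_a lap_b lap_c lap_b0 lap_b1 defect x = pd 1 (U 0) x - pd 0 (U 1) x.
  rewrite L1 L0 /second_order /lap_b0 /lap_b1 (pdC 1 0 oA sdf Ax); ring.
rewrite !UE (pdC 1 0 oA smooth_hopf_re Ax) (pdC 1 0 oA smooth_hopf_im Ax) /spin_curl /defect.
have [c1 c2] := cauchy_riemann Ax.
rewrite !pd_hopf_re !pd_hopf_im c1 c2.
by field; rewrite aa cc.
Qed.

End TraceFree.

(** * Gauss curvature and parallel endomorphisms *)

Lemma det2 (K : comRingType) (N : 'M[K]_2) :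
  \det N = N 0 0 * N 1 1 - N 0 1 * N 1 0.
Proof.
rewrite (expand_det_row _ 0) sum_ord2 /cofactor !det_mx11 !mxE/=.
rewrite (_ : lift 0 0 = 1); last exact/val_inj.
rewrite (_ : lift 1 0 = 0); last exact/val_inj.
by rewrite expr0 expr1; ring.
Qed.

Section GaussCurvature.
Variables (R : realType) (A : set 'rV[R]_2) (g : 'rV[R]_2 -> 'M[R]_2).
Hypothesis hg : metric_on A g.
Hypothesis gpos : forall x, A x -> forall X : 'rV[R]_2, X != 0 -> 0 < inner (g x) X X.
Let oA : open A. Proof. by case: hg. Qed.
Notation al := (chol11 g).
Notation be := (chol12 g).
Notation ga := (chol22 g).
Let a0 x (Ax : A x) := lt0r_neq0 (chol11_gt0 gpos Ax).
Let c0 x (Ax : A x) := lt0r_neq0 (chol22_gt0 hg gpos Ax).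
Let sa : smooth_on A al. Proof. exact: smooth_chol11. Qed.
Let sbe : smooth_on A be. Proof. exact: smooth_chol12. Qed.
Let sc : smooth_on A ga. Proof. exact: smooth_chol22. Qed.

Definition vec2 (a b : R) : 'rV[R]_2 := \row_j if j == 0 then a else b.

Lemma vec2_0 a b : vec2 a b 0 0 = a. Proof. by rewrite mxE. Qed.
Lemma vec2_1 a b : vec2 a b 0 1 = b. Proof. by rewrite mxE. Qed.

Lemma rV2P (X Y : 'rV[R]_2) : X 0 0 = Y 0 0 -> X 0 1 = Y 0 1 -> X = Y.
Proof. by move=> e0 e1; apply/rowP => j; case: (ord2 j) => ->. Qed.

(** The vector f e_1 + k e_2, where e_1, e_2 is the frame dual to the coframe. *)
Definition frame (f k : R) y : 'rV[R]_2 :=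
  vec2 (f * (al y)^-1 - k * (be y * (al y * ga y)^-1)) (k * (ga y)^-1).

Lemma smooth_frame (f k : 'rV[R]_2 -> R) : smooth_on A f -> smooth_on A k ->
  smooth_on A (fun y => frame (f y) (k y) y).
Proof.
move=> sf sk; apply: smooth_mx => // i j; rewrite /frame /vec2.
have sai : smooth_on A (fun y => (al y)^-1) by apply: smoothV => // y /a0.
have sci : smooth_on A (fun y => (ga y)^-1) by apply: smoothV => // y /c0.
have saci : smooth_on A (fun y => (al y * ga y)^-1).
  by apply: smoothV => //; [exact: smoothM|move=> y Ay; rewrite mulf_neq0 ?a0 ?c0].
under eq_fun do rewrite mxE; case: (j == 0); last exact: smoothM.
by apply: smoothB => //; apply: smoothM => //; exact: smoothM.
Qed.

Lemma pd_id i (y : 'rV[R]_2) : pd i id y = delta_mx 0 i.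
Proof. by rewrite pdE derive_id. Qed.

Lemma gam_basis_l y i (V : 'rV[R]_2) : gam g y (delta_mx 0 i) V =
  V 0 0 *: gam g y (delta_mx 0 i) (delta_mx 0 0)
  + V 0 1 *: gam g y (delta_mx 0 i) (delta_mx 0 1).
Proof.
rewrite {1}(row_sum_delta V) gam_sumr sum_ord2.
by rewrite !gamZr.
Qed.

Lemma nab_frame (f k : 'rV[R]_2 -> R) i y : A y -> smooth_on A f -> smooth_on A k ->
  nab g id i (fun y => frame (f y) (k y) y) y =
  frame (pd i f y - spin_form g i y * k y) (pd i k y + spin_form g i y * f y) y.
Proof.
move=> Ay sf sk; have aa := a0 Ay; have cc := c0 Ay.
have ac : al y * ga y != 0 by rewrite mulf_neq0.
have ha := haspd_smooth i sa Ay; have hb := haspd_smooth i sbe Ay.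
have hc := haspd_smooth i sc Ay; have hf := haspd_smooth i sf Ay.
have hk := haspd_smooth i sk Ay.
rewrite nabE pd_id gam_basis_l.
have dF : differentiable (fun y => frame (f y) (k y) y) y.
  exact: smooth_diff (smooth_frame sf sk) Ay.
apply: rV2P; rewrite !mxE ?(christoffel0 hg gpos Ay) ?(christoffel1 hg gpos Ay)
  /coframe1 /coframe2/= ?pd_cst pd_entry//.
- have -> : pd i (fun y => frame (f y) (k y) y 0 0) y =
     pd i (fun y => f y * (al y)^-1 - k y * (be y * (al y * ga y)^-1)) y.
    by apply: (near_eq_pd i oA Ay) => z _; rewrite vec2_0.
  erewrite haspd_val; last haspd_tac; rewrite //=.
  by field; rewrite aa cc.
- have -> : pd i (fun y => frame (f y) (k y) y 0 1) y = pd i (fun y => k y * (ga y)^-1) y.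
    by apply: (near_eq_pd i oA Ay) => z _; rewrite vec2_1.
  erewrite haspd_val; last haspd_tac; rewrite //=.
  by field; rewrite aa cc.
Qed.

(** The second coordinate vector d_1 at x extends to a section V with constant
    coefficients in the frame; two applications of nab_frame and nab_curvature
    give R(d_0, d_1) d_1. *)
Lemma gauss_curvatureE x : A x ->
  gauss_curvature g x = spin_curl g x / (al x * ga x).
Proof.
move=> Ax; have aa := a0 Ax; have cc := c0 Ax.
have sid : smooth_on A (id : 'rV[R]_2 -> 'rV[R]_2).
  by apply: smooth_mx => // i j; rewrite ord1; exact: smooth_coord.
have ss i : smooth_on A (spin_form g i) := smooth_spin_form hg gpos i.
pose a := be x; pose k := ga x.
pose V y := frame a k y.
have sV : smooth_on A V by apply: (smooth_frame (smooth_cst oA a) (smooth_cst oA k)).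
have V1 : V x = delta_mx 0 1.
  by apply: rV2P; rewrite !mxE/= /a /k; field; rewrite ?aa ?cc.
have N1 i y : A y -> nab g id i V y = frame (- (spin_form g i y * k)) (spin_form g i y * a) y.
  move=> Ay; rewrite (nab_frame i Ay (smooth_cst oA a) (smooth_cst oA k)) !pd_cst.
  by rewrite sub0r add0r.
have NN i j : nab g id j (nab g id i V) x =
    frame (- (pd j (spin_form g i) x * k) - spin_form g j x * (spin_form g i x * a))
     (pd j (spin_form g i) x * a + spin_form g j x * - (spin_form g i x * k)) x.
  rewrite nabE (N1 i x Ax) (near_eq_pd j oA Ax (N1 i)).
  rewrite -(nabE g id j (fun y => frame (- (spin_form g i y * k)) (spin_form g i y * a) y)).
  have h := haspd_smooth j (ss i) Ax.
  rewrite nab_frame//.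
  - congr (frame (_ - _) (_ + _) x).
      by erewrite haspd_val; last haspd_tac; rewrite /=; ring.
    by erewrite haspd_val; last haspd_tac; rewrite /=; ring.
  - by apply: smoothN => //; apply: smoothM => //; exact: smooth_cst.
  - by apply: smoothM => //; exact: smooth_cst.
have := nab_curvature hg oA sid (fun _ => id) 0 1 Ax sV.
rewrite !pd_id V1 !NN => E.
rewrite /gauss_curvature curvature_riem -E innerE !sum_ord2 !mxE/= /a /k /spin_curl.
have -> : \det (g x) = (al x * ga x) ^+ 2.
  rewrite det2 (metric00 gpos Ax) (metric01 gpos Ax) (metric10 hg gpos Ax) (metric11 hg gpos Ax).
  ring.
rewrite (metric00 gpos Ax) (metric01 gpos Ax) (metric10 hg gpos Ax) (metric11 hg gpos Ax).
by field; rewrite aa cc.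
Qed.

End GaussCurvature.

Section Parallel.
Variables (R : realType) (A : set 'rV[R]_2) (g : 'rV[R]_2 -> 'M[R]_2).
Hypothesis hg : metric_on A g.
Hypothesis gpos : forall x, A x -> forall X : 'rV[R]_2, X != 0 -> 0 < inner (g x) X X.
Variables (b : 'I_2 -> 'I_2 -> 'rV[R]_2 -> R) (c : R).
Hypothesis sb : forall i j, smooth_on A (b i j).
Hypothesis b_sym : forall x, A x -> b 1 0 x = b 0 1 x.
Hypothesis b_trace : forall x, A x ->
  \sum_i \sum_j invmx (g x) i j * b i j x = 2 * c.
Let oA : open A. Proof. by case: hg. Qed.
Notation al := (chol11 g).
Notation be := (chol12 g).
Notation ga := (chol22 g).
Let a0 x (Ax : A x) := lt0r_neq0 (chol11_gt0 gpos Ax).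
Let c0 x (Ax : A x) := lt0r_neq0 (chol22_gt0 hg gpos Ax).
Let sa : smooth_on A al. Proof. exact: smooth_chol11. Qed.
Let sbe : smooth_on A be. Proof. exact: smooth_chol12. Qed.
Let sc : smooth_on A ga. Proof. exact: smooth_chol22. Qed.
Let p := hopf_re g b c.
Let q := hopf_im g b.

Definition form_endo x : 'M[R]_2 := (\matrix_(i, j) b i j x) *m invmx (g x).

Lemma form_endoE x : A x -> [/\ form_endo x 0 0 = c + p x - q x * be x * (ga x)^-1,
  form_endo x 0 1 = al x * q x * (ga x)^-1,
  form_endo x 1 0 = 2 * p x * be x * (al x)^-1 + q x * (ga x ^+ 2 - be x ^+ 2) * (al x * ga x)^-1 &
  form_endo x 1 1 = c + q x * be x * (ga x)^-1 - p x].
Proof.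
move=> Ax; have aa := a0 Ax; have cc := c0 Ax.
have B00 : b 0 0 x = al x ^+ 2 * (p x + c) := b00E gpos b c Ax.
have B01 : b 0 1 x = al x * be x * (p x + c) + al x * ga x * q x := b01E hg gpos b c Ax.
have B11 : b 1 1 x = be x ^+ 2 * (p x + c) + 2 * be x * ga x * q x + ga x ^+ 2 * (c - p x).
  exact: (b11E hg gpos b_sym b_trace Ax).
split; rewrite /form_endo mxE sum_ord2 !mxE (invmx_metric hg gpos Ax) !mxE/= ?(b_sym Ax) ?B00 ?B01 ?B11;
 by field; rewrite aa cc.
Qed.

Lemma det_form_endo x : A x -> c ^+ 2 - \det (form_endo x) = p x ^+ 2 + q x ^+ 2.
Proof.
move=> Ax; have aa := a0 Ax; have cc := c0 Ax; have [e1 e2 e3 e4] := form_endoE Ax.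
by rewrite det2 e1 e2 e3 e4; field; rewrite aa cc.
Qed.

Lemma form_endo_scalar x : A x -> p x = 0 -> q x = 0 -> form_endo x = c%:M.
Proof.
move=> Ax p0 q0; have [e1 e2 e3 e4] := form_endoE Ax.
apply/matrixP => i j; rewrite [RHS]mxE.
by case: (ord2 i) => ->; case: (ord2 j) => ->; rewrite ?e1 ?e2 ?e3 ?e4 ?p0 ?q0 /= ?mulr1n ?mulr0n; ring.
Qed.

(** In the frame the endomorphism has constant trace and trace-free part
    (p, q), whose covariant differentials vanish; in coordinates this is a
    computation with the explicit Christoffel symbols. *)
Lemma form_endo_parallel x i j : A x ->
  (forall k, dhopf_re g b c k x = 0) -> (forall k, dhopf_im g b c k x = 0) ->
  nabla_endo g form_endo i j x = 0.
Proof.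
move=> Ax P0 Q0; have aa := a0 Ax; have cc := c0 Ax.
have ac : al x * ga x != 0 by rewrite mulf_neq0.
have sp : smooth_on A p := smooth_hopf_re hg gpos c sb.
have sq : smooth_on A q := smooth_hopf_im hg gpos sb.
have ha := haspd_smooth i sa Ax; have hb := haspd_smooth i sbe Ax.
have hc := haspd_smooth i sc Ax.
have h1 : haspd i x p (2 * spin_form g i x * q x).
  have := haspd_smooth i sp Ax; have := P0 i; rewrite /dhopf_re -/p -/q => /eqP.
  by rewrite subr_eq0 => /eqP ->.
have h2 : haspd i x q (- (2 * spin_form g i x * p x)).
  have := haspd_smooth i sq Ax; have := Q0 i; rewrite /dhopf_im -/p -/q => /eqP.
  by rewrite addr_eq0 => /eqP ->.
rewrite /nabla_endo pder_pd Gam_gam.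
have [e1 e2 e3 e4] := form_endoE Ax.
have dS (k l : 'I_2) : smooth_on A (fun y => form_endo y k l).
  rewrite /form_endo; apply: smooth_entry => //; apply: smooth_mulmx => //.
    by apply: smooth_mx => // k' l'; under eq_fun do rewrite mxE; exact: sb.
  by apply: smooth_invmx => //; case: hg.
have dr : differentiable (fun y => row j (form_endo y)) x.
  apply: differentiable_mx => k l; under eq_fun do rewrite mxE.
  exact: smooth_diff (dS j l) Ax.
have pr l : pd i (fun y => row j (form_endo y)) x 0 l = pd i (fun y => form_endo y j l) x.
  by rewrite pd_entry//; congr pd; apply/funext => y; rewrite mxE.
have d00 : pd i (fun y => form_endo y 0 0) x = 
    pd i (fun x => c + p x - q x * be x * (ga x)^-1) x.
  by apply: (near_eq_pd i oA Ax) => y /form_endoE[].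
have d01 : pd i (fun y => form_endo y 0 1) x = pd i (fun x => al x * q x * (ga x)^-1) x.
  by apply: (near_eq_pd i oA Ax) => y /form_endoE[].
have d10 : pd i (fun y => form_endo y 1 0) x = pd i (fun x => 2 * p x * be x * (al x)^-1 +
     q x * (ga x ^+ 2 - be x ^+ 2) * (al x * ga x)^-1) x.
  by apply: (near_eq_pd i oA Ax) => y /form_endoE[].
have d11 : pd i (fun y => form_endo y 1 1) x = pd i (fun x => c + q x * be x * (ga x)^-1 - p x) x.
  by apply: (near_eq_pd i oA Ax) => y /form_endoE[].
have ch0 := christoffel0 hg gpos Ax; have ch1 := christoffel1 hg gpos Ax.
have R0 (X Y : 'rV[R]_2) l : (X + Y) 0 l = X 0 l + Y 0 l by rewrite mxE.
have R1 (X : 'rV[R]_2) l : (- X) 0 l = - X 0 l by rewrite mxE.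
have R2 (t : R) (X : 'rV[R]_2) l : (t *: X) 0 l = t * X 0 l by rewrite mxE.
have R3 (X : 'rV[R]_2) (N : 'M[R]_2) l : (X *m N) 0 l = X 0 0 * N 0 l + X 0 1 * N 1 l.
  by rewrite mxE sum_ord2.
have R4 (k l : 'I_2) (N : 'M[R]_2) : row k N 0 l = N k l by rewrite mxE.
rewrite gam_basis_l.
by apply: rV2P; rewrite R0 R0 R1 R3 R0 !R2 pr !R4 ?ch0 ?ch1 [RHS]mxE;
 case: (ord2 j) => ->; rewrite ?d00 ?d01 ?d10 ?d11 ?e1 ?e2 ?e3 ?e4 /coframe1 /coframe2/= ?pd_cst;
 (erewrite haspd_val; last haspd_tac; rewrite //=);
 field; rewrite aa cc.
Qed.

End Parallel.

(** * The shape operator in a chart *)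

Section ChartLevel.
Variables (R : realType) (n : nat).
Variables (g : 'rV[R]_2 -> 'M[R]_2) (h : 'rV[R]_n -> 'M[R]_n).
Variables (A : set 'rV[R]_2) (B : set 'rV[R]_n) (u : 'rV[R]_2 -> 'rV[R]_n).
Hypotheses (hg : metric_on A g) (hB : metric_on B h).
Hypothesis gpos : forall x, A x -> forall X : 'rV[R]_2, X != 0 -> 0 < inner (g x) X X.
Hypotheses (su : smooth_on A u) (uAB : forall x, A x -> B (u x)).
Hypothesis iso : forall i j x, A x ->
  inner (h (u x)) (pd i u x) (pd j u x) = g x i j.
Hypothesis biharmonic : forall x, A x -> bitension g h u x = 0.
Variable c : R.
Hypothesis Hconst : forall x, A x -> mean_curvature_sqnorm g h u x = c.
Let oA : open A. Proof. by case: hg. Qed.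

(* <B(d_i, d_j), H> *)
Let b i j x := 2^-1 * tension_form g h u i j x.

Lemma mean_curvatureE x : mean_curvature g h u x = 2^-1 *: tension_field g h u x.
Proof. by rewrite /mean_curvature -[trace_g _ _ _]/(tension g h u x) tensionE. Qed.

Lemma shape_HE : shape_H g h u = form_endo g b.
Proof.
apply/funext => x; rewrite /shape_H /form_endo; congr (_ *m _).
by apply/matrixP => i j; rewrite !mxE second_formE mean_curvatureE innerZr.
Qed.

Lemma tension_field_sqnorm x : A x ->
  inner (h (u x)) (tension_field g h u x) (tension_field g h u x) = 4 * c.
Proof.
move=> Ax; rewrite -(Hconst Ax) /mean_curvature_sqnorm mean_curvatureE innerZl innerZr.
by field.
Qed.

Let sb i j : smooth_on A (b i j).
Proof. by apply: smoothM => //; [exact: smooth_cst|exact: (smooth_tension_form hg hB)]. Qed.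

Let b_sym x : A x -> b 1 0 x = b 0 1 x.
Proof. by move=> Ax; rewrite /b (tension_form_sym hg hB su uAB). Qed.

Let b_trace x : A x -> \sum_i \sum_j invmx (g x) i j * b i j x = 2 * c.
Proof.
move=> Ax; have := tension_field_sqnorm Ax.
rewrite {1}/tension_field inner_suml; under eq_bigr do rewrite inner_suml.
move=> E; have -> : 2 * c = 2^-1 * (4 * c) by field.
rewrite -E mulr_sumr; apply: eq_bigr => i _; rewrite mulr_sumr; apply: eq_bigr => j _.
by rewrite innerZl mulrCA.
Qed.

Let b_div x k : A x -> \sum_i \sum_j invmx (g x) i j *
     (2 * pd i (b j k) x
      - 2 * (\sum_l gam g x (delta_mx 0 i) (delta_mx 0 j) 0 l * b l k x)
      - pd k (b i j) x) = 0.
Proof.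
move=> Ax; have := inner_bitension hg hB su uAB iso k Ax.
rewrite biharmonic// inner0l (near_eq_pd k oA Ax tension_field_sqnorm) pd_cst mulr0 subr0.
move/esym/eqP; rewrite oppr_eq0 => /eqP E; apply: etrans (mulr0 2^-1); move/(congr1 ( *%R 2^-1)): E => <-.
have pb i' j' k' : pd k' (b i' j') x = 2^-1 * pd k' (tension_form g h u i' j') x.
  rewrite /b pdM; [by rewrite pd_cst mul0r add0r|exact: differentiable_cst|].
  exact: smooth_diff (smooth_tension_form hg hB su uAB i' j') Ax.
rewrite [RHS]mulr_sumr; apply: eq_bigr => i _; rewrite [RHS]mulr_sumr; apply: eq_bigr => j _.
rewrite !pb (_ : \sum_l _ = 2^-1 * \sum_l gam g x (delta_mx 0 i) (delta_mx 0 j) 0 l *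
    tension_form g h u l k x); first by ring.
by rewrite mulr_sumr; apply: eq_bigr => l _; rewrite /b; ring.
Qed.

(** Cayley-Hamilton for an endomorphism of trace 2c. *)
Lemma det_shape_defect x : A x -> c ^+ 2 - \det (shape_H g h u x) = defect g b c x.
Proof. by move=> Ax; rewrite shape_HE (det_form_endo hg gpos b_sym b_trace Ax). Qed.

Lemma smooth_det_shape : smooth_on A (fun x => \det (shape_H g h u x)).
Proof.
rewrite shape_HE; apply: smooth_det => //; apply: smooth_mulmx => //.
  by apply: smooth_mx => // i j; under eq_fun do rewrite mxE; exact: sb.
by apply: smooth_invmx => //; case: hg.
Qed.

Hypothesis K_ge0 : forall x, A x -> 0 <= gauss_curvature g x.

Let ag x (Ax : A x) := chol11_gt0 gpos Ax.
Let cg x (Ax : A x) := chol22_gt0 hg gpos Ax.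

Lemma spin_curlE x : A x -> spin_curl g x = gauss_curvature g x * (chol11 g x * chol22 g x).
Proof.
move=> Ax; rewrite (gauss_curvatureE hg gpos Ax) divfK//.
by rewrite mulf_neq0 ?gt_eqF ?ag ?cg.
Qed.

Let L := second_order (lap_a g) (lap_b g) (lap_c g) (lap_b0 g) (lap_b1 g).

Lemma gradient_term_ge0 x : A x -> 0 <= chol22 g x / chol11 g x * dhopf_re g b c 0 x ^+ 2
       + (chol11 g x * dhopf_re g b c 1 x - chol12 g x * dhopf_re g b c 0 x) ^+ 2 / (chol11 g x * chol22 g x).
Proof.
move=> Ax; have a0 := ltW (ag Ax); have c0 := ltW (cg Ax).
apply: addr_ge0; first by rewrite mulr_ge0 ?sqr_ge0// divr_ge0.
by rewrite divr_ge0 ?sqr_ge0// mulr_ge0.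
Qed.

Lemma curvature_term_ge0 x : A x -> 0 <= spin_curl g x * defect g b c x.
Proof.
move=> Ax; have a0 := ltW (ag Ax); have cc0 := ltW (cg Ax).
rewrite spin_curlE//; apply: mulr_ge0; last by rewrite addr_ge0 ?sqr_ge0.
by rewrite mulr_ge0 ?K_ge0// mulr_ge0.
Qed.

Lemma bochner_defect x : A x -> L (defect g b c) x =
  4 * (chol22 g x / chol11 g x * dhopf_re g b c 0 x ^+ 2
       + (chol11 g x * dhopf_re g b c 1 x - chol12 g x * dhopf_re g b c 0 x) ^+ 2 / (chol11 g x * chol22 g x))
  + 4 * (spin_curl g x * defect g b c x).
Proof. by move=> Ax; rewrite mulrA; exact: (bochner hg gpos sb b_sym b_trace b_div Ax). Qed.

(** The determinant is c^2 - defect, and the defect is subharmonic by the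
    Bochner formula. *)
Lemma det_shape_min_local (M : R) x0 : (forall x, A x -> M <= \det (shape_H g h u x)) ->
  A x0 -> \det (shape_H g h u x0) = M ->
  \forall x \near x0, \det (shape_H g h u x) = M.
Proof.
move=> DM Ax0 D0.
have dE x : A x -> \det (shape_H g h u x) = c ^+ 2 - defect g b c x.
  by move=> Ax; rewrite -det_shape_defect//; ring.
have sa := smooth_lap_a hg gpos; have sbb := smooth_lap_b hg gpos.
have sc := smooth_lap_c hg gpos.
have ct f x : smooth_on A f -> A x -> {for x, continuous f}.
  by move=> sf Ax; apply: differentiable_continuous; exact: smooth_diff sf Ax.
have : \forall x \near x0, defect g b c x = c ^+ 2 - M.
  apply: (@strong_maximum R A (lap_a g) (lap_b g) (lap_c g) (lap_b0 g) (lap_b1 g)) => //.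
  - move=> x Ax; split; apply: ct Ax => //.
      by apply: smoothD => //; exact: smooth_pd.
    by apply: smoothD => //; exact: smooth_pd.
  - move=> x Ax; have a0 := ag Ax; have c0 := cg Ax; split.
      by rewrite divr_gt0 ?mulr_gt0// ltr_wpDl ?sqr_ge0// exprn_gt0.
    rewrite -subr_gt0 (_ : _ - _ = 1)// /lap_a /lap_b /lap_c; field.
    by rewrite !gt_eqF.
  - exact: smooth_defect.
  - move=> x Ax; rewrite -/L bochner_defect// addr_ge0// mulr_ge0//.
      exact: gradient_term_ge0.
    exact: curvature_term_ge0.
  - by move=> x Ax; have := DM _ Ax; rewrite dE//; lra.
  - by have := dE _ Ax0; rewrite D0; lra.
have nA := open_nbhs_nbhs (conj oA Ax0).
by apply: filterS2 nA => x Ax; rewrite dE// => ->; ring.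
Qed.

(** A constant defect has Laplacian 0, so the two nonnegative terms of the
    Bochner formula both vanish; the first one is a definite quadratic form in
    the covariant differential. *)
Lemma det_shape_const (M : R) : (forall x, A x -> \det (shape_H g h u x) = M) ->
  forall x, A x -> [/\ forall i j, nabla_endo g (shape_H g h u) i j x = 0,
    gauss_curvature g x * (c ^+ 2 - M) = 0 &
    c ^+ 2 = M -> shape_H g h u x = c%:M].
Proof.
move=> DM x Ax; have a0 := ag Ax; have c0 := cg Ax.
have dE y : A y -> defect g b c y = c ^+ 2 - M.
  by move=> Ay; rewrite -det_shape_defect// DM.
have pdE0 k y : A y -> pd k (defect g b c) y = 0.
  by move=> Ay; rewrite (near_eq_pd k oA Ay dE) pd_cst.
have L0 : L (defect g b c) x = 0.
  rewrite /L /second_order !pdE0//.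
  have pp i j : pd i (pd j (defect g b c)) x = 0.
    by rewrite (near_eq_pd i oA Ax (pdE0 j)) pd_cst.
  by rewrite !pp; ring.
have G0 := gradient_term_ge0 Ax; have C0 := curvature_term_ge0 Ax.
have := bochner_defect Ax; rewrite L0 => /esym E.
have {}C0 : spin_curl g x * defect g b c x = 0 by move: E G0 C0; lra.
move: E G0; rewrite C0 => E G0.
have {}G0 : chol22 g x / chol11 g x * dhopf_re g b c 0 x ^+ 2
       + (chol11 g x * dhopf_re g b c 1 x - chol12 g x * dhopf_re g b c 0 x) ^+ 2 / (chol11 g x * chol22 g x) = 0.
  by move: E G0; lra.
move: G0 => /eqP; rewrite paddr_eq0; last 2 first.
- by rewrite mulr_ge0 ?sqr_ge0// divr_ge0 ?ltW.
- by rewrite divr_ge0 ?sqr_ge0// mulr_ge0 ?ltW.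
case/andP; rewrite mulf_eq0 sqrf_eq0 gt_eqF ?divr_gt0//= => /eqP P0.
rewrite P0 mulr0 subr0 mulf_eq0 sqrf_eq0 mulf_eq0 invr_eq0 (gt_eqF a0)/=.
rewrite [_ == 0 in X in _ || X]gt_eqF ?mulr_gt0// orbF => /eqP P1.
have P k : dhopf_re g b c k x = 0 by case: (ord2 k) => ->.
have [q0 q1] := cauchy_riemann hg gpos sb b_sym b_trace b_div Ax.
have Q k : dhopf_im g b c k x = 0.
  by case: (ord2 k) => ->; rewrite ?q0 ?q1 P0 P1; ring.
split.
- by move=> i j; rewrite shape_HE; exact: (form_endo_parallel hg gpos sb b_sym b_trace).
- move: C0; rewrite spin_curlE// dE// => /eqP; rewrite mulf_eq0 mulf_eq0.
  rewrite [_ * chol22 _ _ == 0]mulf_eq0 (gt_eqF a0) (gt_eqF c0)/= orbF.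
  by case/orP => /eqP ->; rewrite ?mul0r ?mulr0.
- move=> cM; have := dE _ Ax; rewrite cM subrr /defect => /eqP.
  rewrite paddr_eq0 ?sqr_ge0// !expf_eq0/= => /andP[/eqP p0 /eqP q00].
  rewrite shape_HE; exact: (form_endo_scalar hg gpos b_sym b_trace Ax p0 q00).
Qed.

End ChartLevel.

(** * Change of charts *)

Section Composition.
Variables (R : realType) (m k n : nat).
Variables (g1 : 'rV[R]_m -> 'M[R]_m) (g2 : 'rV[R]_k -> 'M[R]_k) (h : 'rV[R]_n -> 'M[R]_n).
Variables (A : set 'rV[R]_m) (A2 : set 'rV[R]_k) (B : set 'rV[R]_n).
Variables (v : 'rV[R]_m -> 'rV[R]_k) (w : 'rV[R]_k -> 'rV[R]_n).
Hypotheses (oA : open A) (oA2 : open A2) (hB : metric_on B h).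
Hypotheses (sv : smooth_on A v) (sw : smooth_on A2 w).
Hypotheses (vA : forall x, A x -> A2 (v x)) (wA : forall y, A2 y -> B (w y)).
Let comp_wv x := w (v x).

Lemma pd_comp_wv j x : A x -> pd j comp_wv x = \sum_b pd j v x 0 b *: pd b w (v x).
Proof.
move=> Ax; apply: pd_comp; first exact: smooth_diff sv Ax.
exact: smooth_diff sw (vA Ax).
Qed.

(** The composition formula nabla d(w o v) = dw (nabla dv) + nabla dw (dv, dv). *)
Lemma second_fund_comp i j x : A x -> second_fund g1 h comp_wv i j x =
  \sum_c second_fund g1 g2 v i j x 0 c *: pd c w (v x)
  + \sum_a \sum_b (pd i v x 0 a * pd j v x 0 b) *: second_fund g2 h w a b (v x).
Proof.
move=> Ax; have A2v := vA Ax.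
have dv l : differentiable (pd l v) x by exact: smooth_diff (smooth_pd l sv) Ax.
have dw b : differentiable (pd b w) (v x) by exact: smooth_diff (smooth_pd b sw) A2v.
have dvx : differentiable v x by exact: smooth_diff sv Ax.
have dwv b : differentiable (fun x => pd b w (v x)) x.
  exact: (smooth_diff (smooth_compmx oA oA2 sv (smooth_pd b sw) vA) Ax).
have dve l b : differentiable (fun x => pd l v x 0 b) x by exact: differentiable_entry.
have pp : pd i (pd j comp_wv) x = \sum_b pd i (pd j v) x 0 b *: pd b w (v x)
   + \sum_a \sum_b (pd i v x 0 a * pd j v x 0 b) *: pd a (pd b w) (v x).
  rewrite (near_eq_pd i oA Ax (fun t At => pd_comp_wv j At)).
  rewrite pd_sum => [|b]; last first.
    apply: (smooth_diff (A := A)) => //; apply: smooth_mxZ => //.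
      by apply: smooth_entry => //; exact: smooth_pd.
    exact: (smooth_compmx oA oA2 sv (smooth_pd b sw) vA).
  rewrite exchange_big -big_split; apply: eq_bigr => b _ /=.
  rewrite (pd_scale i (dve j b) (dwv b)) (pd_entry _ _ _ (dv j)) (pd_comp i dvx (dw b)).
  congr (_ + _); rewrite scaler_sumr; apply: eq_bigr => a _.
  by rewrite scalerA mulrC.
have gg : gam h (comp_wv x) (pd i comp_wv x) (pd j comp_wv x) =
   \sum_a \sum_b (pd i v x 0 a * pd j v x 0 b) *: gam h (w (v x)) (pd a w (v x)) (pd b w (v x)).
  rewrite !pd_comp_wv// gam_suml; apply: eq_bigr => a _; rewrite gam_sumr; apply: eq_bigr => b _.
  by rewrite gamZl gamZr scalerA.
rewrite /second_fund nabE pp gg.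
have -> : \sum_a \sum_b (pd i v x 0 a * pd j v x 0 b) *:
     (nab h w a (pd b w) (v x) - \sum_c gam g2 (v x) (delta_mx 0 a) (delta_mx 0 b) 0 c *: pd c w (v x))
   = \sum_a \sum_b (pd i v x 0 a * pd j v x 0 b) *: pd a (pd b w) (v x)
   + \sum_a \sum_b (pd i v x 0 a * pd j v x 0 b) *: gam h (w (v x)) (pd a w (v x)) (pd b w (v x))
   - \sum_c gam g2 (v x) (pd i v x) (pd j v x) 0 c *: pd c w (v x).
  have -> : \sum_c gam g2 (v x) (pd i v x) (pd j v x) 0 c *: pd c w (v x) =
     \sum_a \sum_b (pd i v x 0 a * pd j v x 0 b) *:
       (\sum_c gam g2 (v x) (delta_mx 0 a) (delta_mx 0 b) 0 c *: pd c w (v x)).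
    under eq_bigr => c _.
      rewrite gam_basis summxE scaler_suml.
      under eq_bigr => a _.
        rewrite summxE scaler_suml.
        under eq_bigr do rewrite mxE -scalerA.
        over.
      over.
    rewrite exchange_big; apply: eq_bigr => a _; rewrite exchange_big; apply: eq_bigr => b _.
    by rewrite scaler_sumr.
  rewrite -!big_split -sumrB; apply: eq_bigr => a _ /=.
  rewrite -!big_split -sumrB; apply: eq_bigr => b _ /=.
  by rewrite nabE scalerBr scalerDr.
have -> : \sum_c (nab g2 v i (pd j v) x
    - \sum_(l < m) gam g1 x (delta_mx 0 i) (delta_mx 0 j) 0 l *: pd l v x) 0 c *: pd c w (v x)
   = \sum_c pd i (pd j v) x 0 c *: pd c w (v x)
    + \sum_c gam g2 (v x) (pd i v x) (pd j v x) 0 c *: pd c w (v x)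
    - \sum_(l < m) gam g1 x (delta_mx 0 i) (delta_mx 0 j) 0 l *: pd l comp_wv x.
  have -> : \sum_(l < m) gam g1 x (delta_mx 0 i) (delta_mx 0 j) 0 l *: pd l comp_wv x =
    \sum_c (\sum_(l < m) gam g1 x (delta_mx 0 i) (delta_mx 0 j) 0 l *: pd l v x) 0 c *: pd c w (v x).
    under eq_bigr => l _ do rewrite pd_comp_wv// scaler_sumr.
    rewrite exchange_big; apply: eq_bigr => c _ /=; rewrite summxE scaler_suml.
    by apply: eq_bigr => l _; rewrite mxE scalerA.
  rewrite -!big_split -sumrB; apply: eq_bigr => c _ /=.
  by rewrite nabE -scalerDl -scalerBl !mxE.
set t1 := \sum_(b < k) _; set t2 := \sum_a _; set t3 := \sum_a _; set t4 := \sum_(l < m) _.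
set t5 := \sum_c _.
apply/rowP => q; rewrite !mxE; ring.
Qed.

End Composition.

Section Transition.
Variables (R : realType) (m : nat).
Variables (g1 g2 : 'rV[R]_m -> 'M[R]_m) (A A2 : set 'rV[R]_m) (t : 'rV[R]_m -> 'rV[R]_m).
Hypotheses (h1 : metric_on A g1) (h2 : metric_on A2 g2).
Hypotheses (st : smooth_on A t) (tA : forall x, A x -> A2 (t x)).
Hypothesis iso : forall i j x, A x -> inner (g2 (t x)) (pd i t x) (pd j t x) = g1 x i j.

Definition jac n (u : 'rV[R]_m -> 'rV[R]_n) x : 'M[R]_(m, n) :=
  \matrix_(i, j) pd i u x 0 j.

Lemma row_jac n (u : 'rV[R]_m -> 'rV[R]_n) i x : row i (jac u x) = pd i u x.
Proof. by apply/rowP => j; rewrite !mxE. Qed.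

Lemma jac_metric x : A x -> jac t x *m g2 (t x) *m (jac t x)^T = g1 x.
Proof.
move=> Ax; apply/matrixP => i j; rewrite -iso// /inner -!row_jac.
by rewrite -row_mul [LHS]mxE [RHS]mxE; apply: eq_bigr => l _; rewrite !mxE.
Qed.

Lemma jac_unit x : A x -> jac t x \in unitmx.
Proof.
move=> Ax; have u1 : g1 x \in unitmx by case: h1 => _ _ _; exact.
by move: u1; rewrite -(jac_metric Ax) !unitmx_mul => /andP[/andP[]].
Qed.

(** The second fundamental form of an isometric map is normal, and for equal
    dimensions the image of the differential is everything. *)
Lemma second_fund_transition i j x : A x -> second_fund g1 g2 t i j x = 0.
Proof.
move=> Ax; have u2 : g2 (t x) \in unitmx by case: h2 => _ _ _; apply; exact: tA.
have E : second_fund g1 g2 t i j x *m g2 (t x) *m (jac t x)^T = 0.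
  apply/rowP => k; have := second_fund_normal h1 h2 st tA iso i j k Ax.
  rewrite /inner mxE => E; rewrite [RHS]mxE mxE -[RHS]E.
  by apply: eq_bigr => l _; rewrite !mxE.
have uj : (jac t x)^T \in unitmx by rewrite unitmx_tr jac_unit.
by rewrite -[LHS](mulmxK u2) -[X in X *m _](mulmxK uj) E !mul0mx.
Qed.

End Transition.

Definition shape_form (R : realType) (m n : nat) (g : 'rV[R]_m -> 'M[R]_m)
    (h : 'rV[R]_n -> 'M[R]_n) (u : 'rV[R]_m -> 'rV[R]_n) x : 'M[R]_m :=
  \matrix_(i, j) (m%:R^-1 * inner (h (u x)) (second_fund g h u i j x) (tension_field g h u x)).

Lemma shape_HE_form (R : realType) (m n : nat) (g : 'rV[R]_m -> 'M[R]_m)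
    (h : 'rV[R]_n -> 'M[R]_n) (u : 'rV[R]_m -> 'rV[R]_n) x :
  shape_H g h u x = shape_form g h u x *m invmx (g x).
Proof.
rewrite /shape_H; congr (_ *m _); apply/matrixP => i j; rewrite !mxE second_formE.
by rewrite /mean_curvature -[trace_g _ _ _]/(tension g h u x) tensionE innerZr.
Qed.

Section ChangeOfCharts.
Variables (R : realType) (m n : nat).
Variables (g1 g2 : 'rV[R]_m -> 'M[R]_m) (h1 h2 : 'rV[R]_n -> 'M[R]_n).
Variables (A A2 : set 'rV[R]_m) (B B2 : set 'rV[R]_n).
Variables (t : 'rV[R]_m -> 'rV[R]_m) (s : 'rV[R]_n -> 'rV[R]_n).
Variables (u1 u2 : 'rV[R]_m -> 'rV[R]_n).
Hypotheses (mg1 : metric_on A g1) (mg2 : metric_on A2 g2).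
Hypotheses (mh1 : metric_on B h1) (mh2 : metric_on B2 h2).
Hypotheses (st : smooth_on A t) (tA : forall x, A x -> A2 (t x)).
Hypotheses (ss : smooth_on B s) (sB : forall y, B y -> B2 (s y)).
Hypotheses (su1 : smooth_on A u1) (uB1 : forall x, A x -> B (u1 x)).
Hypotheses (su2 : smooth_on A2 u2) (uB2 : forall x, A2 x -> B2 (u2 x)).
Hypothesis t_iso : forall i j x, A x -> inner (g2 (t x)) (pd i t x) (pd j t x) = g1 x i j.
Hypothesis s_iso : forall i j y, B y -> inner (h2 (s y)) (pd i s y) (pd j s y) = h1 y i j.
Hypothesis compat : forall x, A x -> s (u1 x) = u2 (t x).
Let oA : open A. Proof. by case: mg1. Qed.
Let oA2 : open A2. Proof. by case: mg2. Qed.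
Let oB : open B. Proof. by case: mh1. Qed.

Lemma near_eq_second_fund (v w : 'rV[R]_m -> 'rV[R]_n) i j x : A x -> (forall y, A y -> v y = w y) ->
  second_fund g1 h2 v i j x = second_fund g1 h2 w i j x.
Proof.
move=> Ax vw; have E k y : A y -> pd k v y = pd k w y.
  by move=> Ay; exact: (near_eq_pd k oA Ay vw).
rewrite /second_fund !nabE !E// vw// (near_eq_pd i oA Ax (E j)); congr (_ - _).
by apply: eq_bigr => k _; rewrite E.
Qed.

(** Compute nabla d of s o u1 = u2 o t in two ways; nabla ds and nabla dt
    vanish. *)
Lemma second_fund_change i j x : A x -> second_fund g1 h1 u1 i j x *m jac s (u1 x) =
  \sum_a \sum_b (jac t x i a * jac t x j b) *: second_fund g2 h2 u2 a b (t x).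
Proof.
move=> Ax.
have mul_jac (X : 'rV[R]_n) y : X *m jac s y = \sum_c X 0 c *: pd c s y.
  by rewrite mulmx_sum_row; apply: eq_bigr => c _; rewrite row_jac.
rewrite mul_jac.
have := second_fund_comp g1 h1 h2 oA oB su1 ss uB1 i j Ax.
rewrite [X in _ + X]big1 ?addr0 => [<-|a _]; last first.
  by rewrite big1// => b _; rewrite (second_fund_transition mh1 mh2 ss sB s_iso)// ?scaler0//; exact: uB1.
rewrite (near_eq_second_fund i j Ax compat).
rewrite (second_fund_comp g1 g2 h2 oA oA2 st su2 tA i j Ax).
rewrite [X in X + _]big1 ?add0r => [|c _]; last first.
  by rewrite (second_fund_transition mg1 mg2 st tA t_iso)// mxE scale0r.
by apply: eq_bigr => a _; apply: eq_bigr => b _; rewrite !mxE.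
Qed.

Lemma inner_jac X Y y : B y ->
  inner (h1 y) X Y = inner (h2 (s y)) (X *m jac s y) (Y *m jac s y).
Proof. by move=> By; rewrite /inner -(jac_metric s_iso By) trmx_mul !mulmxA. Qed.

Lemma invmx_change x : A x ->
  (jac t x)^T *m invmx (g1 x) *m jac t x = invmx (g2 (t x)).
Proof.
move=> Ax; have ug : g1 x \in unitmx by case: mg1 => _ _ _; exact.
have ug2 : g2 (t x) \in unitmx by case: mg2 => _ _ _; apply; exact: tA.
have uj := jac_unit mg1 t_iso Ax.
rewrite -[LHS](mulmxK ug2) -[RHS]mul1mx; congr (_ *m _).
rewrite -!mulmxA; have ujT : (jac t x)^T \in unitmx by rewrite unitmx_tr.
apply: (can_inj (mulmxK ujT)).
by rewrite -!mulmxA [jac t x *m _]mulmxA (jac_metric t_iso Ax) mulVmx// mulmx1 mul1mx.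
Qed.

Lemma tension_field_change x : A x ->
  tension_field g1 h1 u1 x *m jac s (u1 x) = tension_field g2 h2 u2 (t x).
Proof.
move=> Ax; rewrite /tension_field mulmx_suml.
under eq_bigr => i _.
  rewrite mulmx_suml.
  under eq_bigr => j _.
    rewrite -scalemxAl second_fund_change// scaler_sumr.
    under eq_bigr => a _.
      rewrite scaler_sumr.
      under eq_bigr => b _ do rewrite scalerA.
      over.
    over.
  over.
under [RHS]eq_bigr => a _.
  under eq_bigr => b _.
    rewrite -(invmx_change Ax) mxE scaler_suml.
    under eq_bigr => j _.
      rewrite mxE mulr_suml scaler_suml.
      over.
    over.
  over.
transitivity (\sum_i \sum_j \sum_a \sum_b
   (invmx (g1 x) i j * (jac t x i a * jac t x j b)) *: second_fund g2 h2 u2 a b (t x)) => //.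
have swap (F : 'I_m -> 'I_m -> 'I_m -> 'I_m -> 'rV[R]_n) :
   \sum_i \sum_j \sum_a \sum_b F i j a b = \sum_a \sum_b \sum_j \sum_i F i j a b.
  under eq_bigr do rewrite exchange_big.
  rewrite exchange_big; apply: eq_bigr => a _.
  under eq_bigr do rewrite exchange_big.
  rewrite exchange_big; apply: eq_bigr => b _.
  by rewrite exchange_big.
rewrite swap; apply: eq_bigr => a _; apply: eq_bigr => b _; apply: eq_bigr => j _.
apply: eq_bigr => i _; congr (_ *: _); rewrite [in RHS]mxE; ring.
Qed.

(** <B, H> is multiplied by the Jacobian of t on both sides, and so is the
    metric: the quotient of determinants is unchanged. *)
Lemma det_shape_change x : A x ->
  \det (shape_H g1 h1 u1 x) = \det (shape_H g2 h2 u2 (t x)).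
Proof.
move=> Ax; rewrite !shape_HE_form !det_mulmx !det_inv.
have -> : shape_form g1 h1 u1 x = jac t x *m shape_form g2 h2 u2 (t x) *m (jac t x)^T.
  apply/matrixP => i j; rewrite [LHS]mxE inner_jac; last exact: uB1.
  rewrite second_fund_change// tension_field_change// compat// inner_suml mulr_sumr [RHS]mxE.
  under [RHS]eq_bigr => b _.
    rewrite mxE mulr_suml.
    over.
  rewrite [RHS]exchange_big; apply: eq_bigr => a _; rewrite inner_suml mulr_sumr; apply: eq_bigr => b _ /=.
  rewrite innerZl [shape_form _ _ _ _ a b]mxE [(jac t x)^T b j]mxE.
  ring.
rewrite -(jac_metric t_iso Ax) !det_mulmx det_tr.
have uj := jac_unit mg1 t_iso Ax; rewrite unitmxE unitfE in uj.
have ug2 : g2 (t x) \in unitmx by case: mg2 => _ _ _; apply; exact: tA.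
rewrite unitmxE unitfE in ug2.
rewrite !invfM; move: (\det (jac t x)) (\det (shape_form _ _ _ _)) (\det (g2 _)) uj ug2 => d1 d2 d3 n1 n3.
by rewrite (_ : d1 * d2 * d1 = d2 * (d1 * d1)); [field; rewrite n1 n3|ring].
Qed.

End ChangeOfCharts.

(** * Globalization *)

Section Charts.
Variables (R : realType) (m : nat) (M : manifold R m).

Lemma chart_cover (p : M) : exists i, @chart_dom _ _ M i p.
Proof. by move: M p => []. Qed.
Lemma chart_open (i : chart_index M) : open (chart_dom i).
Proof. by move: M i => []. Qed.
Lemma chart_img_open (i : chart_index M) : open (chart i @` chart_dom i).
Proof. by move: M i => []. Qed.
Lemma chartK (i : chart_index M) p : chart_dom i p -> chart_inv i (chart i p) = p.
Proof.
move: M i p => [P I cd ch ci H1 H2 H3 H4 H5 H6 ? ? ?] i p /= ip.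
by apply: (H6 i p); rewrite inE.
Qed.
Lemma chart_within (i : chart_index M) : {within chart_dom i, continuous (chart i)}.
Proof. by move: M i => []. Qed.
Lemma chart_inv_within (i : chart_index M) :
  {within chart i @` chart_dom i, continuous (chart_inv i)}.
Proof. by move: M i => []. Qed.
Lemma chart_trans_smooth (i j : chart_index M) :
  smooth_on (chart i @` (chart_dom i `&` chart_dom j)) (chart j \o chart_inv i).
Proof. by move: M i j => []. Qed.

Lemma chart_continuous (i : chart_index M) p : chart_dom i p ->
  {for p, continuous (chart i)}.
Proof.
move=> ip; have := @chart_within i.
rewrite continuous_open_subspace; last exact: chart_open.
by apply; rewrite inE.
Qed.

Lemma chart_inv_continuous (i : chart_index M) x : (chart i @` chart_dom i) x ->
  {for x, continuous (chart_inv i)}.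
Proof.
move=> ix; have := @chart_inv_within i.
rewrite continuous_open_subspace; last exact: chart_img_open.
by apply; rewrite inE.
Qed.

(** Near chart i p the image is the preimage of V under chart_inv i, which is
    continuous there. *)
Lemma open_chart_image (i : chart_index M) (V : set M) : open V ->
  open (chart i @` (chart_dom i `&` V)).
Proof.
move=> oV; rewrite openE => x [p [ip Vp] <-].
have ix : (chart i @` chart_dom i) (chart i p) by exists p.
have n1 := open_nbhs_nbhs (conj (chart_img_open (i := i)) ix).
have n2 : nbhs (chart i p) (chart_inv i @^-1` V).
  apply: (chart_inv_continuous ix); rewrite (chartK ip).
  exact: open_nbhs_nbhs.
apply: filterS2 n1 n2 => _ [q iq <-] /=; rewrite (chartK iq) => Vq.
by exists q.
Qed.

End Charts.

Section RiemannianCharts.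
Variables (R : realType) (m : nat) (M : riemannian R m).

Lemma metric_smooth (i : chart_index M) : smooth_on (chart i @` chart_dom i) (metric i).
Proof. by move: M i => []. Qed.
Lemma metric_sym (i : chart_index M) x : (chart i @` chart_dom i) x ->
  (metric i x)^T = metric i x.
Proof. by move: M i x => [? ? ? H ? ?] i x; exact: H. Qed.
Lemma metric_pos (i : chart_index M) x : (chart i @` chart_dom i) x ->
  forall X : 'rV[R]_m, X != 0 -> 0 < inner (metric i x) X X.
Proof. by move: M i x => [? ? ? ? H ?] i x; exact: H. Qed.
Lemma metric_change (i j : chart_index M) x :
  (chart i @` (chart_dom i `&` chart_dom j)) x ->
  metric i x = 'J (chart j \o chart_inv i) x
    *m metric j ((chart j \o chart_inv i) x) *m ('J (chart j \o chart_inv i) x)^T.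
Proof. by move: M i j x => [? ? ? ? ? H] i j x; exact: H. Qed.

Lemma metric_unit (i : chart_index M) x : (chart i @` chart_dom i) x ->
  metric i x \in unitmx.
Proof.
move=> ix; rewrite -row_free_unit -kermx_eq0; apply/eqP/row_matrixP => k; rewrite row0.
apply/eqP; apply: contraT => nz; have := metric_pos ix nz.
by rewrite /inner -row_mul mulmx_ker row0 mul0mx mxE ltxx.
Qed.

Lemma metric_on_chart (i : chart_index M) (A : set 'rV[R]_m) : open A ->
  A `<=` chart i @` chart_dom i -> metric_on A (metric i).
Proof.
move=> oA Ai; split => //.
- by move=> s x /Ai ix; exact: metric_smooth.
- by move=> x /Ai; exact: metric_sym.
- by move=> x /Ai; exact: metric_unit.
Qed.

End RiemannianCharts.

Lemma row_jacobian (R : realType) m n (u : 'rV[R]_m -> 'rV[R]_n) i x :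
  differentiable u x -> row i ('J u x) = pd i u x.
Proof. by move=> du; rewrite pdE deriveEjacobian// rowE. Qed.

Lemma pullback_entry (R : realType) m n (u : 'rV[R]_m -> 'rV[R]_n) (h : 'M[R]_n) i j x :
  differentiable u x ->
  ('J u x *m h *m ('J u x)^T) i j = inner h (pd i u x) (pd j u x).
Proof.
move=> du; rewrite /inner -!row_jacobian// -row_mul [LHS]mxE [RHS]mxE.
by apply: eq_bigr => l _; rewrite !mxE.
Qed.

Section Global.
Variables (R : realType) (n : nat) (M : riemannian R 2) (N : riemannian R n).
Variable phi : M -> N.
Hypothesis phi_immersion : riemannian_immersion phi.
Implicit Types (i j : chart_index M) (a b : chart_index N) (p : M).

Let phi_cont : continuous phi.
Proof. by case: phi_immersion => -[[]]. Qed.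

Lemma open_preimage_chart a : open (phi @^-1` chart_dom a).
Proof. by apply: open_comp => [p _|]; [exact: phi_cont|exact: chart_open]. Qed.

Lemma local_dom_open i a : open (local_dom phi i a).
Proof. by apply: open_chart_image; exact: open_preimage_chart. Qed.

Lemma local_dom_sub i a : local_dom phi i a `<=` chart i @` chart_dom i.
Proof. by move=> _ [p [ip _] <-]; exists p. Qed.

Lemma local_map_chart i a p : chart_dom i p ->
  local_map phi i a (chart i p) = chart a (phi p).
Proof. by move=> ip; rewrite /local_map/= chartK. Qed.

Lemma local_map_img i a x : local_dom phi i a x ->
  (chart a @` chart_dom a) (local_map phi i a x).
Proof. by move=> [p [ip ap] <-]; rewrite local_map_chart//; exists (phi p). Qed.

Lemma local_map_smooth i a : smooth_on (local_dom phi i a) (local_map phi i a).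
Proof. by case: phi_immersion => -[[_ H] _] _; exact: H. Qed.

Lemma local_map_iso i a k l x : local_dom phi i a x ->
  inner (metric a (local_map phi i a x)) (pd k (local_map phi i a) x)
    (pd l (local_map phi i a) x) = metric i x k l.
Proof.
move=> ix; have du := smooth_diff (@local_map_smooth i a) ix.
by case: phi_immersion => _ /(_ i a x ix)/= <-; rewrite pullback_entry.
Qed.

Definition det_shape i a x := \det (shape_H (metric i) (metric a) (local_map phi i a) x).

(** det_shape_change on the part of M where all four charts are defined. *)
Lemma det_shape_chart i j a b p : chart_dom i p -> chart_dom j p ->
  chart_dom a (phi p) -> chart_dom b (phi p) ->
  det_shape i a (chart i p) = det_shape j b (chart j p).
Proof.
move=> ip jp ap bp.
pose V : set M := chart_dom j `&` (phi @^-1` chart_dom a `&` phi @^-1` chart_dom b).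
have oV : open V by apply: openI; [exact: chart_open|apply: openI; exact: open_preimage_chart].
pose A := chart i @` (chart_dom i `&` V).
pose B := chart a @` (chart_dom a `&` chart_dom b).
have oA : open A by exact: open_chart_image.
have oB : open B by apply: open_chart_image; exact: chart_open.
have Ap : A (chart i p) by exists p.
have Aij x : A x -> (chart i @` (chart_dom i `&` chart_dom j)) x.
  by move=> [q [iq [jq _]] <-]; exists q.
have Aia x : A x -> local_dom phi i a x by move=> [q [iq [_ [aq _]]] <-]; exists q.
have st : smooth_on A (chart j \o chart_inv i).
  by move=> l x /Aij; exact: (@chart_trans_smooth _ _ M i j).
have ss : smooth_on B (chart b \o chart_inv a) := @chart_trans_smooth _ _ N a b.
have -> : chart j p = (chart j \o chart_inv i) (chart i p) by rewrite /= chartK.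
apply: (@det_shape_change R 2 n (metric i) (metric j) (metric a) (metric b)
  A (local_dom phi j b) B (chart b @` chart_dom b)
  (chart j \o chart_inv i) (chart b \o chart_inv a)
  (local_map phi i a) (local_map phi j b)) => //.
- by apply: metric_on_chart => // x /Aia/local_dom_sub.
- by apply: metric_on_chart; [exact: local_dom_open|exact: local_dom_sub].
- by apply: metric_on_chart => // _ [q [aq _] <-]; exists q.
- by apply: metric_on_chart; [exact: chart_img_open|].
- by move=> _ [q [iq [jq [_ bq]]] <-]; rewrite /= chartK//; exists q.
- by move=> _ [q [aq bq] <-]; rewrite /= chartK//; exists q.
- by move=> l x /Aia; exact: local_map_smooth.
- by move=> _ [q [iq [jq [aq bq]]] <-]; rewrite local_map_chart//; exists (phi q).
- exact: local_map_smooth.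
- move=> k l x Ax; rewrite (metric_change (Aij _ Ax)) pullback_entry//.
  exact: smooth_diff st Ax.
- move=> k l y By; rewrite [in RHS](metric_change By) pullback_entry//.
  exact: smooth_diff ss By.
- move=> _ [q [iq [jq [aq bq]]] <-].
  by rewrite local_map_chart//= !chartK// -[RHS]/(local_map phi j b (chart j q)) local_map_chart.
Qed.

(** An arbitrary choice of charts at each point turns det_shape into a function
    on M; by det_shape_chart it can be computed in any other charts. *)
Definition chart_at p : chart_index M := sval (cid (chart_cover p)).
Definition target_chart_at p : chart_index N := sval (cid (chart_cover (phi p))).
Definition det_shape_at p := det_shape (chart_at p) (target_chart_at p) (chart (chart_at p) p).

Lemma det_shape_atE i a p : chart_dom i p -> chart_dom a (phi p) ->
  det_shape_at p = det_shape i a (chart i p).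
Proof.
by move=> ip ap; apply: det_shape_chart => //;
  [exact: (svalP (cid (chart_cover p)))|exact: (svalP (cid (chart_cover (phi p))))].
Qed.

Variable c : R.
Hypothesis Hc : forall i a x, local_dom phi i a x ->
    mean_curvature_sqnorm (metric i) (metric a) (local_map phi i a) x = c.
Hypothesis phi_biharmonic : biharmonic_map phi.
Hypothesis K_ge0 : nonneg_gauss_curvature M.

Lemma near_chart i a p : chart_dom i p -> chart_dom a (phi p) ->
  \forall q \near p, det_shape_at q = det_shape i a (chart i q).
Proof.
move=> ip ap.
have n1 := open_nbhs_nbhs (conj (@chart_open _ _ M i) ip).
have n2 := open_nbhs_nbhs (conj (@open_preimage_chart a) (ap : (phi @^-1` chart_dom a) p)).
by apply: filterS2 n1 n2 => q iq aq; exact: det_shape_atE.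
Qed.

Let metM i a : metric_on (local_dom phi i a) (metric i).
Proof. by apply: metric_on_chart; [exact: local_dom_open|exact: local_dom_sub]. Qed.
Let metN a : metric_on (chart a @` chart_dom a) (metric a).
Proof. by apply: metric_on_chart; [exact: chart_img_open|]. Qed.
Let pos i a x : local_dom phi i a x ->
  forall X : 'rV[R]_2, X != 0 -> 0 < inner (metric i x) X X.
Proof. by move=> /local_dom_sub; exact: metric_pos. Qed.

Lemma det_shape_at_continuous : continuous det_shape_at.
Proof.
move=> p; have [i ip] := chart_cover p; have [a ap] := chart_cover (phi p).
have nE := near_chart ip ap.
have ix : local_dom phi i a (chart i p) by exists p.
have sd : smooth_on (local_dom phi i a) (det_shape i a).
  exact: (smooth_det_shape (metM i a) (metN a) (@local_map_smooth i a) (@local_map_img i a)).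
have cd : {for chart i p, continuous (det_shape i a)}.
  by apply: differentiable_continuous; exact: smooth_diff sd ix.
have cc : {for p, continuous (det_shape i a \o chart i)}.
  by apply: continuous_comp => //; exact: chart_continuous.
rewrite /continuous_at (det_shape_atE ip ap).
apply: cvg_trans cc; apply: near_eq_cvg.
by apply: filterS nE => q ->.
Qed.

(** The function is continuous, so it attains a minimum on M; the set where it
    equals this minimum is closed, open by det_shape_min_local, and not
    empty. *)
Lemma det_shape_at_const : connected [set: M] -> compact [set: M] ->
  exists D : R, forall p, det_shape_at p = D.
Proof.
move=> Mconn Mcomp.
have [[p0 _]|M0] := pselect (exists p : M, True); last first.
  by exists 0 => p; exfalso; apply: M0; exists p.
have [||p _ pmin] := @compact_EVT_min M R det_shape_at setT _ Mcomp.
- by exists p0.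
- by apply: continuous_subspaceT; exact: det_shape_at_continuous.
have {}pmin q : det_shape_at p <= det_shape_at q by apply: pmin; rewrite inE.
pose S := [set q : M | det_shape_at q = det_shape_at p].
exists (det_shape_at p) => q; suff : S q by [].
suff -> : S = setT by [].
apply: Mconn.
- by exists p.
- exists S; last by rewrite setTI.
  rewrite openE => r Sr; have [i ir] := chart_cover r; have [a ar] := chart_cover (phi r).
  have nE := near_chart ir ar.
  have ix : local_dom phi i a (chart i r) by exists r.
  have nD : \forall x \near chart i r, det_shape i a x = det_shape_at p.
    apply: (det_shape_min_local (metM i a) (metN a) (@pos i a) (@local_map_smooth i a)
      (@local_map_img i a) (@local_map_iso i a) (@phi_biharmonic i a) (@Hc i a)) => //.
    + by move=> x /local_dom_sub; exact: K_ge0.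
    + move=> _ [s [is_ as_] <-]; rewrite -[\det _]/(det_shape i a (chart i s)).
      by rewrite -(det_shape_atE is_ as_).
    + by rewrite -[\det _]/(det_shape i a (chart i r)) -(det_shape_atE ir ar).
  have nD' : \forall s \near r, det_shape i a (chart i s) = det_shape_at p.
    exact: (chart_continuous ir nD).
  by apply: filterS2 nE nD' => s e1 e2; rewrite /S/= e1 e2.
- exists S; last by rewrite setTI.
  rewrite (_ : S = det_shape_at @^-1` [set det_shape_at p]); last first.
    by apply/seteqP; split.
  by apply: preimage_closed; [move=> x _; exact: det_shape_at_continuous|exact: closed_eq].
Qed.

End Global.

Theorem corollary4 (R : realType) (n : nat) (M : riemannian R 2)
  (N : riemannian R n) (phi : M -> N)
  (Mconnected : connected [set: M])
  (Mcompact : compact [set: M])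
  (phi_immersion : riemannian_immersion phi)
  (phi_proper : proper_biharmonic phi)
  (H_const : constant_mean_curvature_sqnorm phi)
  (K_ge0 : nonneg_gauss_curvature M) :
  shape_H_parallel phi /\ (flat M \/ pseudo_umbilical phi).
Proof.
have [c Hc] := H_const; have [bih _] := phi_proper.
have [D ED] := det_shape_at_const phi_immersion Hc bih K_ge0 Mconnected Mcompact.
have key i a x (ix : local_dom phi i a x) :
  [/\ forall k l, nabla_endo (metric i) (shape_H (metric i) (metric a) (local_map phi i a)) k l x = 0,
    gauss_curvature (metric i) x * (c ^+ 2 - D) = 0 &
    c ^+ 2 = D -> shape_H (metric i) (metric a) (local_map phi i a) x = c%:M].
  apply: (det_shape_const _ _ _ (@local_map_smooth _ _ _ _ _ phi_immersion i a)
    (@local_map_img _ _ _ _ phi i a) (@local_map_iso _ _ _ _ _ phi_immersion i a)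
    (bih i a) (Hc i a) _ _ ix).
  - apply: metric_on_chart; [exact: local_dom_open|exact: local_dom_sub].
  - by apply: metric_on_chart; [exact: chart_img_open|].
  - by move=> y /local_dom_sub; exact: metric_pos.
  - by move=> y /local_dom_sub; exact: K_ge0.
  - move=> _ [p [ip ap] <-]; rewrite -[\det _]/(det_shape phi i a (chart i p)).
    by rewrite -(det_shape_atE phi_immersion ip ap).
split; first by move=> i a x /key[].
have [cD|cD] := eqVneq (c ^+ 2) D.
  by right => i a x /[dup] ix /key[_ _ ->//]; rewrite (Hc _ _ _ ix).
left => i _ [p ip <-]; have [a ap] := chart_cover (phi p).
have /key[_ /eqP] : local_dom phi i a (chart i p) by exists p.
by rewrite mulf_eq0 subr_eq0 (negbTE cD) orbF => /eqP.
Qed.
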